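(* For $n\ge 2$, $i\mathsf{RCA}_0^\omega$ proves \[\mathsf{WKL}n \equiv_W \mathsf{WKL} \equiv_W \widehat{\mathsf{LLPO}} \equiv_W \mathsf{GC}n \equiv_W \mathsf{GC}2.\]
   Context: $i\mathsf{RCA}_0^\omega$ is Kohlenbach's higher-order base system $\mathsf{RCA}_0^\omega$ with intuitionistic logic. $\mathsf{WKL}n$: given a tree $T\subseteq n^{<\mathbb N}$ (coded by a function via a fixed coding of $n^{<\mathbb N}$) containing a sequence of every length $m$, output an infinite path through $T$; $\mathsf{WKL}=\mathsf{WKL}2$. $\mathsf{LLPO}$: given $p:\mathbb N\to\mathbb N$, output $n$ such that: if $n=0$ then for every $j$ with $p(j)\ne0$ and $p(t)=0$ for all $t<j$, $j$ is odd; if $n\ne0$ then $n=1$ and for every such $j$, $j$ is even. Graphs have vertex set $\mathbb N$, coded by functions $e:\mathbb N\to\mathbb N$ via a fixed primitive recursive bijection of $\mathbb N$ onto $\{(a,b):a<b\}$; $G_m$ is the subgraph on $\{0,\dots,m\}$. $\mathsf{GC}k$: given $G$ such that every $G_m$ has a $k$-coloring, output a $k$-coloring $f:\mathbb N\to k$ of $G$ (adjacent vertices get distinct colors). For a problem $\mathsf P$, $\widehat{\mathsf P}$ takes a sequence of $\mathsf P$-inputs and outputs a sequence of corresponding $\mathsf P$-solutions. For $\mathsf P:\forall x(p_1(x)\to\exists y\,p_2(x,y))$, $\mathsf Q:\forall u(q_1(u)\to\exists v\,q_2(u,v))$, formalized $\mathsf Q\le_W\mathsf P$ is $\exists\Phi\exists\Psi\forall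 u\forall y\,(q_1(u)\to(p_1(\Phi(u))\land(p_2(\Phi(u),y)\to q_2(u,\Psi(y)))))$ with $\Phi,\Psi$ of type $1\to1$; $\equiv_W$ means both directions. *)

(* Defs.v *)
From Stdlib Require Import List.
Import ListNotations.
Set Implicit Arguments.
Unset Strict Implicit.
Unset Printing Implicit Defensive.

(* The terms and formulas of higher-type arithmetic are intrinsically typed;
   a context is the list of the types of the free de Bruijn variables. *)

Declare Scope ty_scope.
Delimit Scope ty_scope with ty.
Declare Scope tm_scope.
Delimit Scope tm_scope with tm.
Declare Scope fm_scope.
Delimit Scope fm_scope with fm.

Inductive ty : Type :=
| N : ty
| Arr : ty -> ty -> ty.
Bind Scope ty_scope with ty.
Notation "s ~> t" := (Arr s t) (at level 55, right associativity) : ty_scope.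
Local Open Scope ty_scope.

Notation T1 := (N ~> N).
Notation T11 := (T1 ~> T1).

Inductive var : list ty -> ty -> Type :=
| VZ G s : var (s :: G) s
| VS G s t : var G s -> var (t :: G) s.
Arguments VZ {G s}.
Arguments VS {G s t} _.

(* [Pi], [Sigma] are the typed combinators K and S; [Rec] is the recursor R_0
   for primitive recursion with values of type 0. *)
Inductive term (G : list ty) : ty -> Type :=
| Var s : var G s -> term G s
| App s t : term G (s ~> t) -> term G s -> term G t
| Zero : term G N
| Succ : term G (N ~> N)
| Pi s t : term G (s ~> t ~> s)
| Sigma r s t : term G ((r ~> s ~> t) ~> (r ~> s) ~> r ~> t)
| Rec : term G (N ~> N ~> (N ~> N ~> N) ~> N).
Bind Scope tm_scope with term.
Arguments Var {G s} _.
Arguments App {G s t} _ _.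
Arguments Zero {G}.
Arguments Succ {G}.
Arguments Pi {G s t}.
Arguments Sigma {G r s t}.
Arguments Rec {G}.
Notation "f @ a" := (App f a) (at level 40, left associativity) : tm_scope.
Local Open Scope tm_scope.

(* The only prime formulas besides [Bot] are equations of type 0. *)
Inductive form : list ty -> Type :=
| Eq G : term G N -> term G N -> form G
| Bot G : form G
| And G : form G -> form G -> form G
| Or G : form G -> form G -> form G
| Imp G : form G -> form G -> form G
| All G s : form (s :: G) -> form G
| Ex G s : form (s :: G) -> form G.
Bind Scope fm_scope with form.
Arguments Bot {G}.
Arguments All {G} s _.
Arguments Ex {G} s _.
Notation "a == b" := (Eq a%tm b%tm) (at level 70, no associativity) : fm_scope.
Notation "A /\ B" := (And A B) : fm_scope.
Notation "A \/ B" := (Or A B) : fm_scope.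
Notation "A ==> B" := (Imp A B) (at level 90, right associativity) : fm_scope.
Notation "a != b" := (Imp (Eq a%tm b%tm) Bot)
  (at level 70, no associativity) : fm_scope.
Local Open Scope fm_scope.

Definition Top {G} : form G := Bot ==> Bot.

Fixpoint qf G (A : form G) : Prop :=
  match A with
  | Eq _ _ | Bot => True
  | And A B | Or A B | Imp A B => (qf A /\ qf B)%type
  | All _ _ | Ex _ _ => False
  end.

Definition vcase G r (P : ty -> Type) (z : P r) (f : forall s, var G s -> P s)
    s (x : var (r :: G) s) : P s :=
  match x in var D s' return
    match D with
    | [] => unit
    | r' :: G' => forall P, P r' -> (forall s, var G' s -> P s) -> P s'
    end
  with
  | VZ => fun _ z _ => z
  | VS y => fun _ _ f => f _ y
  end P z f.

Definition sub G D := forall s, var G s -> term D s.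

Fixpoint tsubst G D (f : sub G D) s (t : term G s) : term D s :=
  match t with
  | Var x => f _ x
  | App t u => tsubst f t @ tsubst f u
  | Zero => Zero
  | Succ => Succ
  | Pi => Pi
  | Sigma => Sigma
  | Rec => Rec
  end.

Definition ids {G} : sub G G := fun s x => Var x.
Definition shift {G r} : sub G (r :: G) := fun s x => Var (VS x).
Definition wk {G r s} (t : term G s) : term (r :: G) s := tsubst shift t.
Definition scons G D r (t : term D r) (f : sub G D) : sub (r :: G) D :=
  vcase (P := term D) t f.
Definition up G D r (f : sub G D) : sub (r :: G) (r :: D) :=
  scons (Var VZ) (fun s x => wk (f s x)).

Fixpoint fsubst G (A : form G) : forall D, sub G D -> form D :=
  match A with
  | Eq a b => fun D f => tsubst f a == tsubst f b
  | Bot => fun D f => Bot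
  | And A B => fun D f => fsubst A f /\ fsubst B f
  | Or A B => fun D f => fsubst A f \/ fsubst B f
  | Imp A B => fun D f => fsubst A f ==> fsubst B f
  | All s A => fun D f => All s (fsubst A (up f))
  | Ex s A => fun D f => Ex s (fsubst A (up f))
  end.

Definition fwk {G r} (A : form G) : form (r :: G) := fsubst A shift.
Definition inst G r (A : form (r :: G)) (t : term G r) : form G :=
  fsubst A (scons t ids).

Definition v0 {G r} : term (r :: G) r := Var VZ.
Definition v1 {G r s} : term (s :: r :: G) r := Var (VS VZ).
Definition v2 {G r s t} : term (t :: s :: r :: G) r := Var (VS (VS VZ)).
Definition v3 {G r s t u} : term (u :: t :: s :: r :: G) r :=
  Var (VS (VS (VS VZ))).

(* Equality at higher types is the usual extensional abbreviation. *)
Fixpoint eqt s : forall G, term G s -> term G s -> form G :=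
  match s with
  | N => fun G a b => a == b
  | r ~> t => fun G a b => All r (eqt (wk a @ v0) (wk b @ v0))
  end.

(* A(x, y) |-> A(x, Y x), from the context y, x, G to the context x, Y, G. *)
Definition ac_sub G : sub (N :: T1 :: G) (T1 :: (T1 ~> N) :: G) :=
  scons (v1 @ v0) (scons v0 (fun s x => Var (VS (VS x)))).

(* iRCA_0^omega: natural deduction for intuitionistic many-sorted predicate
   logic, with the axioms of Kohlenbach's RCA_0^omega: type-0 equality,
   successor, [Pi], [Sigma], R_0, full extensionality, quantifier-free
   induction and QF-AC^{1,0}. *)
Inductive prf : forall G, list (form G) -> form G -> Prop :=
| Hyp G (H : list (form G)) A : In A H -> prf H A
| BotE G (H : list (form G)) A : prf H Bot -> prf H A
| AndI G (H : list (form G)) A B : prf H A -> prf H B -> prf H (A /\ B)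
| AndE1 G (H : list (form G)) A B : prf H (A /\ B) -> prf H A
| AndE2 G (H : list (form G)) A B : prf H (A /\ B) -> prf H B
| OrI1 G (H : list (form G)) A B : prf H A -> prf H (A \/ B)
| OrI2 G (H : list (form G)) A B : prf H B -> prf H (A \/ B)
| OrE G (H : list (form G)) A B C :
    prf H (A \/ B) -> prf (A :: H) C -> prf (B :: H) C -> prf H C
| ImpI G (H : list (form G)) A B : prf (A :: H) B -> prf H (A ==> B)
| ImpE G (H : list (form G)) A B : prf H (A ==> B) -> prf H A -> prf H B
| AllI G (H : list (form G)) s (A : form (s :: G)) :
    prf (map fwk H) A -> prf H (All s A)
| AllE G (H : list (form G)) s (A : form (s :: G)) (t : term G s) :
    prf H (All s A) -> prf H (inst A t)
| ExI G (H : list (form G)) s (A : form (s :: G)) (t : term G s) :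
    prf H (inst A t) -> prf H (Ex s A)
| ExE G (H : list (form G)) s (A : form (s :: G)) C :
    prf H (Ex s A) -> prf (A :: map fwk H) (fwk C) -> prf H C
| EqRefl G (H : list (form G)) a : prf H (a == a)
| EqSubst G (H : list (form G)) (A : form (N :: G)) a b :
    prf H (a == b) -> prf H (inst A a) -> prf H (inst A b)
| SuccNZ G (H : list (form G)) a : prf H (Succ @ a != Zero)
| SuccInj G (H : list (form G)) a b :
    prf H (Succ @ a == Succ @ b ==> a == b)
| PiEq G (H : list (form G)) s t (a : term G s) (b : term G t) :
    prf H (eqt (Pi @ a @ b) a)
| SigmaEq G (H : list (form G)) r s t
    (a : term G (r ~> s ~> t)) (b : term G (r ~> s)) (c : term G r) :
    prf H (eqt (Sigma @ a @ b @ c) (a @ c @ (b @ c)))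
| RecZ G (H : list (form G)) b f : prf H (Rec @ Zero @ b @ f == b)
| RecS G (H : list (form G)) a b f :
    prf H (Rec @ (Succ @ a) @ b @ f == f @ (Rec @ a @ b @ f) @ a)
| Ext G (H : list (form G)) s t (f : term G (s ~> t)) (a b : term G s) :
    prf H (eqt a b ==> eqt (f @ a) (f @ b))
| QFInd G (H : list (form G)) (A : form (N :: G)) : qf A ->
    prf H (inst A Zero) ->
    prf H (All N (A ==> fsubst A (scons (Succ @ v0) shift))) ->
    prf H (All N A)
| QFAC G (H : list (form G)) (A : form (N :: T1 :: G)) : qf A ->
    prf H (All T1 (Ex N A) ==>
           Ex (T1 ~> N) (All T1 (fsubst A (@ac_sub G)))).

Definition iRCA0w (A : form []) : Prop := prf [] A.

(* Abstraction of [v0], by the usual translation into combinators. *)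
Fixpoint lam {G r s} (t : term (r :: G) s) : term G (r ~> s) :=
  match t with
  | Var x =>
      vcase (P := fun s => term G (r ~> s))
        (Sigma (s := r ~> r) @ Pi @ Pi) (fun s y => Pi @ Var y) x
  | App t u => Sigma @ lam t @ lam u
  | Zero => Pi @ Zero
  | Succ => Pi @ Succ
  | Pi => Pi @ Pi
  | Sigma => Pi @ Sigma
  | Rec => Pi @ Rec
  end.

Fixpoint num {G} (n : nat) : term G N :=
  match n with O => Zero | S n => Succ @ num n end.

(* [primrec z f m] is the m-th iterate: value [z] at 0, and [f], which lives
   under two binders, gets the previous value as [v1] and the index as [v0]. *)
Definition primrec {G} (z : term G N) (f : term (N :: N :: G) N)
  (m : term G N) : term G N := Rec @ m @ z @ lam (lam f).

Definition add {G} (a b : term G N) : term G N := primrec a (Succ @ v1) b.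
Definition mul {G} (a b : term G N) : term G N :=
  primrec Zero (add v1 (wk (wk a))) b.
Definition pred {G} (a : term G N) : term G N := primrec Zero v0 a.
Definition monus {G} (a b : term G N) : term G N := primrec a (pred v1) b.

Definition le {G} (a b : term G N) : form G := monus a b == Zero.
Definition lt {G} (a b : term G N) : form G := le (Succ @ a) b.
Definition even {G} (a : term G N) : form G :=
  Ex N (wk a == add v0 v0).
Definition odd {G} (a : term G N) : form G :=
  Ex N (wk a == Succ @ add v0 v0).

(* [sumbelow b] = 0 + 1 + ... + (b - 1). *)
Definition sumbelow {G} (b : term G N) : term G N := primrec Zero (add v1 v0) b.
(* The inverse of a primitive recursive bijection of N onto the set of pairs
   a < b (colexicographic order). *)
Definition ecode {G} (a b : term G N) : term G N := add (sumbelow b) a.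
(* Cantor pairing, a bijection of N x N onto N. *)
Definition pair {G} (i j : term G N) : term G N :=
  ecode i (Succ @ add i j).

(* Bijective coding of the finite sequences over {0, ..., n-1} by numbers
   (bijective base-n numeration): the empty sequence is 0, and appending the
   entry i < n to the sequence coded by c gives n * c + i + 1. *)
Definition snoc {G} (n : nat) (c i : term G N) : term G N :=
  Succ @ add (mul (num n) c) i.
(* Code of the sequence f 0, ..., f (m - 1). *)
Definition restr {G} (n : nat) (f : term G T1) (m : term G N) : term G N :=
  primrec Zero (snoc n v1 (wk (wk f) @ v0)) m.
(* The codes of the sequences of length m form an interval, whose least
   element is the code of the constant sequence 0. *)
Definition minseq {G} (n : nat) (m : term G N) : term G N :=
  restr n (Pi @ Zero) m.
Definition has_length {G} (n : nat) (c m : term G N) : form G :=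
  le (minseq n m) c /\ lt c (minseq n (Succ @ m)).

(* A problem  forall x (pre x -> exists y, post x y)  with inputs x of type 1
   and outputs y of type [o]; in [post], y is [v0] and x is [v1]. *)
Record problem (o : ty) := Problem { pre : form [T1]; post : form [o; T1] }.

Definition inst1 {G} (A : form [T1]) (x : term G T1) : form G :=
  fsubst A (scons x (fun s (z : var [] s) => match z with end)).
Definition inst2 {G o} (A : form [o; T1]) (x : term G T1) (y : term G o)
  : form G :=
  fsubst A (scons y (scons x (fun s (z : var [] s) => match z with end))).

Definition weihrauch_le (Q P : problem T1) : form [] :=
  Ex T11 (* Phi = v3 *) (Ex T11 (* Psi = v2 *)
    (All T1 (* u = v1 *) (All T1 (* y = v0 *)
      (inst1 (pre Q) v1 ==>
       inst1 (pre P) (v3 @ v1) /\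
       (inst2 (post P) (v3 @ v1) v0 ==> inst2 (post Q) v1 (v2 @ v0)))))).

Definition weihrauch_equiv (P Q : problem T1) : form [] :=
  weihrauch_le P Q /\ weihrauch_le Q P.

(* Parallelization of a problem with numerical outputs; the i-th input in the
   sequence coded by x is j |-> x (pair i j). *)
Definition section {G} (x : term G T1) (i : term G N) : term G T1 :=
  lam (wk x @ pair (wk i) v0).
Definition parallelization (P : problem N) : problem T1 :=
  {| pre := All N (inst1 (pre P) (section v1 v0));
     post := All N (inst2 (post P) (section v2 v0) (v1 @ v0)) |}.

(* A sequence belongs to the tree [t] iff [t] does not vanish at its code. *)
Definition in_tree {G} (t : term G T1) (c : term G N) : form G :=
  t @ c != Zero.

Definition is_tree {G} (n : nat) (t : term G T1) : form G :=
  All N (* c *) (All N (* i *)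
    (lt v0 (num n) ==>
     in_tree (wk (wk t)) (snoc n v1 v0) ==> in_tree (wk (wk t)) v1)).

Definition bounded {G} (k : nat) (f : term G T1) : form G :=
  All N (lt (wk f @ v0) (num k)).

Definition WKL (n : nat) : problem T1 :=
  {| pre := is_tree n v0 /\
            All N (* m *) (Ex N (* c *) (has_length n v0 v1 /\ in_tree v2 v0));
     post := bounded n v0 /\ All N (* m *) (in_tree v2 (restr n v1 v0)) |}.

(* [j] is the least argument at which [p] does not vanish. *)
Definition first_nonzero {G} (p : term G T1) (j : term G N) : form G :=
  p @ j != Zero /\ All N (lt v0 (wk j) ==> wk p @ v0 == Zero).

Definition LLPO : problem N :=
  {| pre := Top;
     post :=
       (v0 == Zero ==> All N (first_nonzero v2 v0 ==> odd v0)) /\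
       (v0 != Zero ==>
        v0 == num 1 /\ All N (first_nonzero v2 v0 ==> even v0)) |}.

(* For a < b, the vertices a and b are adjacent in the graph [e] iff [e] does
   not vanish at the code of (a, b). *)
Definition adjacent {G} (e : term G T1) (a b : term G N) : form G :=
  e @ ecode a b != Zero.

Definition proper {G} (e f : term G T1) (a b : term G N) : form G :=
  adjacent e a b ==> f @ a != f @ b.

(* [f] restricted to {0, ..., m} is a k-coloring of G_m. *)
Definition fin_coloring {G} (k : nat) (e f : term G T1) (m : term G N)
  : form G :=
  All N (le v0 (wk m) ==> lt (wk f @ v0) (num k)) /\
  All N (* b *) (All N (* a *)
    (lt v0 v1 ==> le v1 (wk (wk m)) ==> proper (wk (wk e)) (wk (wk f)) v0 v1)).

Definition coloring {G} (k : nat) (e f : term G T1) : form G :=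
  bounded k f /\
  All N (* b *) (All N (* a *)
    (lt v0 v1 ==> proper (wk (wk e)) (wk (wk f)) v0 v1)).

Definition GC (k : nat) : problem T1 :=
  {| pre := All N (* m *) (Ex T1 (* f *) (fin_coloring k v2 v0 v1));
     post := coloring k v1 v0 |}.

(* Main.v *)
(* The equivalences follow from the cycle LLPO^ <= GCk <= WKLk <= LLPO^ for
   every k >= 2.
   WKLk <= LLPO^: for a node and one of its children, LLPO decides which dies out
   first, the subtree above the child or those above all the later siblings of
   the child.  Following the answers, a node with a descendant at level s is
   always left for a child with a descendant at level s; for fixed s this is an
   induction over a quantifier-free predicate.
   GCk <= WKLk: the k-colorings of the initial segments of a graph form a tree.
   LLPO^ <= GCk: for each instance p, take an infinite path and a further vertex,
   which is joined to the path at a position of the same parity as the first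
   nonzero argument of p; a clique of k - 2 vertices that are joined to all
   others leaves two colors for these vertices.

   Derivations are obtained from truth in term models.  As quantifier-free
   formulas are provably decidable, a theory that is maximal among those not
   proving A decides them, so in its term model truth of formulas without
   universal quantifiers (outside of premises) implies provability, and
   provability of formulas without existential quantifiers (outside of premises)
   implies truth.  The term model satisfies induction for predicates with a
   characteristic function, because bounded search, a term, finds the place where
   the induction step fails. *)

From Stdlib Require Import List Arith Lia FunctionalExtensionality
  PropExtensionality ProofIrrelevance Classical ClassicalEpsilon Ring.
From mathcomp Require boolp classical_sets.
Require Import Defs.
Import ListNotations.
Set Implicit Arguments.
Unset Strict Implicit.
Unset Printing Implicit Defensive.
Unset Asymmetric Patterns.
Set Bullet Behavior "Strict Subproofs".
Local Open Scope ty_scope.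
Local Open Scope tm_scope.
Local Open Scope fm_scope.

(** * Substitution and derived rules *)

(** The calculus is intuitionistic and its terms are combinators, so long derivations are avoided:
    inside a model the arguments are ordinary classical mathematics over a semiring with induction.
    The price is a restriction on formulas. A prime theory may contain an existential formula
    without a witness among the terms of the context, and truth of a universal formula in the term
    model gives only its instances by such terms. Hence universal quantifiers of a goal and
    existential ones of a hypothesis are removed by the rules of the calculus before a model is
    entered; this dictates the layout of the reductions. The question put to LLPO is which of two
    extinctions comes first; any answer is right when neither occurs. Extinction of a node at depth
    r sits at index 2r of the instance and that of its later siblings at 2r + 1, so parity names the
    loser. Comparing a child with all its later siblings together turns a choice among k children
    into at most k - 1 such questions. *)

Lemma var_ind G r (P : forall s, var (r :: G) s -> Prop) :
  P r VZ -> (forall s (y : var G s), P s (VS y)) -> forall s x, P s x.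
Proof.
intros Hz Hs s x.
refine (match x as x in var D s return
  match D return var D s -> Prop with
  | [] => fun _ => True
  | r :: G => fun x => forall P : forall s, var (r :: G) s -> Prop,
     P r VZ -> (forall s (y : var G s), P s (VS y)) -> P s x
  end x with VZ => _ | VS y => _ end P Hz Hs); auto.
Qed.

Definition nov {P : ty -> Type} s (x : var [] s) : P s := match x with end.

Lemma sub_ext G (P : ty -> Type) (f g : forall s, var G s -> P s) :
  (forall s x, f s x = g s x) -> f = g.
Proof.
intro E; apply functional_extensionality_dep; intro s.
apply functional_extensionality; auto.
Qed.

Ltac var_cases :=
  lazymatch goal with |- forall s (x : var (?r :: ?G) s), @?P s x =>
    refine (@var_ind G r P _ _) end.
Ltac sub_cases := apply sub_ext; var_cases.

Lemma nov_ext (P : ty -> Type) (f g : forall s, var [] s -> P s) : f = g.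
Proof. apply sub_ext; intros s x; destruct (@nov (fun _ => False) s x). Qed.

Lemma tsubst_comp G D E (f : sub G D) (g : sub D E) s (t : term G s) :
  tsubst g (tsubst f t) = tsubst (fun s x => tsubst g (f s x)) t.
Proof. induction t; simpl; congruence. Qed.

Lemma tsubst_ids G s (t : term G s) : tsubst ids t = t.
Proof. induction t; simpl; unfold ids in *; congruence. Qed.

Lemma up_ids G r : up (@ids G) = @ids (r :: G).
Proof. sub_cases; reflexivity. Qed.

Lemma up_comp G D E r (f : sub G D) (g : sub D E) :
  (fun s x => tsubst (up g) (@up _ _ r f s x)) =
  up (fun s x => tsubst g (f s x)).
Proof.
sub_cases; [reflexivity|]; intros s y; cbn.
unfold wk; rewrite !tsubst_comp; f_equal.
Qed.

Lemma scons_comp G D E r (t : term D r) (f : sub G D) (g : sub D E) :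
  (fun s x => tsubst g (scons t f x)) =
  scons (tsubst g t) (fun s x => tsubst g (f s x)).
Proof. sub_cases; reflexivity. Qed.

Lemma up_scons G D E r (f : sub G D) (t : term E r) (g : sub D E) :
  (fun s x => tsubst (scons t g) (up f x)) =
  scons t (fun s x => tsubst g (f s x)).
Proof.
sub_cases; [reflexivity|]; intros s y; cbn.
unfold wk; rewrite tsubst_comp; reflexivity.
Qed.

Lemma tsubst_wk G D r s (t : term G s) (u : term D r) (f : sub G D) :
  tsubst (scons u f) (wk t) = tsubst f t.
Proof. unfold wk; rewrite tsubst_comp; reflexivity. Qed.

Lemma fsubst_ids G (A : form G) : fsubst A ids = A.
Proof.
induction A; simpl; rewrite ?up_ids, ?tsubst_ids; congruence.
Qed.

Lemma fsubst_comp G (A : form G) : forall D E (f : sub G D) (g : sub D E),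
  fsubst (fsubst A f) g = fsubst A (fun s x => tsubst g (f s x)).
Proof.
induction A; intros D E f g; simpl; rewrite ?tsubst_comp;
  try (rewrite IHA1, IHA2); try (rewrite IHA, up_comp); reflexivity.
Qed.

Lemma inst_up G D r (A : form (r :: G)) (f : sub G D) (t : term D r) :
  inst (fsubst A (up f)) t = fsubst A (scons t f).
Proof.
unfold inst; rewrite fsubst_comp, up_scons; f_equal.
sub_cases; [reflexivity|]; intros; cbn; apply tsubst_ids.
Qed.

Lemma fsubst_eqt s : forall G D (a b : term G s) (f : sub G D),
  fsubst (eqt a b) f = eqt (tsubst f a) (tsubst f b).
Proof.
induction s as [|r _ s IH]; intros G D a b f; [reflexivity|].
simpl; f_equal; rewrite IH; simpl.
unfold wk; rewrite !tsubst_comp; reflexivity.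
Qed.

Lemma qf_fsubst G (A : form G) : forall D (f : sub G D),
  qf A -> qf (fsubst A f).
Proof. induction A; simpl; intuition. Qed.

Lemma prf_weaken G (H : list (form G)) A :
  prf H A -> forall H', incl H H' -> prf H' A.
Proof.
induction 1; intros H' I; try solve [econstructor; eauto].
- eapply OrE; [eauto|apply IHprf2|apply IHprf3];
    intros x [|]; [left|right|left|right]; auto.
- apply ImpI, IHprf; intros x [|]; [left|right]; auto.
- apply AllI, IHprf; apply incl_map; auto.
- eapply ExE; [eauto|apply IHprf2].
  intros x [|]; [left|right]; auto; eapply incl_map; eauto.
Qed.

Lemma prf_cut G (L H : list (form G)) A :
  (forall B, In B L -> prf H B) -> prf L A -> prf H A.
Proof.
revert A; induction L as [|B L IH]; intros A HL P.
- apply (prf_weaken P); intros ? [].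
- apply ImpE with B; [apply IH|]; auto using in_eq, in_cons, ImpI.
Qed.

Lemma hyp0 G (H : list (form G)) A : prf (A :: H) A.
Proof. apply Hyp, in_eq. Qed.

Lemma prf_S G (H : list (form G)) A B : prf H A -> prf (B :: H) A.
Proof. intro P; apply (prf_weaken P), incl_tl, incl_refl. Qed.

(** These rules are stated for an unevaluated substitution [fsubst A f]. A nested formula such as a
    precondition is then taken apart by extending [f], without computing the substituted body. *)
Lemma AllE' G D (H : list (form D)) r (A : form (r :: G)) (f : sub G D) t :
  prf H (fsubst (All r A) f) -> prf H (fsubst A (scons t f)).
Proof. intro P; rewrite <- inst_up; exact (AllE t P). Qed.

Lemma ExI' G D (H : list (form D)) r (A : form (r :: G)) (f : sub G D) t :
  prf H (fsubst A (scons t f)) -> prf H (fsubst (Ex r A) f).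
Proof. intro P; rewrite <- inst_up in P; exact (ExI P). Qed.

Lemma ExE' G D (H : list (form D)) r (A : form (r :: G)) (f : sub G D) C :
  prf H (fsubst (Ex r A) f) -> prf (fsubst A (up f) :: map fwk H) (fwk C) ->
  prf H C.
Proof. exact (fun P => ExE P). Qed.
Lemma AllI' G D (H : list (form D)) r (A : form (r :: G)) (f : sub G D) :
  prf (map (@fwk D r) H) (fsubst A (up f)) -> prf H (fsubst (All r A) f).
Proof. exact (fun P => AllI P). Qed.
Lemma AndI' G D (H : list (form D)) (A B : form G) (f : sub G D) :
  prf H (fsubst A f) -> prf H (fsubst B f) -> prf H (fsubst (And A B) f).
Proof. exact (fun P Q => AndI P Q). Qed.
Lemma AndE1' G D (H : list (form D)) (A B : form G) (f : sub G D) :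
  prf H (fsubst (And A B) f) -> prf H (fsubst A f).
Proof. exact (fun P => AndE1 P). Qed.
Lemma AndE2' G D (H : list (form D)) (A B : form G) (f : sub G D) :
  prf H (fsubst (And A B) f) -> prf H (fsubst B f).
Proof. exact (fun P => AndE2 P). Qed.
Lemma ImpE' G D (H : list (form D)) (A B : form G) (f : sub G D) :
  prf H (fsubst (Imp A B) f) -> prf H (fsubst A f) -> prf H (fsubst B f).
Proof. exact (fun P Q => ImpE P Q). Qed.

Lemma eqt_app G (H : list (form G)) s t (f g : term G (s ~> t)) a :
  prf H (eqt f g) -> prf H (eqt (f @ a) (g @ a)).
Proof.
intro P; apply (AllE a) in P; unfold inst in P; fold eqt in P.
rewrite fsubst_eqt in P; cbn in P; rewrite !tsubst_wk, !tsubst_ids in P.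
exact P.
Qed.

Lemma eqt_intro G (H : list (form G)) s t (f g : term G (s ~> t)) :
  prf (map fwk H) (eqt (wk f @ v0) (wk g @ v0)) -> prf H (eqt f g).
Proof. exact (fun P => AllI P). Qed.

Lemma eqt_refl s : forall G (H : list (form G)) (a : term G s),
  prf H (eqt a a).
Proof.
induction s; intros; [apply EqRefl|apply eqt_intro; auto].
Qed.

(** Induction on the type, for an equation that is a member of the hypothesis list: [map fwk]
    carries a member under the next binder, whereas carrying a derivation there would require
    renaming inside derivations. A derivable equation is reduced to this case by a cut. Transitivity
    is organized in the same way. *)
Lemma eqt_sym s : forall G (H : list (form G)) (a b : term G s),
  prf H (eqt a b) -> prf H (eqt b a).
Proof.
assert (E : forall s G (H : list (form G)) (a b : term G s),
  In (eqt a b) H -> prf H (eqt b a)).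
{ clear; induction s as [|r _ s IH]; intros G H a b I.
  - assert (P := @EqSubst G H (v0 == wk a) a b (Hyp I)).
    unfold inst in P; cbn in P; rewrite !tsubst_wk, !tsubst_ids in P.
    apply P, EqRefl.
  - apply eqt_intro.
    apply ImpE with (eqt (wk a @ v0) (wk b @ v0)).
    + apply ImpI, IH, in_eq.
    + apply eqt_app; apply (in_map (@fwk G r)) in I.
      unfold fwk at 1 in I; rewrite fsubst_eqt in I; exact (Hyp I). }
intros G H a b P; apply ImpE with (eqt a b); auto.
apply ImpI, E, in_eq.
Qed.

Lemma eqt_trans s : forall G (H : list (form G)) (a b c : term G s),
  prf H (eqt a b) -> prf H (eqt b c) -> prf H (eqt a c).
Proof.
assert (E : forall s G (H : list (form G)) (a b c : term G s),
  In (eqt a b) H -> In (eqt b c) H -> prf H (eqt a c)).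
{ clear; induction s as [|r _ s IH]; intros G H a b c I J.
  - assert (P := @EqSubst G H (wk a == v0) b c (Hyp J)).
    unfold inst in P; cbn in P; rewrite !tsubst_wk, !tsubst_ids in P.
    apply P, Hyp, I.
  - apply eqt_intro.
    apply (in_map (@fwk G r)) in I; apply (in_map (@fwk G r)) in J.
    unfold fwk at 1 in I; unfold fwk at 1 in J.
    rewrite fsubst_eqt in I, J.
    apply (prf_cut (L := [eqt (wk a @ v0) (wk b @ v0);
                          eqt (wk b @ v0) (wk c @ v0)])).
    + intros B [<-|[<-|[]]]; apply eqt_app; apply Hyp; assumption.
    + eapply IH; [left|right; left]; reflexivity. }
intros G H a b c P Q; apply (prf_cut (L := [eqt a b; eqt b c])).
- intros B [<-|[<-|[]]]; assumption.
- eapply E; [left|right; left]; reflexivity.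
Qed.

(** The extensionality axiom enters here; it makes application compatible with provable [eqt], hence
    well defined on classes of terms. *)
Lemma eqt_cong G (H : list (form G)) s t (f g : term G (s ~> t)) a b :
  prf H (eqt f g) -> prf H (eqt a b) -> prf H (eqt (f @ a) (g @ b)).
Proof.
intros P Q; apply eqt_trans with (f @ b).
- exact (ImpE (@Ext G H s t f a b) Q).
- apply eqt_app, P.
Qed.

(** * Combinatory models *)

(** Equality is that of the metatheory at every type, and no extensionality is required: elements
    that agree at all arguments may differ. *)
Record cmodel := CModel {
  car :> ty -> Type;
  ap : forall s t, car (s ~> t) -> car s -> car t;
  ze : car N;
  su : car (N ~> N);
  pi : forall s t, car (s ~> t ~> s);
  sg : forall r s t, car ((r ~> s ~> t) ~> (r ~> s) ~> r ~> t);
  rc : car (N ~> N ~> (N ~> N ~> N) ~> N);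
  piE : forall s t (a : car s) (b : car t), ap (ap (pi s t) a) b = a;
  sgE : forall r s t (a : car (r ~> s ~> t)) (b : car (r ~> s)) (c : car r),
    ap (ap (ap (sg r s t) a) b) c = ap (ap a c) (ap b c);
  rcZ : forall b f, ap (ap (ap rc ze) b) f = b;
  rcS : forall a b f, ap (ap (ap rc (ap su a)) b) f =
    ap (ap f (ap (ap (ap rc a) b) f)) a }.
Arguments ap {_ _ _} _ _.
Arguments ze {_}.
Arguments su {_}.
Arguments pi {_ s t}.
Arguments sg {_ r s t}.
Arguments rc {_}.

Declare Scope md_scope.
Delimit Scope md_scope with md.
Notation "f '$' a" := (ap f a) (at level 40, left associativity) : md_scope.
Local Open Scope md_scope.

(* The induction scheme is only for predicates with a characteristic function
   in the model; [eqd] makes equations such predicates. *)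
Record model := Model {
  cm :> cmodel;
  su_inj : forall a b : cm N, su $ a = su $ b -> a = b;
  su_nz : forall a : cm N, su $ a <> ze;
  zcase : forall a : cm N, a = ze \/ exists b, a = su $ b;
  eqd : cm (N ~> N ~> N);
  eqdP : forall a b, eqd $ a $ b = ze <-> a = b;
  model_ind : forall f : cm (N ~> N), f $ ze = ze ->
    (forall x, f $ x = ze -> f $ (su $ x) = ze) -> forall x, f $ x = ze }.

Definition env (M : ty -> Type) (G : list ty) := forall s, var G s -> M s.
Definition econs M G r (x : M r) (e : env M G) : env M (r :: G) :=
  vcase (P := M) x e.
Definition enil {M} : env M [] := @nov M.

Fixpoint eval (M : cmodel) G (e : env M G) s (t : term G s) : M s :=
  match t in term _ s return M s with
  | Var x => e _ x
  | App t u => eval e t $ eval e u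
  | Zero => ze
  | Succ => su
  | Pi => pi
  | Sigma => sg
  | Rec => rc
  end.

Fixpoint sat (M : cmodel) G (A : form G) : env M G -> Prop :=
  match A with
  | Eq a b => fun e => eval e a = eval e b
  | Bot => fun e => False
  | And A B => fun e => (sat A e /\ sat B e)%type
  | Or A B => fun e => (sat A e \/ sat B e)%type
  | Imp A B => fun e => sat A e -> sat B e
  | All s A => fun e => forall x : M s, sat A (econs x e)
  | Ex s A => fun e => exists x : M s, sat A (econs x e)
  end.

Lemma eval_tsubst (M : cmodel) G D (f : sub G D) (e : env M D) s (t : term G s) :
  eval e (tsubst f t) = eval (fun s x => eval e (f s x)) t.
Proof. induction t; simpl; congruence. Qed.

Lemma econs_eta (M : ty -> Type) G r (e : env M (r :: G)) :
  e = econs (e r VZ) (fun s x => e s (VS x)).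
Proof. sub_cases; reflexivity. Qed.

Lemma eval_up (M : cmodel) G D r (f : sub G D) (x : M r) (e : env M D) :
  (fun s y => eval (econs x e) (up f y)) =
  econs x (fun s y => eval e (f s y)).
Proof.
sub_cases; [reflexivity|]; intros s y; cbn.
unfold wk; rewrite eval_tsubst; reflexivity.
Qed.

Lemma eval_scons (M : cmodel) G D r (t : term D r) (f : sub G D) (e : env M D) :
  (fun s y => eval e (scons t f y)) = econs (eval e t) (fun s y => eval e (f s y)).
Proof. sub_cases; reflexivity. Qed.

Lemma sat_fsubst (M : cmodel) G (A : form G) : forall D (f : sub G D) (e : env M D),
  sat (fsubst A f) e <-> sat A (fun s x => eval e (f s x)).
Proof.
induction A; intros D f e; simpl; rewrite ?eval_tsubst, ?IHA1, ?IHA2;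
  try tauto.
- split; intros Q x; specialize (Q x);
    [rewrite IHA, eval_up in Q|rewrite IHA, eval_up]; exact Q.
- split; intros [x Q]; exists x;
    [rewrite IHA, eval_up in Q|rewrite IHA, eval_up]; exact Q.
Qed.

Lemma eval_wk (M : cmodel) G r s (t : term G s) (x : M r) (e : env M G) :
  eval (econs x e) (wk t) = eval e t.
Proof. unfold wk; rewrite eval_tsubst; reflexivity. Qed.

Lemma sat_fwk (M : cmodel) G r (A : form G) (x : M r) (e : env M G) :
  sat (fwk A) (econs x e) <-> sat A e.
Proof. unfold fwk; rewrite sat_fsubst; reflexivity. Qed.

Lemma eval_lam (M : cmodel) G r s (t : term (r :: G) s) (e : env M G) x :
  eval e (lam t) $ x = eval (econs x e) t.
Proof.
induction t as [s y|s t t1 IH1 t2 IH2| | | | |]; cbn; rewrite ?sgE, ?piE;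
  try congruence.
revert s y; var_cases; intros; cbn; rewrite ?sgE, ?piE; reflexivity.
Qed.

(** * Term models *)

Definition closed_theory G (Th : form G -> Prop) :=
  forall L A, (forall B, In B L -> Th B) -> prf L A -> Th A.

Section Quotient.
Variables (G : list ty) (Th : form G -> Prop) (Cl : closed_theory Th).

(** Classes of terms modulo provable [eqt], each represented by the predicate of its members.
    Propositional extensionality turns provable equality into equality of classes, so the equations
    of [cmodel] hold literally. *)
Definition quo s := {P : term G s -> Prop | exists a, P = fun b => Th (eqt a b)}.
Definition cls s (a : term G s) : quo s :=
  exist _ (fun b => Th (eqt a b)) (ex_intro _ a eq_refl).
Definition rep s (q : quo s) : term G s :=
  proj1_sig (constructive_indefinite_description _ (proj2_sig q)).

Lemma th0 A : prf [] A -> Th A.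
Proof. apply Cl; intros ? []. Qed.

Lemma th1 A B : prf [A] B -> Th A -> Th B.
Proof. intros P Q; apply (Cl (L := [A])); auto; intros ? [<-|[]]; auto. Qed.

Lemma th2 A B C : prf [A; B] C -> Th A -> Th B -> Th C.
Proof.
intros P Q R; apply (Cl (L := [A; B])); auto; intros ? [<-|[<-|[]]]; auto.
Qed.

Lemma cls_eq s (a b : term G s) : cls a = cls b <-> Th (eqt a b).
Proof.
split; intro E.
- apply (f_equal (@proj1_sig _ _)) in E; simpl in E.
  rewrite (equal_f E b); apply th0, eqt_refl.
- apply eq_sig_hprop; [intros; apply proof_irrelevance|]; simpl.
  apply functional_extensionality; intro c; apply propositional_extensionality.
  split; intro F; revert E F; apply th2.
  + apply eqt_trans with a; [apply eqt_sym|]; apply Hyp; simpl; auto.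
  + apply eqt_trans with b; apply Hyp; simpl; auto.
Qed.

Lemma cls_rep s (q : quo s) : cls (rep q) = q.
Proof.
apply eq_sig_hprop; [intros; apply proof_irrelevance|]; simpl.
unfold rep; destruct constructive_indefinite_description as [a E]; simpl.
symmetry; exact E.
Qed.

Lemma quo_ind s (P : quo s -> Prop) : (forall a, P (cls a)) -> forall q, P q.
Proof. intros E q; rewrite <- cls_rep; auto. Qed.

Definition qapp s t (f : quo (s ~> t)) (a : quo s) : quo t :=
  cls (rep f @ rep a).

Lemma cls_app s t (f : term G (s ~> t)) a :
  qapp (cls f) (cls a) = cls (f @ a).
Proof.
unfold qapp; apply cls_eq.
assert (Th (eqt (rep (cls f)) f)) as E by (apply cls_eq, cls_rep).
assert (Th (eqt (rep (cls a)) a)) as F by (apply cls_eq, cls_rep).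
revert E F; apply th2, eqt_cong; apply Hyp; simpl; auto.
Qed.

Program Definition qmodel : cmodel :=
  @CModel quo qapp (cls Zero) (cls Succ) (fun s t => cls Pi)
    (fun r s t => cls Sigma) (cls Rec) _ _ _ _.
Next Obligation.
revert a; apply quo_ind; intro a; revert b; apply quo_ind; intro b.
rewrite !cls_app; apply cls_eq, th0, PiEq.
Qed.
Next Obligation.
revert a; apply quo_ind; intro a; revert b; apply quo_ind; intro b.
revert c; apply quo_ind; intro c.
rewrite !cls_app; apply cls_eq, th0, SigmaEq.
Qed.
Next Obligation.
revert b; apply quo_ind; intro b; revert f; apply quo_ind; intro f.
rewrite !cls_app; apply cls_eq, th0, RecZ.
Qed.
Next Obligation.
revert a; apply quo_ind; intro a; revert b; apply quo_ind; intro b.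
revert f; apply quo_ind; intro f.
rewrite !cls_app; apply cls_eq, th0, RecS.
Qed.

Definition genv : env qmodel G := fun s x => cls (Var x).

Lemma eval_cls D (f : sub D G) s (t : term D s) :
  eval (M := qmodel) (fun s x => cls (f s x)) t = cls (tsubst f t).
Proof.
induction t; simpl; auto; rewrite IHt1, IHt2; apply cls_app.
Qed.

End Quotient.

(* Prime theories and truth in their term models *)
Local Close Scope fm_scope.

(** Zorn's lemma for preorders, applied to the good sets under inclusion: a nonempty chain is
    bounded by its union, an empty one by [S0]. *)
Lemma zorn_sets (X : Type) (good : (X -> Prop) -> Prop) (S0 : X -> Prop) :
  good S0 ->
  (forall Ch : (X -> Prop) -> Prop, (forall S, Ch S -> good S) ->
    (exists S, Ch S) ->
    (forall S S', Ch S -> Ch S' -> (forall x, S x -> S' x) \/ (forall x, S' x -> S x)) ->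
    good (fun x => exists S, Ch S /\ S x)) ->
  exists S, good S /\ forall S', good S' -> (forall x, S x -> S' x) ->
    forall x, S' x -> S x.
Proof.
intros g0 union.
pose (T := {S : X -> Prop | good S}).
pose (R := fun S S' : T =>
  boolp.asbool (forall x, proj1_sig S x -> proj1_sig S' x)).
destruct (@classical_sets.ZL_preorder T (exist _ S0 g0) R) as [S mS].
- intro S; apply (ssrbool.introT (boolp.asboolP _)); auto.
- intros S1 S2 S3 L1 L2; apply (ssrbool.introT (boolp.asboolP _)).
  apply (ssrbool.elimT (boolp.asboolP _)) in L1, L2; auto.
- intros Ch tot.
  destruct (classic (exists S, Ch S)) as [[S1 C1]|ne].
  + pose (C := fun S => exists g : good S, Ch (exist _ S g)).
    assert (gU : good (fun x => exists S, C S /\ S x)).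
    { apply union.
      - intros S [g _]; exact g.
      - exists (proj1_sig S1); destruct S1 as [S1 g1]; exists g1; exact C1.
      - intros S S' [g c] [g' c'].
        destruct (tot _ _ c c') as [L|L];
          apply (ssrbool.elimT (boolp.asboolP _)) in L; auto. }
    exists (exist _ _ gU); intros [S g] c.
    apply (ssrbool.introT (boolp.asboolP _)); simpl; intros x sx.
    exists S; split; [exists g|]; assumption.
  + exists (exist _ S0 g0); intros S c; destruct ne; eauto.
- exists (proj1_sig S); split; [exact (proj2_sig S)|]; intros S' g' L.
  specialize (mS (exist _ S' g')).
  exact (ssrbool.elimT (boolp.asboolP _)
    (mS (ssrbool.introT (boolp.asboolP _) L))).
Qed.

Definition derives G (S : form G -> Prop) A :=
  exists L, (forall B, In B L -> S B) /\ prf L A.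

Record prime_theory G (S : form G -> Prop) : Prop := {
  pt_closed : closed_theory S;
  pt_cons : ~ S Bot;
  pt_prime : forall A B, S (Or A B) -> S A \/ S B }.

(** Maximality is taken against the single formula [A], so a formula [B] outside the theory only
    yields a derivation of the implication from [B] to [A], not of the negation of [B]. This
    suffices for primeness: if both disjuncts were outside, their disjunction would give [A]. *)
Lemma lindenbaum G (H : list (form G)) A : ~ prf H A ->
  exists S, prime_theory S /\ (forall B, In B H -> S B) /\ ~ S A.
Proof.
intro np.
pose (good := fun S : form G -> Prop =>
  (forall B, In B H -> S B) /\ ~ derives S A).
assert (self : forall (S : form G -> Prop) B, S B -> derives S B).
{ intros S B s; exists [B]; split; [intros ? [<-|[]]; auto|apply hyp0]. }
destruct (@zorn_sets (form G) good (fun B => In B H)) as [S [[HS nA] mS]].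
- split; auto; intros [L [i p]]; apply np; exact (prf_weaken p i).
- intros Ch cg [S1 c1] tot; split.
  + intros B i; exists S1; split; auto; destruct (cg _ c1) as [h _]; exact (h _ i).
  + intros [L [i p]].
    assert (exists S, Ch S /\ forall B, In B L -> S B) as [S [c l]].
    { clear p; induction L as [|B L IH].
      - exists S1; split; auto; intros ? [].
      - destruct IH as [S [c l]]; [intros; apply i; right; auto|].
        destruct (i B) as [S' [c' b]]; [left; auto|].
        destruct (tot _ _ c c') as [s|s].
        + exists S'; split; auto; intros ? [<-|]; auto.
        + exists S; split; auto; intros ? [<-|]; auto. }
    destruct (cg _ c) as [_ h]; apply h; exists L; auto.
- assert (ext : forall B, S B \/ derives S (Imp B A)).
  { intro B; destruct (classic (S B)) as [s|ns]; [left; auto|right].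
    apply NNPP; intro nd; apply ns.
    apply (mS (fun C => S C \/ C = B)); auto.
    split; auto; intros [L [i p]]; apply nd.
    (* Every hypothesis in [L] is in [S] or equal to [B]; the filter keeps the former and [ImpI]
       discharges the latter. *)
    exists (filter (fun C =>
      if excluded_middle_informative (S C) then true else false) L).
    split.
    - intros C c; apply filter_In in c as [_ c].
      destruct excluded_middle_informative; [assumption|discriminate].
    - apply ImpI, (prf_weaken p); intros C c.
      destruct (classic (S C)) as [sc|nc].
      + right; apply filter_In; split; auto.
        destruct excluded_middle_informative; auto.
      + left; destruct (i _ c) as [|e]; [contradiction|auto]. }
  assert (comb : forall L B, (forall C, In C L -> derives S C) -> prf L B ->
    derives S B).
  { intros L B; revert B; induction L as [|C L IH]; intros B l p.
    - exists []; split; auto; intros ? [].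
    - destruct (l C) as [L1 [i1 p1]]; [left; auto|].
      destruct (IH (Imp C B)) as [L2 [i2 p2]];
        [intros; apply l; right; auto|apply ImpI, p|].
      exists (L1 ++ L2); split.
      + intros D d; apply in_app_or in d as [|]; auto.
      + apply ImpE with C; [apply (prf_weaken p2), incl_appr, incl_refl|
          apply (prf_weaken p1), incl_appl, incl_refl]. }
  assert (cl : forall B, derives S B -> S B).
  { intros B d; destruct (ext B) as [|e]; auto; destruct nA.
    apply (@comb [B; Imp B A]).
    - intros C [<-|[<-|[]]]; auto.
    - apply ImpE with B; apply Hyp; simpl; auto. }
  exists S; repeat split.
  + intros L B l p; apply cl; exists L; auto.
  + intro b; apply nA; apply (@comb [Bot]); [|apply BotE, hyp0].
    intros C [<-|[]]; auto.
  + intros B C s.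
    destruct (ext B) as [|b]; [left; auto|].
    destruct (ext C) as [|c]; [right; auto|]; destruct nA.
    apply (@comb [Or B C; Imp B A; Imp C A]).
    * intros D [<-|[<-|[<-|[]]]]; auto.
    * apply OrE with B C.
      -- apply hyp0.
      -- apply ImpE with B; apply Hyp; simpl; auto.
      -- apply ImpE with C; apply Hyp; simpl; auto.
  + exact HS.
  + intro a; apply nA, self, a.
Qed.

(* Formulas whose truth in the term model of a prime theory implies membership
   ([frag d true]), respectively follows from it ([frag d false]).  The flag
   [d] permits quantifier-free premises on the positive side, which requires
   that these are decided by the theory. *)
Fixpoint frag (d p : bool) G (A : form G) : Prop :=
  match A with
  | Eq _ _ | Bot => True
  | And A B | Or A B => (frag d p A /\ frag d p B)%type
  | Imp A B => if p then (d = true /\ qf A /\ frag d false A /\ frag d true B)%type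
               else (frag d true A /\ frag d false B)%type
  | All _ A => if p then False else frag d p A
  | Ex _ A => if p then frag d p A else False
  end.

Lemma frag_fsubst d p G (A : form G) : forall D (f : sub G D),
  frag d p A -> frag d p (fsubst A f).
Proof.
revert p; induction A; intros p D f; simpl; try tauto.
- intros []; split; auto.
- intros []; split; auto.
- destruct p; intuition auto using qf_fsubst.
- destruct p; auto.
- destruct p; auto.
Qed.

Section PrimeModel.
Variables (G : list ty) (S : form G -> Prop) (PS : prime_theory S).
Let Cl : closed_theory S := pt_closed PS.
Let M := qmodel Cl.

Lemma econs_cls D r (t : term G r) (f : sub D G) :
  (fun s (x : var (r :: D) s) => cls S (scons t f x)) =
  econs (M := M) (cls S t) (fun s x => cls S (f s x)).
Proof. sub_cases; reflexivity. Qed.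

(** Every element of the term model is the class of a term, which settles existential formulas on
    the positive side and universal ones on the negative side. Both directions are proved together
    because implication exchanges them. *)
Lemma sat_frag d : (d = true -> forall A, qf A -> S A \/ S (Imp A Bot)) ->
  forall D (A : form D) p (f : sub D G), frag d p A ->
  if p then sat (M := M) A (fun s x => cls S (f s x)) -> S (fsubst A f)
  else S (fsubst A f) -> sat (M := M) A (fun s x => cls S (f s x)).
Proof.
intros dec D A; induction A as [D a b|D|D A IHA B IHB|D A IHA B IHB|
  D A IHA B IHB|D s A IHA|D s A IHA]; intros p f; simpl.
- intros _; unfold M; rewrite !(eval_cls Cl f).
  destruct p; apply (@cls_eq _ _ Cl N).
- intros _; destruct p; [contradiction|apply (pt_cons PS)].
- intros [fA fB]; specialize (IHA _ f fA); specialize (IHB _ f fB).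
  destruct p.
  + intros [a b]; apply (th2 Cl (A := fsubst A f) (B := fsubst B f)); auto.
    apply AndI; apply Hyp; simpl; auto.
  + intro s; split; [apply IHA|apply IHB]; revert s; apply (th1 Cl);
      [eapply AndE1|eapply AndE2]; apply hyp0.
- intros [fA fB]; specialize (IHA _ f fA); specialize (IHB _ f fB).
  destruct p.
  + intros [a|a]; [apply IHA in a|apply IHB in a]; revert a; apply (th1 Cl);
      [apply OrI1|apply OrI2]; apply hyp0.
  + intro s; apply (pt_prime PS) in s; tauto.
- destruct p.
  (* If the theory contains the premise, the premise is true, hence so is the conclusion; if it
     contains the negation of the premise, it proves the implication outright. *)
  + intros [ed [q [fA fB]]] h.
    specialize (IHA _ f fA); specialize (IHB _ f fB); simpl in *.
    destruct (dec ed _ (qf_fsubst f q)) as [s|s].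
    * apply (th1 Cl (A := fsubst B f)); auto.
      apply ImpI, prf_S, hyp0.
    * revert s; apply (th1 Cl); apply ImpI, BotE.
      apply ImpE with (fsubst A f); apply Hyp; simpl; auto.
  + intros [fA fB] h a.
    specialize (IHA _ f fA); specialize (IHB _ f fB); simpl in *.
    apply IHB; apply IHA in a; revert h a; apply (th2 Cl).
    apply ImpE with (fsubst A f); apply Hyp; simpl; auto.
- destruct p; [contradiction|]; intros fA h.
  intro x; revert x; apply quo_ind; intro t.
  rewrite <- econs_cls.
  apply (IHA false); auto.
  revert h; apply (th1 Cl).
  apply (@AllE' _ _ _ _ A f t), hyp0.
- destruct p; [|contradiction]; intros fA [x h].
  revert x h; refine (quo_ind _); intros t h.
  rewrite <- econs_cls in h.
  apply (IHA true) in h; auto.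
  revert h; apply (th1 Cl); intros; apply (@ExI' _ _ _ _ A f t), hyp0.
Qed.
End PrimeModel.

(* Bootstrapping version, before equality is known to be decidable. *)
Lemma transfer0 G (H L : list (form G)) A :
  (forall B, In B L -> frag false false B /\ prf H B) -> frag false true A ->
  (forall (M : cmodel) (e : env M G), (forall B, In B L -> sat B e) -> sat A e) ->
  prf H A.
Proof.
intros l fA h; apply prf_cut with L; [apply l|].
apply NNPP; intro np; destruct (lindenbaum np) as [S [PS [i nA]]].
apply nA; rewrite <- (fsubst_ids A).
apply (@sat_frag _ _ PS false (fun e => ltac:(discriminate)) _ A true ids fA).
apply h; intros B b.
apply (@sat_frag _ _ PS false (fun e => ltac:(discriminate)) _ B false ids);
  [apply l|rewrite fsubst_ids; apply i]; exact b.
Qed.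

(** * Arithmetic derived by quantifier-free induction *)

Lemma rc_step (M : cmodel) G (e : env M G) z F x :
  rc $ (su $ x) $ z $ eval e (lam (lam F)) =
  eval (econs x (econs (rc $ x $ z $ eval e (lam (lam F))) e)) F.
Proof. rewrite rcS, !eval_lam; reflexivity. Qed.

(** A closed term evaluates to the same element of the model in every environment, so large
    constructions are kept closed and enter other terms through [cl]. *)
Definition cl G s (t : term [] s) : term G s := tsubst (@nov (term G)) t.
Arguments cl {G s} t.

Lemma eval_cl (M : cmodel) G (e : env M G) s (t : term [] s) :
  eval e (cl t) = eval enil t.
Proof. unfold cl; rewrite eval_tsubst; f_equal; apply nov_ext. Qed.

Definition cond G (a b c : term G N) : term G N := Rec @ a @ b @ (Pi @ (Pi @ c)).

(* Least argument below the bound at which [f] does not vanish, or the bound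
   itself. *)
Definition mu0 : term [] (T1 ~> N ~> N) :=
  lam (lam (primrec Zero (cond (v3 @ v1) (Succ @ v1) v1) v0)).

(* Vanishes iff the arguments are equal. *)
Definition eqd0 : term [] (N ~> N ~> N) :=
  lam (lam (cond (monus (Succ @ v1) v0) (Succ @ Zero) (monus v1 v0))).

Section Arith1.
Variable M : cmodel.
Definition predM (a : M N) := eval (econs a enil) (pred v0).
Definition monM (a b : M N) := eval (econs b (econs a enil)) (monus v1 v0).
Definition addM (a b : M N) := eval (econs b (econs a enil)) (add v1 v0).
Definition condM (a b c : M N) : M N := rc $ a $ b $ (pi $ (pi $ c)).
Definition muM f m : M N := eval enil mu0 $ f $ m.
Definition eqdM a b : M N := eval enil eqd0 $ a $ b.

Lemma eval_pred G (e : env M G) a : eval e (pred a) = predM (eval e a).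
Proof. reflexivity. Qed.
Lemma eval_monus G (e : env M G) a b :
  eval e (monus a b) = monM (eval e a) (eval e b).
Proof. reflexivity. Qed.
Lemma eval_add G (e : env M G) a b :
  eval e (add a b) = addM (eval e a) (eval e b).
Proof. reflexivity. Qed.
Lemma eval_cond G (e : env M G) a b c :
  eval e (cond a b c) = condM (eval e a) (eval e b) (eval e c).
Proof. reflexivity. Qed.
Lemma predM0 : predM ze = ze.
Proof. apply rcZ. Qed.
Lemma predMS a : predM (su $ a) = a.
Proof. exact (rc_step (econs (su $ a) enil) ze v0 a). Qed.
Lemma monM0 a : monM a ze = a.
Proof. apply rcZ. Qed.
Lemma monMS a b : monM a (su $ b) = predM (monM a b).
Proof. exact (rc_step (econs (su $ b) (econs a enil)) a (pred v1) b). Qed.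
Lemma addM0 a : addM a ze = a.
Proof. apply rcZ. Qed.
Lemma addMS a b : addM a (su $ b) = su $ addM a b.
Proof. exact (rc_step (econs (su $ b) (econs a enil)) a (Succ @ v1) b). Qed.
Lemma condM0 b c : condM ze b c = b.
Proof. apply rcZ. Qed.
Lemma condMS a b c : condM (su $ a) b c = c.
Proof. unfold condM; rewrite rcS, !piE; reflexivity. Qed.
Lemma muM0 f : muM f ze = ze.
Proof. unfold muM, mu0; rewrite !eval_lam; apply rcZ. Qed.
Lemma muMS f m :
  muM f (su $ m) = condM (f $ muM f m) (su $ muM f m) (muM f m).
Proof.
unfold muM, mu0; rewrite !eval_lam.
exact (rc_step (econs (su $ m) (econs f enil)) ze
  (cond (v3 @ v1) (Succ @ v1) v1) m).
Qed.
Lemma eqdME a b : eqdM a b = condM (monM (su $ a) b) (su $ ze) (monM a b).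
Proof. unfold eqdM, eqd0; rewrite !eval_lam; reflexivity. Qed.
End Arith1.

Lemma eval_v0 (M : cmodel) G r (x : M r) (e : env M G) : eval (econs x e) v0 = x.
Proof. reflexivity. Qed.
Lemma eval_v1 (M : cmodel) G r s (x : M r) (e : env M (s :: G)) :
  eval (econs x e) v1 = eval e v0.
Proof. reflexivity. Qed.
Lemma eval_v2 (M : cmodel) G r s t (x : M r) (e : env M (t :: s :: G)) :
  eval (econs x e) v2 = eval e v1.
Proof. reflexivity. Qed.
Lemma eval_v3 (M : cmodel) G r s t u (x : M r) (e : env M (u :: t :: s :: G)) :
  eval (econs x e) v3 = eval e v2.
Proof. reflexivity. Qed.
Lemma eval_app (M : cmodel) G (e : env M G) s t (f : term G (s ~> t)) a :
  eval e (f @ a) = eval e f $ eval e a.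
Proof. reflexivity. Qed.
Lemma eval_Zero (M : cmodel) G (e : env M G) : eval e Zero = ze.
Proof. reflexivity. Qed.
Lemma eval_Succ (M : cmodel) G (e : env M G) : eval e Succ = su.
Proof. reflexivity. Qed.

Ltac evs_more := fail.
Ltac evs := repeat first [rewrite eval_v0 | rewrite eval_v1 | rewrite eval_v2
  | rewrite eval_v3 | evs_more | rewrite eval_wk | rewrite eval_cl
  | rewrite eval_tsubst | rewrite eval_scons
  | rewrite eval_pred | rewrite eval_monus | rewrite eval_add
  | rewrite eval_cond | rewrite eval_Zero | rewrite eval_Succ
  | rewrite eval_app].
Ltac arith1 := repeat first [rewrite predMS | rewrite monMS | rewrite addMS
  | rewrite monM0 | rewrite addM0 | rewrite predM0
  | rewrite condM0 | rewrite condMS].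

(** The facts needed before equality is known to be decided. Witnesses are written as terms, as in
    [pred v0], so the matrices are quantifier-free: induction applies to them, and their universal
    closures may serve as hypotheses of later transfers. *)
Definition F_su G : form G := All N (Succ @ v0 != Zero)%fm.
Definition F_zcase G : form G := All N (v0 == Zero \/ v0 == Succ @ pred v0)%fm.
Definition F_monSS G : form G :=
  All N (All N (monus (Succ @ v1) (Succ @ v0) == monus v1 v0))%fm.
Definition F_mon1 G : form G := All N (monus (Succ @ v0) v0 == Succ @ Zero)%fm.
Definition F_addS G : form G :=
  All N (All N (add (Succ @ v1) v0 == Succ @ add v1 v0))%fm.
Definition F_add0 G : form G := All N (add Zero v0 == v0)%fm.
Definition F_cmp G : form G :=
  All N (All N (add v0 (monus v1 v0) == v1 \/ monus (Succ @ v1) v0 == Zero))%fm.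
Definition F_eqd_refl G : form G := All N (cl eqd0 @ v0 @ v0 == Zero)%fm.
Definition F_eqd G : form G :=
  All N (All N (cl eqd0 @ v1 @ v0 == Zero ==> v1 == v0))%fm.
Definition F_mu G : form G :=
  All T1 (All N
    ((cl mu0 @ v1 @ v0 == v0 \/
      v1 @ (cl mu0 @ v1 @ v0) == Succ @ pred (v1 @ (cl mu0 @ v1 @ v0))) /\
     (cl mu0 @ v1 @ v0 == Zero \/
      v1 @ pred (cl mu0 @ v1 @ v0) == Zero)))%fm.

(** Base and step of an induction in the calculus are verified by truth in all combinatory models of
    [L]; besides [L], only the equations for the combinators and the recursor are available
    there. *)
Lemma prf_ind G (H L : list (form G)) (A : form (N :: G)) :
  (forall B, In B L -> frag false false B /\ prf H B) ->
  qf A -> frag false true A -> frag false false A ->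
  (forall (M : cmodel) (e : env M G), (forall B, In B L -> sat B e) ->
     sat A (econs ze e)) ->
  (forall (M : cmodel) (e : env M G), (forall B, In B L -> sat B e) ->
     forall x, sat A (econs x e) -> sat A (econs (su $ x) e)) ->
  prf H (All N A).
Proof.
intros l q f1 f2 b s; apply prf_cut with L; [apply l|].
apply QFInd; auto.
- apply transfer0 with L.
  + intros B i; split; [apply l, i|apply Hyp, i].
  + apply frag_fsubst, f1.
  + intros M e h; unfold inst; rewrite sat_fsubst, eval_scons; apply b, h.
- apply AllI, ImpI; apply transfer0 with (A :: map fwk L).
  + intros B i; split; [|apply Hyp, i].
    destruct i as [<-|i]; [exact f2|].
    apply in_map_iff in i as [C [<- i]]; apply frag_fsubst, l, i.
  + apply frag_fsubst, f1.
  + intros M e h; rewrite sat_fsubst, eval_scons.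
    rewrite (econs_eta e) in h |- *; apply s.
    * intros B i; rewrite <- (sat_fwk B (e N VZ)).
      apply h; right; apply in_map, i.
    * apply h; left; reflexivity.
Qed.

Ltac in_list i tac :=
  lazymatch type of i with
  | False => destruct i
  | _ => destruct i as [<-|i]; [tac|in_list i tac]
  end.
Ltac side := solve [simpl; auto | simpl; tauto].
Ltac sats := cbn [sat]; evs.
Ltac sats_in h := cbn [sat] in h; revert h; evs; intro h.

Ltac by_ind l := apply prf_ind with (L := l);
  [intros ? ?i; cbn [In] in i; in_list i ltac:(split; [side|auto])
  |side|side|side|intros M e h
  |intros M e h x].

Section Boot.
Variables (G : list ty) (H : list (form G)).

Lemma prf_F_su : prf H (F_su G).
Proof. apply AllI, SuccNZ. Qed.

Lemma prf_F_zcase : prf H (F_zcase G).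
Proof.
by_ind (@nil (form G)); sats.
- left; reflexivity.
- right; arith1; reflexivity.
Qed.
End Boot.

Lemma prf_F_monSS G (H : list (form G)) : prf H (F_monSS G).
Proof.
apply AllI; by_ind (@nil (form (N :: G))); sats; arith1; [reflexivity|].
intros ->; reflexivity.
Qed.

Lemma prf_F_addS G (H : list (form G)) : prf H (F_addS G).
Proof.
apply AllI; by_ind (@nil (form (N :: G))); sats; arith1; [reflexivity|].
intros ->; reflexivity.
Qed.

#[local] Hint Resolve prf_F_su prf_F_zcase prf_F_monSS prf_F_addS : core.

Section SatF.
Variables (M : cmodel) (G : list ty) (e : env M G).

Lemma sat_F_su : sat (F_su G) e -> forall a : M N, su $ a <> ze.
Proof. exact (fun h => h). Qed.
Lemma sat_F_zcase : sat (F_zcase G) e ->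
  forall a : M N, a = ze \/ a = su $ predM a.
Proof. exact (fun h => h). Qed.
Lemma sat_F_monSS : sat (F_monSS G) e ->
  forall a b : M N, monM (su $ a) (su $ b) = monM a b.
Proof. exact (fun h => h). Qed.
Lemma sat_F_mon1 : sat (F_mon1 G) e ->
  forall a : M N, monM (su $ a) a = su $ ze.
Proof. exact (fun h => h). Qed.
Lemma sat_F_addS : sat (F_addS G) e ->
  forall a b : M N, addM (su $ a) b = su $ addM a b.
Proof. exact (fun h => h). Qed.
Lemma sat_F_add0 : sat (F_add0 G) e -> forall a : M N, addM ze a = a.
Proof. exact (fun h => h). Qed.
Lemma sat_F_cmp : sat (F_cmp G) e ->
  forall a b : M N, addM b (monM a b) = a \/ monM (su $ a) b = ze.
Proof. exact (fun h => h). Qed.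
Lemma sat_F_eqd_refl : sat (F_eqd_refl G) e ->
  forall a : M N, eqdM a a = ze.
Proof. intros h a; specialize (h a); sats_in h; exact h. Qed.
Lemma sat_F_eqd : sat (F_eqd G) e ->
  forall a b : M N, eqdM a b = ze -> a = b.
Proof. intros h a b; specialize (h a b); sats_in h; exact h. Qed.
Lemma sat_F_mu : sat (F_mu G) e -> forall (f : M T1) m,
  (muM f m = m \/ f $ muM f m = su $ predM (f $ muM f m)) /\
  (muM f m = ze \/ f $ predM (muM f m) = ze).
Proof. intros h f m; specialize (h f m); sats_in h; exact h. Qed.
End SatF.

Lemma prf_F_mon1 G (H : list (form G)) : prf H (F_mon1 G).
Proof.
by_ind [F_monSS G]; sats; arith1; [reflexivity|].
rewrite <- monMS, (sat_F_monSS (h _ (or_introl eq_refl))); auto.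
Qed.

#[local] Hint Resolve prf_F_mon1 : core.

Lemma prf_F_add0 G (H : list (form G)) : prf H (F_add0 G).
Proof.
by_ind (@nil (form G)); sats; arith1; [reflexivity|].
intros ->; reflexivity.
Qed.

#[local] Hint Resolve prf_F_add0 : core.

Ltac hyp_of h := apply h; simpl; tauto.

(** Induction on the number x that is compared with a: as long as x + (a - x) = a, either a - x is a
    successor and one unit moves across, or a = x and the second disjunct takes over. *)
Lemma prf_F_cmp G (H : list (form G)) : prf H (F_cmp G).
Proof.
apply AllI; by_ind [F_zcase (N :: G); F_addS (N :: G); F_add0 (N :: G);
  F_mon1 (N :: G)]; sats; arith1.
- left; apply (@sat_F_add0 _ _ e); hyp_of h.
- assert (h1 := @sat_F_zcase _ _ e ltac:(hyp_of h)).
  assert (h2 := @sat_F_addS _ _ e ltac:(hyp_of h)).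
  assert (h3 := @sat_F_mon1 _ _ e ltac:(hyp_of h)).
  generalize (eval e v0); intros a [E|E]; [|right; rewrite E; arith1; reflexivity].
  destruct (h1 (monM a x)) as [E'|E']; rewrite E' in E |- *; revert E; arith1.
  + intros ->; right; rewrite h3; arith1; reflexivity.
  + intro E; left; rewrite h2; exact E.
Qed.

#[local] Hint Resolve prf_F_cmp : core.

Lemma prf_F_eqd_refl G (H : list (form G)) : prf H (F_eqd_refl G).
Proof.
apply AllI, (transfer0 (L := [F_monSS (N :: G); F_mon1 (N :: G)])); [|side|].
- intros ? i; cbn [In] in i; in_list i ltac:(split; [side|auto]).
- intros M e h; sats.
  assert (h1 := @sat_F_monSS _ _ e ltac:(hyp_of h)).
  assert (h2 := @sat_F_mon1 _ _ e ltac:(hyp_of h)).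
  generalize (eval e v0); intros a; fold (eqdM a a); rewrite eqdME, h2; arith1.
  rewrite <- h1; arith1; rewrite h2; arith1; reflexivity.
Qed.

Lemma prf_F_eqd G (H : list (form G)) : prf H (F_eqd G).
Proof.
apply AllI, AllI, ImpI.
set (E := (cl eqd0 @ v1 @ v0 == Zero)%fm).
apply (transfer0 (L := [E; F_su (N :: N :: G); F_zcase (N :: N :: G);
  F_cmp (N :: N :: G)])); [|side|].
- intros ? i; cbn [In] in i;
    in_list i ltac:(split; [side|first [apply hyp0|auto]]).
- intros M e h; sats.
  assert (h0 : eqdM (eval e v1) (eval e v0) = ze).
  { assert (h0 : sat E e) by hyp_of h; sats_in h0; exact h0. }
  assert (h1 := @sat_F_su _ _ e ltac:(hyp_of h)).
  assert (h2 := @sat_F_zcase _ _ e ltac:(hyp_of h)).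
  assert (h3 := @sat_F_cmp _ _ e ltac:(hyp_of h)).
  revert h0; generalize (eval e v1), (eval e v0); intros a b; rewrite eqdME.
  destruct (h2 (monM (su $ a) b)) as [E'|E']; rewrite E'; arith1.
  + intro E0; destruct (h1 _ E0).
  + intro E0; destruct (h3 a b) as [E1|E1].
    * rewrite E0 in E1; symmetry; revert E1; arith1; auto.
    * rewrite E' in E1; destruct (h1 _ E1).
Qed.

Lemma prf_F_mu G (H : list (form G)) : prf H (F_mu G).
Proof.
apply AllI; by_ind [F_su (T1 :: G); F_zcase (T1 :: G)]; sats;
  fold (muM (eval e v0) ze); rewrite ?muM0; auto.
assert (h1 := @sat_F_su _ _ e ltac:(hyp_of h)).
assert (h2 := @sat_F_zcase _ _ e ltac:(hyp_of h)).
generalize (eval e v0); intro f.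
fold (muM f (su $ x)); fold (muM f x); rewrite muMS.
intros [E1 E2].
destruct (h2 (f $ muM f x)) as [E|E]; rewrite E; arith1.
- split; [left|right; exact E].
  destruct E1 as [E1|E1]; [rewrite E1; reflexivity|].
  rewrite E1 in E; destruct (h1 _ E).
- split; [right; exact E|exact E2].
Qed.

#[local] Hint Resolve prf_F_eqd_refl prf_F_eqd prf_F_mu : core.

(** * Term models with decided equations *)

Section DecidedModel.
Variables (G : list ty) (S : form G -> Prop) (PS : prime_theory S).
Let Cl : closed_theory S := pt_closed PS.
Let M := qmodel Cl.
Let ge := genv Cl : env M G.

Lemma sat_theorem (A : form G) : frag false false A -> prf [] A -> sat A ge.
Proof.
intros f p.
apply (@sat_frag _ _ PS false (fun e => ltac:(discriminate)) _ A false ids f).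
rewrite fsubst_ids; apply (th0 Cl), p.
Qed.

(** With d the value of the characteristic term of equality, d is provably zero or a successor, and
    primeness picks one of the two. The former yields the equation, the latter refutes it. *)
Lemma eq_decided (a b : term G N) : S (a == b)%fm \/ S (Imp (a == b)%fm Bot).
Proof.
set (d := cl eqd0 @ a @ b).
assert (z : S (d == Zero \/ d == Succ @ pred d)%fm).
{ apply (th0 Cl).
  exact (AllE d (prf_F_zcase [])). }
apply (pt_prime PS) in z as [z|z]; [left|right].
- revert z; apply (th1 Cl).
  apply (transfer0 (L := [(d == Zero)%fm; F_eqd G])); [|side|].
  + intros ? i; cbn [In] in i;
      in_list i ltac:(split; [side|first [apply hyp0|auto]]).
  + intros M' e h; sats; apply (@sat_F_eqd _ _ e ltac:(hyp_of h)).
    assert (h0 : sat (d == Zero)%fm e) by hyp_of h.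
    unfold d in h0; sats_in h0; exact h0.
- revert z; apply (th1 Cl), ImpI.
  apply (transfer0 (L := [(a == b)%fm; (d == Succ @ pred d)%fm; F_su G;
    F_eqd_refl G])); [|side|].
  + intros ? i; cbn [In] in i;
      in_list i ltac:(split; [side|first [apply Hyp; simpl; tauto|auto]]).
  + intros M' e h; sats.
    assert (h0 : sat (a == b)%fm e) by hyp_of h.
    assert (h1 : sat (d == Succ @ pred d)%fm e) by hyp_of h.
    unfold d in h1; sats_in h1; cbn [sat] in h0; rewrite h0 in h1.
    fold (eqdM (eval e b) (eval e b)) in h1.
    rewrite (@sat_F_eqd_refl _ _ e ltac:(hyp_of h)) in h1.
    symmetry in h1; revert h1; apply (@sat_F_su _ _ e ltac:(hyp_of h)).
Qed.

Lemma pmodel_su_inj (a b : M N) : su $ a = su $ b -> a = b.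
Proof.
revert a b; refine (quo_ind _); intro a; refine (quo_ind _); intro b.
intro E; change (qapp (cls S Succ) (cls S a) = qapp (cls S Succ) (cls S b)) in E.
rewrite !(cls_app Cl) in E; apply (cls_eq Cl) in E; apply (cls_eq Cl).
revert E; apply (th1 Cl); apply (ImpE (@SuccInj _ _ a b)), hyp0.
Qed.

Lemma pmodel_ind (f : M T1) : f $ ze = ze ->
  (forall x, f $ x = ze -> f $ (su $ x) = ze) -> forall x, f $ x = ze.
Proof.
intros f0 fS x.
assert (nz := sat_F_su (sat_theorem (A := F_su G) ltac:(side) (prf_F_su []))).
assert (zc := sat_F_zcase (sat_theorem (A := F_zcase G) ltac:(side) (prf_F_zcase []))).
assert (m := sat_F_mu (sat_theorem (A := F_mu G) ltac:(side) (prf_F_mu []))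
  f (su $ x)).
(* The search below the successor of x either runs to the end, with [f] vanishing at the predecessor
   x, or stops where [f] does not vanish. A stop at zero contradicts the base, a stop at a successor
   contradicts the step. *)
destruct m as [[m1|m1] [m2|m2]].
- rewrite m1 in m2; destruct (nz _ m2).
- rewrite m1, predMS in m2; exact m2.
- rewrite m2, f0 in m1; symmetry in m1; destruct (nz _ m1).
- destruct (zc (muM f (su $ x))) as [E|E].
  + rewrite E, f0 in m1; symmetry in m1; destruct (nz _ m1).
  + apply fS in m2; rewrite <- E, m1 in m2; destruct (nz _ m2).
Qed.

Definition pmodel : model.
Proof.
refine (@Model M pmodel_su_inj _ _ (eval ge (cl eqd0)) _ pmodel_ind).
- exact (sat_F_su (sat_theorem (A := F_su G) ltac:(side) (prf_F_su []))).
- intro a.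
  destruct (sat_F_zcase (sat_theorem (A := F_zcase G) ltac:(side)
    (prf_F_zcase [])) a); eauto.
- intros a b; rewrite eval_cl; split.
  + apply (sat_F_eqd (sat_theorem (A := F_eqd G) ltac:(side) (prf_F_eqd []))).
  + intros ->; apply (sat_F_eqd_refl
      (sat_theorem (A := F_eqd_refl G) ltac:(side) (prf_F_eqd_refl []))).
Defined.
End DecidedModel.

(** * Quantifier-free formulas and the transfer principle *)

Lemma qf_decided G (A : form G) : qf A -> forall S, prime_theory S ->
  S A \/ S (Imp A Bot).
Proof.
induction A as [G a b|G|G A IHA B IHB|G A IHA B IHB|
  G A IHA B IHB|G s A IHA|G s A IHA]; intros q S PS;
  simpl in q; assert (Cl := pt_closed PS);
  try (match type of q with _ /\ _ => destruct q as [qA qB] end).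
- apply eq_decided, PS.
- right; apply (th0 Cl), ImpI, hyp0.
- destruct (IHA qA S PS) as [a|a], (IHB qB S PS) as [b|b].
  + left; revert a b; apply (th2 Cl), AndI; apply Hyp; simpl; auto.
  + right; revert b; apply (th1 Cl), ImpI.
    apply ImpE with B; [apply prf_S, hyp0|eapply AndE2, hyp0].
  + right; revert a; apply (th1 Cl), ImpI.
    apply ImpE with A; [apply prf_S, hyp0|eapply AndE1, hyp0].
  + right; revert a; apply (th1 Cl), ImpI.
    apply ImpE with A; [apply prf_S, hyp0|eapply AndE1, hyp0].
- destruct (IHA qA S PS) as [a|a];
    [left; revert a; apply (th1 Cl), OrI1, hyp0|].
  destruct (IHB qB S PS) as [b|b];
    [left; revert b; apply (th1 Cl), OrI2, hyp0|].
  right; revert a b; apply (th2 Cl), ImpI.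
  apply OrE with A B; [apply hyp0| |].
  + apply ImpE with A; apply Hyp; simpl; auto.
  + apply ImpE with B; apply Hyp; simpl; auto.
- destruct (IHB qB S PS) as [b|b];
    [left; revert b; apply (th1 Cl), ImpI, prf_S, hyp0|].
  destruct (IHA qA S PS) as [a|a].
  + right; revert a b; apply (th2 Cl), ImpI.
    apply ImpE with B; [apply Hyp; simpl; auto|].
    apply ImpE with A; apply Hyp; simpl; auto.
  + left; revert a; apply (th1 Cl), ImpI, BotE.
    apply ImpE with A; apply Hyp; simpl; auto.
- contradiction.
- contradiction.
Qed.

(** Outer universal quantifiers, conjunctions and premises are stripped by introduction rules, the
    premises joining the hypotheses. Only what remains must be reflected by a term model, and it may
    be existential. *)
Fixpoint goal G (A : form G) : Prop :=
  match A with
  | All _ A => goal A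
  | And A B => goal A /\ goal B
  | Imp A B => frag true false A /\ goal B
  | A => frag true true A
  end.

(** [L] collects what the models need to see, formulas of the negative fragment derivable from [H];
    [H] itself may contain anything. Classical logic is used only about derivations, so the
    derivation obtained is intuitionistic. *)
Theorem transfer G (A : form G) : goal A -> forall L H,
  (forall B, In B L -> frag true false B /\ prf H B) ->
  (forall (M : model) (e : env M G), (forall B, In B L -> sat B e) -> sat A e) ->
  prf H A.
Proof.
assert (base : forall G (A : form G), frag true true A -> forall L,
  (forall B, In B L -> frag true false B) ->
  (forall (M : model) (e : env M G), (forall B, In B L -> sat B e) -> sat A e) ->
  prf L A).
{ clear; intros G A fA L l h.
  apply NNPP; intro np; destruct (lindenbaum np) as [S [PS [i nA]]].
  apply nA; rewrite <- (fsubst_ids A).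
  apply (@sat_frag _ _ PS true (fun _ B q => qf_decided q PS) _ A true ids fA).
  apply (h (pmodel PS)); intros B b.
  apply (@sat_frag _ _ PS true (fun _ B q => qf_decided q PS) _ B false ids);
    [apply l|rewrite fsubst_ids; apply i]; exact b. }
intros gA L H l h; apply prf_cut with L; [apply l|].
assert (l' : forall B, In B L -> frag true false B) by apply l.
clear l H; revert L l' h.
induction A as [G a b|G|G A IHA B IHB|G A IHA B IHB|
  G A IHA B IHB|G s A IHA|G s A IHA]; intros L l h; auto.
- destruct gA as [gA gB].
  apply AndI; [apply IHA|apply IHB]; auto; intros M e k; apply (h M e k).
- destruct gA as [gA gB].
  apply ImpI, IHB; auto.
  + intros C [<-|c]; auto.
  + intros M e k; apply h; [intros; apply k; right; auto|apply k; left; auto].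
- apply AllI, IHA; auto.
  + intros B b; apply in_map_iff in b as [C [<- c]]; apply frag_fsubst; auto.
  + intros M e k; rewrite (econs_eta e); apply h; intros B b.
    rewrite <- (sat_fwk B (e s VZ)), <- econs_eta.
    apply k, in_map, b.
Qed.

(** * Arithmetic in a model *)

Definition mul0 : term [] (N ~> N ~> N) := lam (lam (mul v1 v0)).
Definition mulM (M : cmodel) (a b : M N) : M N := eval enil mul0 $ a $ b.

Section Definability.
Variable M : model.

(** Induction in a model is confined to predicates given by an element of it. Parameters from the
    model are allowed, and the tactics [def] and [dec] build the element along the shape of the
    expression. *)
Definition Def r s (g : M r -> M s) := exists f : M (r ~> s), forall x, f $ x = g x.
Definition Dec (P : M N -> Prop) := exists f : M T1, forall x, f $ x = ze <-> P x.

Lemma Def_id r : Def (fun x : M r => x).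
Proof. exists (@sg M r (r ~> r) r $ pi $ pi); intro x; rewrite sgE, piE; auto. Qed.
Lemma Def_const r s (a : M s) : Def (fun _ : M r => a).
Proof. exists (pi $ a); intro x; apply piE. Qed.
Lemma Def_fun r s (f : M (r ~> s)) : Def (ap f).
Proof. exists f; reflexivity. Qed.
Lemma Def_app r s t (f : M r -> M (s ~> t)) g :
  Def f -> Def g -> Def (fun x => f x $ g x).
Proof.
intros [f' Ef] [g' Eg]; exists (sg $ f' $ g'); intro x.
rewrite sgE, Ef, Eg; reflexivity.
Qed.

Ltac def := lazymatch goal with
  | |- Def (fun x => x) => apply Def_id
  | |- Def (ap _) => apply Def_fun
  | |- Def (fun x => ap _ _) => apply Def_app; def
  | |- _ => first [assumption | apply Def_const]
  end.

Lemma Def_ext r s (f g : M r -> M s) : (forall x, f x = g x) -> Def f -> Def g.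
Proof. intros E [h Eh]; exists h; intro x; rewrite Eh; apply E. Qed.

Section Ops.
Variables (r : ty) (g h k : M r -> M N).
Hypotheses (dg : Def g) (dh : Def h) (dk : Def k).

Lemma Def_add : Def (fun x => addM (g x) (h x)).
Proof.
apply (@Def_ext r N (fun x => rc $ h x $ g x $ eval enil (lam (lam (Succ @ v1)))));
  [reflexivity|def].
Qed.
Lemma Def_pred : Def (fun x => predM (g x)).
Proof.
apply (@Def_ext r N (fun x => rc $ g x $ ze $ eval enil (lam (lam v0))));
  [reflexivity|def].
Qed.
Lemma Def_mon : Def (fun x => monM (g x) (h x)).
Proof.
apply (@Def_ext r N (fun x => rc $ h x $ g x $ eval enil (lam (lam (pred v1)))));
  [reflexivity|def].
Qed.
Lemma Def_cond : Def (fun x => condM (g x) (h x) (k x)).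
Proof. unfold condM; def. Qed.
Lemma Def_mul : Def (fun x => mulM (g x) (h x)).
Proof. unfold mulM; def. Qed.
End Ops.

Lemma Def_mu r (f : M r -> M T1) g : Def f -> Def g -> Def (fun x => muM (f x) (g x)).
Proof. intros; unfold muM; def. Qed.

Lemma Dec_ext (P Q : M N -> Prop) : (forall x, P x <-> Q x) -> Dec P -> Dec Q.
Proof. intros E [f Ef]; exists f; intro x; rewrite Ef; apply E. Qed.

Lemma Dec_eq (g h : M N -> M N) : Def g -> Def h -> Dec (fun x => g x = h x).
Proof.
intros dg dh; assert (Def (fun x => eqd M $ g x $ h x)) as [f Ef] by def.
exists f; intro x; rewrite Ef; apply eqdP.
Qed.

Lemma cond_cases (a b c : M N) :
  (a = ze /\ condM a b c = b) \/ (a <> ze /\ condM a b c = c).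
Proof.
destruct (zcase a) as [->|[d ->]]; [left|right]; split; auto.
- apply condM0.
- apply su_nz.
- apply condMS.
Qed.

Lemma Dec_of (P : M N -> Prop) g : Def g -> (forall x, g x = ze <-> P x) -> Dec P.
Proof. intros [f Ef] E; exists f; intro x; rewrite Ef; apply E. Qed.

Lemma Dec_not (P : M N -> Prop) : Dec P -> Dec (fun x => ~ P x).
Proof.
intros [f Ef].
apply (@Dec_of _ (fun x => condM (f $ x) (su $ ze) ze)); [apply Def_cond; def|].
intro x; destruct (cond_cases (f $ x) (su $ ze) ze) as [[E ->]|[E ->]];
  rewrite Ef in E; intuition; destruct (su_nz H).
Qed.

Lemma Dec_imp (P Q : M N -> Prop) : Dec P -> Dec Q -> Dec (fun x => P x -> Q x).
Proof.
intros [f Ef] [g Eg].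
apply (@Dec_of _ (fun x => condM (f $ x) (g $ x) ze)); [apply Def_cond; def|].
intro x; destruct (cond_cases (f $ x) (g $ x) ze) as [[E ->]|[E ->]];
  rewrite Ef in E; rewrite ?Eg; intuition.
Qed.

Lemma Dec_and (P Q : M N -> Prop) : Dec P -> Dec Q -> Dec (fun x => P x /\ Q x).
Proof.
intros dP dQ; apply (@Dec_ext (fun x => ~ (P x -> ~ Q x))).
- intro x; tauto.
- apply Dec_not, Dec_imp; [|apply Dec_not]; assumption.
Qed.

Lemma Dec_or (P Q : M N -> Prop) : Dec P -> Dec Q -> Dec (fun x => P x \/ Q x).
Proof.
intros dP dQ; apply (@Dec_ext (fun x => ~ P x -> Q x)).
- intro x; tauto.
- apply Dec_imp; [apply Dec_not|]; assumption.
Qed.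

(** Classical logic decides a proposition free of the induction variable, whatever its quantifiers,
    so such premises may stay inside an induction predicate. *)
Lemma Dec_const (P : Prop) : Dec (fun _ => P).
Proof.
destruct (classic P).
- apply (@Dec_of _ (fun x => ze)); [def|tauto].
- apply (@Dec_of _ (fun x => su $ ze)); [def|].
  intros _; split; [intro E; destruct (su_nz E)|tauto].
Qed.

Lemma mind (P : M N -> Prop) : Dec P -> P ze ->
  (forall x, P x -> P (su $ x)) -> forall x, P x.
Proof.
intros [f Ef] P0 PS x; apply Ef, model_ind; [apply Ef, P0|].
intros y Ey; apply Ef, PS, Ef, Ey.
Qed.
End Definability.

Ltac def := lazymatch goal with
  | |- Def (fun x => x) => apply Def_id
  | |- Def (ap _) => apply Def_fun
  | |- Def (fun x => addM _ _) => apply Def_add; def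
  | |- Def (fun x => predM _) => apply Def_pred; def
  | |- Def (fun x => monM _ _) => apply Def_mon; def
  | |- Def (fun x => condM _ _ _) => apply Def_cond; def
  | |- Def (fun x => mulM _ _) => apply Def_mul; def
  | |- Def (fun x => muM _ _) => apply Def_mu; def
  | |- Def (fun x => ap _ _) => first [apply Def_const | apply Def_app; def]
  | |- Def (fun x => _) => first [assumption | apply Def_const]
  | |- Def ?g => first [assumption | change (Def (fun x => g x)); def]
  end.

Ltac dec := lazymatch goal with
  | |- Dec (fun x => _ = _) => apply Dec_eq; def
  | |- Dec (fun x => _ /\ _) => apply Dec_and; dec
  | |- Dec (fun x => _ \/ _) => apply Dec_or; dec
  | |- Dec (fun x => ~ _) => apply Dec_not; dec
  | |- Dec (fun x => _ -> _) => apply Dec_imp; dec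
  | |- Dec (fun x => _) => first [assumption | apply Dec_const]
  | |- Dec ?P => first [assumption | change (Dec (fun x => P x)); dec]
  end.
Ltac mind_on a := revert a;
  lazymatch goal with |- forall x : _, @?P x =>
    refine (@mind _ P _ _ _); cbv beta; [try solve [dec]|..] end.

Declare Scope num_scope.
Delimit Scope num_scope with num.
Notation "0" := (@ze _) : num_scope.
Notation "1" := (ap (@su _) (@ze _)) : num_scope.
Notation "a + b" := (addM a b) : num_scope.
Notation "a * b" := (mulM a b) : num_scope.
Notation "a - b" := (monM a b) : num_scope.
Local Open Scope num_scope.

(** The additive form lets inequalities be opened into witnesses and closed by [ring]. It still has
    a characteristic function, since it amounts to b = a + (b - a). *)
Definition leM (M : cmodel) (a b : M N) := exists d, b = a + d.
Notation "a <= b" := (leM a b) : num_scope.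
Notation "a < b" := (leM (a + 1) b) : num_scope.

(** The translations by [lam] of one step function in two contexts are only pointwise equal
    elements, and the model need not be extensional; recursions along them are therefore compared by
    induction. *)
Lemma model_rec_ext (M : model) (z : M N) (g g' : M (N ~> N ~> N)) :
  (forall p i, g $ p $ i = g' $ p $ i) ->
  forall m, rc $ m $ z $ g = rc $ m $ z $ g'.
Proof.
intros E m; mind_on m.
- rewrite !rcZ; reflexivity.
- intros m IH; rewrite !rcS, IH; apply E.
Qed.

Lemma eval_mul (M : model) G (e : env M G) a b :
  eval e (mul a b) = mulM (eval e a) (eval e b).
Proof.
unfold mulM, mul0; rewrite !eval_lam.
apply model_rec_ext; intros p i; rewrite !eval_lam.
rewrite !eval_add, !eval_wk; reflexivity.
Qed.

Section Arith.
Variable M : model.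
Implicit Types a b c d x y : M N.

Lemma suE a : su $ a = a + 1.
Proof. rewrite addMS, addM0; reflexivity. Qed.

Lemma ind1 (P : M N -> Prop) : Dec P -> P 0 ->
  (forall x, P x -> P (x + 1)) -> forall x, P x.
Proof. intros d P0 PS; apply mind; auto; intros; rewrite suE; auto. Qed.

Lemma add0l a : 0 + a = a.
Proof.
mind_on a; [apply addM0|].
intros x E; rewrite addMS, E; reflexivity.
Qed.
Lemma addSl a b : (su $ a) + b = su $ (a + b).
Proof.
mind_on b; [rewrite !addM0; reflexivity|].
intros x E; rewrite !addMS, E; reflexivity.
Qed.
Lemma addC a b : a + b = b + a.
Proof.
mind_on b; [rewrite addM0, add0l; reflexivity|].
intros x E; rewrite addMS, addSl, E; reflexivity.
Qed.
Lemma addA a b c : a + (b + c) = a + b + c.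
Proof.
mind_on c; [rewrite !addM0; reflexivity|].
intros x E; rewrite !addMS, E; reflexivity.
Qed.
Lemma mulM0 a : a * 0 = 0.
Proof. unfold mulM, mul0; rewrite !eval_lam; apply rcZ. Qed.
Lemma mulMS a b : a * (su $ b) = a * b + a.
Proof.
unfold mulM, mul0; rewrite !eval_lam.
set (e := econs (su $ b) _); set (e' := econs b _).
assert (E := rc_step e 0 (add v1 (wk (wk v1))) b).
transitivity ((rc $ b $ 0 $ eval e (lam (lam (add v1 (wk (wk v1)))))) + a);
  [exact E|].
f_equal; apply model_rec_ext; intros p i; rewrite !eval_lam; reflexivity.
Qed.

Lemma mul0l a : 0 * a = 0.
Proof.
mind_on a; [apply mulM0|].
intros x E; rewrite mulMS, E, addM0; reflexivity.
Qed.
Lemma mulSl a b : (su $ a) * b = a * b + b.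
Proof.
mind_on b; [rewrite !mulM0, addM0; reflexivity|].
intros x E; rewrite !mulMS, E, !addMS; f_equal.
rewrite <- !addA; f_equal; apply addC.
Qed.
Lemma mulC a b : a * b = b * a.
Proof.
mind_on b; [rewrite mulM0, mul0l; reflexivity|].
intros x E; rewrite mulMS, mulSl, E; reflexivity.
Qed.
Lemma mulDr a b c : a * (b + c) = a * b + a * c.
Proof.
mind_on c; [rewrite mulM0, !addM0; reflexivity|].
intros x E; rewrite addMS, !mulMS, E, addA; reflexivity.
Qed.
Lemma mulA a b c : a * (b * c) = a * b * c.
Proof.
mind_on c; [rewrite !mulM0; reflexivity|].
intros x E; rewrite !mulMS, mulDr, E; reflexivity.
Qed.
Lemma mul1l a : 1 * a = a.
Proof. rewrite mulSl, mul0l, add0l; reflexivity. Qed.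

Lemma model_semiring : semi_ring_theory (0 : M N) 1 (@addM M) (@mulM M) eq.
Proof.
split; intros.
- apply add0l.
- apply addC.
- apply addA.
- apply mul1l.
- apply mul0l.
- apply mulC.
- apply mulA.
- rewrite mulC, mulDr, !(mulC p); reflexivity.
Qed.
End Arith.

Section Order.
Variable M : model.
Implicit Types a b c d x y : M N.
Add Ring model_ring : (model_semiring M).

Lemma addI a b c : c + a = c + b -> a = b.
Proof.
mind_on c; [rewrite !add0l; auto|].
intros x IH; rewrite !addSl; intro E; apply IH, (su_inj E).
Qed.
Lemma one_nz a : a + 1 <> 0.
Proof. rewrite <- suE; apply su_nz. Qed.
Lemma zcase1 a : a = 0 \/ exists b, a = b + 1.
Proof.
destruct (zcase a) as [E|[b E]]; [auto|right; exists b; rewrite <- suE; exact E].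
Qed.
Lemma predM1 a : predM (a + 1) = a.
Proof. rewrite <- suE; apply predMS. Qed.
Lemma cond1 a b c : condM (a + 1) b c = c.
Proof. rewrite <- suE; apply condMS. Qed.

Lemma le_refl a : a <= a.
Proof. exists 0; ring. Qed.
Lemma le_trans a b c : a <= b -> b <= c -> a <= c.
Proof. intros [d ->] [e ->]; exists (d + e); ring. Qed.
Lemma le_addr a b : a <= a + b.
Proof. exists b; ring. Qed.
Lemma le_addl a b : a <= b + a.
Proof. exists b; ring. Qed.
Lemma le0 a : 0 <= a.
Proof. exists a; ring. Qed.
Lemma lt_irrefl a : ~ a < a.
Proof.
intros [d E]; apply (@one_nz d), (@addI _ _ a).
transitivity (a + 1 + d); [ring|rewrite <- E; ring].
Qed.
Lemma lt_le a b : a < b -> a <= b.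
Proof. intros [d ->]; exists (1 + d); ring. Qed.
Lemma lt_le_trans a b c : a < b -> b <= c -> a < c.
Proof. intros [d ->] [e ->]; exists (d + e); ring. Qed.
Lemma lt_not_le a b : a < b -> ~ b <= a.
Proof. intros L L'; apply (@lt_irrefl a), lt_le_trans with b; auto. Qed.
Lemma le_antisym a b : a <= b -> b <= a -> a = b.
Proof.
intros [d ->] L; destruct (zcase1 d) as [->|[e ->]]; [ring|].
destruct (@lt_irrefl a); apply le_trans with (2 := L); exists e; ring.
Qed.
Lemma le_add a b c d : a <= b -> c <= d -> a + c <= b + d.
Proof. intros [e ->] [f ->]; exists (e + f); ring. Qed.
Lemma le_mul a b c : a <= b -> c * a <= c * b.
Proof. intros [e ->]; exists (c * e); ring. Qed.
Lemma le_addI a b c : c + a <= c + b -> a <= b.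
Proof. intros [d E]; exists d; apply (@addI _ _ c); rewrite E; ring. Qed.
Lemma ltS a b : a < b + 1 <-> a <= b.
Proof.
split; intros [d E]; exists d.
- apply (@addI _ _ 1); transitivity (b + 1); [ring|rewrite E; ring].
- rewrite E; ring.
Qed.
Lemma ltSW a b : a < b + 1 -> a <= b.
Proof. apply ltS. Qed.
Lemma lt0 a : ~ a < 0.
Proof.
intros [d E]; apply (@one_nz (a + d)); transitivity (a + 1 + d);
  [ring|symmetry; exact E].
Qed.

Lemma monSS a b : (a + 1) - (b + 1) = a - b.
Proof.
rewrite <- !suE; mind_on b; [rewrite monMS, !monM0, predMS; reflexivity|].
intros x E; rewrite monMS, E, monMS; reflexivity.
Qed.
Lemma mon_add a b : (a + b) - a = b.
Proof.
mind_on a; [rewrite monM0; ring|].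
intros x E; rewrite suE.
replace (x + 1 + b) with (x + b + 1) by ring; rewrite monSS; exact E.
Qed.
Lemma mon_add0 a b : a - (a + b) = 0.
Proof.
mind_on b; [replace (a + 0) with a by ring|].
- transitivity ((a + 0) - a); [f_equal; ring|apply mon_add].
- intros x E; rewrite addMS, monMS, E; apply predM0.
Qed.

Lemma mon_le a b : b <= a -> b + (a - b) = a.
Proof. intros [d ->]; rewrite mon_add; reflexivity. Qed.

Lemma Dec_le (g h : M N -> M N) : Def g -> Def h -> Dec (fun x => g x <= h x).
Proof.
intros dg dh; apply (@Dec_ext M (fun x => h x = g x + (h x - g x))); [|dec].
intro x; split; [exists (h x - g x); assumption|].
intro L; rewrite mon_le; auto.
Qed.

End Order.

Ltac dec ::= lazymatch goal with
  | |- Dec (fun x => _ = _) => apply Dec_eq; def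
  | |- Dec (fun x => leM _ _) => apply Dec_le; def
  | |- Dec (fun x => _ /\ _) => apply Dec_and; dec
  | |- Dec (fun x => _ \/ _) => apply Dec_or; dec
  | |- Dec (fun x => ~ _) => apply Dec_not; dec
  | |- Dec (fun x => _ -> _) => apply Dec_imp; dec
  | |- Dec (fun x => _) => first [assumption | apply Dec_const]
  | |- Dec ?P => first [assumption | change (Dec (fun x => P x)); dec]
  end.
Ltac ind_on a := revert a;
  lazymatch goal with |- forall x : _, @?P x =>
    refine (@ind1 _ P _ _ _); cbv beta; [try solve [dec]|..] end.

Section Search.
Variable M : model.
Implicit Types a b c d x y : M N.
Add Ring model_ring1 : (model_semiring M).

Lemma le_or_lt a b : a <= b \/ b < a.
Proof.
mind_on b.
- destruct (zcase1 a) as [->|[d ->]]; [left; apply le_refl|right].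
  exists d; ring.
- intros x [L|[d ->]]; rewrite (suE x).
  + left; apply le_trans with x; auto; apply le_addr.
  + destruct (zcase1 d) as [->|[e ->]]; [left|right].
    * exists 0; ring.
    * exists e; ring.
Qed.
Lemma mon_eq0 a b : a - b = 0 <-> a <= b.
Proof.
split.
- intro E; destruct (le_or_lt a b) as [L|L]; auto.
  apply lt_le, mon_le in L; rewrite E in L; exists 0; rewrite <- L; ring.
- intros [d ->]; apply mon_add0.
Qed.
Lemma not_le a b : ~ a <= b <-> b < a.
Proof.
split; [destruct (le_or_lt a b); tauto|apply lt_not_le].
Qed.
Lemma lt_or_le a b : a < b \/ b <= a.
Proof. destruct (le_or_lt b a); auto. Qed.
Lemma trichotomy a b : a < b \/ a = b \/ b < a.
Proof.
destruct (lt_or_le a b) as [L|L]; auto; destruct (lt_or_le b a) as [L'|L']; auto.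
right; left; apply le_antisym; assumption.
Qed.
Lemma mon_nz a b : a - b <> 0 <-> b < a.
Proof. rewrite mon_eq0; apply not_le. Qed.

Fixpoint numM (n : nat) : M N := match n with O => 0 | S n => numM n + 1 end.

Lemma eval_num G (e : env M G) n : eval e (num n) = numM n.
Proof.
induction n; [reflexivity|]; cbn [num numM]; rewrite <- suE, <- IHn.
reflexivity.
Qed.
(** Models may be nonstandard, but not below a numeral. This is what allows the finitely many colors
    to be counted in the metatheory. *)
Lemma lt_num a n : a < numM n -> exists i, Nat.lt i n /\ a = numM i.
Proof.
induction n as [|n IH]; simpl; intro L; [destruct (lt0 L)|].
apply ltSW in L; destruct (lt_or_le a (numM n)) as [L'|L'].
- destruct (IH L') as [i [l E]]; exists i; split; [lia|exact E].
- exists n; split; [lia|apply le_antisym; auto].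
Qed.
Lemma num_lt i j : Nat.lt i j -> numM i < numM j.
Proof.
induction 1; simpl; [apply le_refl|].
apply le_trans with (1 := IHle), le_addr.
Qed.

Lemma muM1 (f : M T1) (m : M N) :
  muM f (m + 1) = condM (f $ muM f m) (muM f m + 1) (muM f m).
Proof. rewrite <- suE, muMS, suE; reflexivity. Qed.
Lemma mu_le (f : M T1) (m : M N) : muM f m <= m.
Proof.
ind_on m; [rewrite muM0; apply le_refl|].
intros x IH; rewrite muM1.
destruct (cond_cases (f $ muM f x) (muM f x + 1) (muM f x)) as [[_ ->]|[_ ->]].
- apply le_add; [exact IH|apply le_refl].
- apply le_trans with x; [exact IH|apply le_addr].
Qed.
Lemma mu_found (f : M T1) (m : M N) : muM f m = m \/ f $ muM f m <> 0.
Proof.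
ind_on m; [left; apply muM0|].
intros x IH; rewrite muM1.
destruct (cond_cases (f $ muM f x) (muM f x + 1) (muM f x)) as [[E ->]|[E ->]].
- left; destruct IH as [->|]; [reflexivity|contradiction].
- right; exact E.
Qed.
Lemma mu_below (f : M T1) (m j : M N) : j < muM f m -> f $ j = 0.
Proof.
ind_on m; [rewrite muM0; intro L; destruct (lt0 L)|].
intros x IH; rewrite muM1.
destruct (cond_cases (f $ muM f x) (muM f x + 1) (muM f x)) as [[E ->]|[E ->]];
  auto.
intro L; apply ltSW in L; destruct (lt_or_le j (muM f x)) as [L'|L']; auto.
rewrite (le_antisym L L'); exact E.
Qed.
Lemma mu_eq (f : M T1) (m j : M N) :
  j <= m -> f $ j <> 0 -> (forall i, i < j -> f $ i = 0) ->
  muM f m = j.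
Proof.
intros L nz z; destruct (trichotomy (muM f m) j) as [L'|[E|L']]; auto.
- destruct (mu_found f m) as [E|E]; [|destruct (E (z _ L'))].
  rewrite E in L'; destruct (lt_not_le L' L).
- destruct (nz (mu_below L')).
Qed.
Lemma mu_none (f : M T1) (m : M N) : (forall i, i < m -> f $ i = 0) -> muM f m = m.
Proof.
intro z; destruct (mu_found f m) as [E|E]; auto.
destruct (lt_or_le (muM f m) m) as [L|L]; [destruct (E (z _ L))|].
apply le_antisym; [apply mu_le|exact L].
Qed.
End Search.

(** * Coding of pairs and sequences *)

#[global] Opaque lam.

Definition sum0 : term [] (N ~> N) := lam (sumbelow v0).
Definition sumM (M : cmodel) (b : M N) : M N := eval enil sum0 $ b.
Definition ecodeM (M : cmodel) (a b : M N) : M N := sumM b + a.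
Definition pairM (M : cmodel) (i j : M N) : M N := ecodeM i (i + j + 1).

Definition mu G (t : term (N :: G) N) (m : term G N) : term G N :=
  cl mu0 @ lam t @ m.

(* Inverses of [ecode]: [hi w] is the larger and [lo w] the smaller vertex of
   the pair coded by [w].  The components of [w] under [pair] are [lo w] and
   [snd w]. *)
Definition hi0 : term [] (N ~> N) :=
  lam (mu (monus (sumbelow (Succ @ v0)) v1) (Succ @ v0)).
Definition hiM (M : cmodel) (w : M N) : M N := eval enil hi0 $ w.
Definition hi G (w : term G N) : term G N := cl hi0 @ w.
Definition lo G (w : term G N) : term G N := monus w (sumbelow (hi w)).
Definition loM (M : cmodel) (w : M N) : M N := w - sumM (hiM w).
Definition snd G (w : term G N) : term G N := monus (pred (hi w)) (lo w).
Definition sndM (M : cmodel) (w : M N) : M N := predM (hiM w) - loM w.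

Lemma eval_sumbelow (M : cmodel) G (e : env M G) b :
  eval e (sumbelow b) = sumM (eval e b).
Proof. unfold sumM, sum0; rewrite eval_lam; reflexivity. Qed.
Lemma eval_ecode (M : cmodel) G (e : env M G) a b :
  eval e (ecode a b) = ecodeM (eval e a) (eval e b).
Proof. unfold ecode, ecodeM; rewrite eval_add, eval_sumbelow; reflexivity. Qed.
Lemma eval_pair (M : model) G (e : env M G) a b :
  eval e (pair a b) = pairM (eval e a) (eval e b).
Proof. unfold pair, pairM; rewrite eval_ecode, <- suE; reflexivity. Qed.
Lemma eval_mu (M : cmodel) G (e : env M G) t m :
  eval e (mu t m) = muM (eval e (lam t)) (eval e m).
Proof. unfold mu; rewrite !eval_app, eval_cl; reflexivity. Qed.
Lemma eval_hi (M : cmodel) G (e : env M G) w : eval e (hi w) = hiM (eval e w).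
Proof. unfold hi; rewrite !eval_app, eval_cl; reflexivity. Qed.
Lemma eval_lo (M : cmodel) G (e : env M G) w : eval e (lo w) = loM (eval e w).
Proof. unfold lo; rewrite eval_monus, eval_sumbelow, eval_hi; reflexivity. Qed.
Lemma eval_snd (M : cmodel) G (e : env M G) w : eval e (snd w) = sndM (eval e w).
Proof. unfold snd; rewrite eval_monus, eval_pred, eval_hi, eval_lo; reflexivity. Qed.

(* [lev k r c] is the least code of a sequence that extends the one coded by
   [c] by [r] entries, so these codes are those in [lev k r c, lev k r (c+1)). *)
Definition lev0 (k : nat) : term [] (N ~> N ~> N) :=
  lam (lam (primrec v0 (snoc k v1 Zero) v1)).
Definition levM (M : cmodel) (k : nat) (r c : M N) : M N := eval enil (lev0 k) $ r $ c.
Definition lev G (k : nat) (r c : term G N) : term G N := cl (lev0 k) @ r @ c.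
Definition restr0 (k : nat) : term [] (T1 ~> N ~> N) := lam (lam (restr k v1 v0)).
Definition restrM (M : cmodel) (k : nat) (f : M T1) (m : M N) : M N :=
  eval enil (restr0 k) $ f $ m.
Definition snocM (M : model) (k : nat) (c i : M N) : M N := numM M k * c + i + 1.

Lemma eval_lev (M : cmodel) G (e : env M G) k r c :
  eval e (lev k r c) = levM k (eval e r) (eval e c).
Proof. unfold lev; rewrite !eval_app, eval_cl; reflexivity. Qed.
Lemma eval_snoc (M : model) G (e : env M G) k c i :
  eval e (snoc k c i) = snocM k (eval e c) (eval e i).
Proof.
unfold snoc, snocM; rewrite !eval_app, eval_add, eval_mul, eval_num.
apply suE.
Qed.
Lemma eval_restr (M : model) G (e : env M G) k f m :
  eval e (restr k f m) = restrM k (eval e f) (eval e m).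
Proof.
unfold restrM, restr0; rewrite !eval_lam.
apply model_rec_ext; intros p i; rewrite !eval_lam.
rewrite !eval_snoc, !eval_app; unfold wk; rewrite !eval_tsubst; reflexivity.
Qed.

#[global] Hint Unfold sumM hiM loM sndM ecodeM pairM levM restrM snocM : mdef.
Ltac def ::= lazymatch goal with
  | |- Def (fun x => x) => apply Def_id
  | |- Def (ap _) => apply Def_fun
  | |- Def (fun x => addM _ _) => apply Def_add; def
  | |- Def (fun x => predM _) => apply Def_pred; def
  | |- Def (fun x => monM _ _) => apply Def_mon; def
  | |- Def (fun x => condM _ _ _) => apply Def_cond; def
  | |- Def (fun x => mulM _ _) => apply Def_mul; def
  | |- Def (fun x => muM _ _) => apply Def_mu; def
  | |- Def (fun x => ap _ _) => first [apply Def_const | apply Def_app; def]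
  | |- Def (fun x => _) => first [assumption | apply Def_const |
      progress (autounfold with mdef); def]
  | |- Def ?g => first [assumption | change (Def (fun x => g x)); def]
  end.

Ltac evs_coding := first [rewrite eval_num | rewrite eval_sumbelow
  | rewrite eval_pair | rewrite eval_ecode | rewrite eval_snoc
  | rewrite eval_lev | rewrite eval_restr
  | rewrite eval_hi | rewrite eval_lo | rewrite eval_snd
  | rewrite eval_mu | rewrite eval_mul | rewrite eval_lam].
Ltac evs_more ::= evs_coding.

Section Coding.
Variable M : model.
Implicit Types a b c d i j w x y : M N.
Add Ring model_ring2 : (model_semiring M).

Lemma rc_step1 G (e : env M G) z F x :
  rc $ (x + 1) $ z $ eval e (lam (lam F)) =
  eval (econs x (econs (rc $ x $ z $ eval e (lam (lam F))) e)) F.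
Proof. rewrite <- suE; apply rc_step. Qed.

Lemma sum_0 : sumM (0 : M N) = 0.
Proof. unfold sumM, sum0; rewrite eval_lam; apply rcZ. Qed.
Lemma sum_S b : sumM (b + 1) = sumM b + b.
Proof.
unfold sumM, sum0; rewrite !eval_lam; unfold sumbelow, primrec; cbn [eval].
rewrite eval_v0, rc_step1, eval_add. reflexivity.
Qed.
Lemma sum_mono a b : a <= b -> sumM a <= sumM b.
Proof.
intros [d ->]; ind_on d; [rewrite addM0; apply le_refl|].
intros x L; replace (a + (x + 1)) with (a + x + 1) by ring; rewrite sum_S.
apply le_trans with (1 := L), le_addr.
Qed.
Lemma sum_ge b : b <= sumM b + 1.
Proof.
destruct (zcase1 b) as [->|[c ->]]; [apply le0|].
rewrite sum_S; exists (sumM c); ring.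
Qed.

Lemma hiE w : hiM w = muM (eval (econs w enil)
  (lam (monus (sumbelow (Succ @ v0)) v1))) (w + 1).
Proof. unfold hiM, hi0; rewrite eval_lam; evs; rewrite suE; reflexivity. Qed.
(** The pairs with larger vertex b fill the codes from [sumM b] up to but excluding [sumM (b + 1)];
    the search finds the least b whose interval ends beyond the code. *)
Lemma hi_ecode a b : a < b -> hiM (ecodeM a b) = b.
Proof.
intro L; rewrite hiE; unfold ecodeM; apply mu_eq.
(* The search bound, the code plus one, can be attained: the pair (0, 1) has code 0 and larger
   vertex 1. *)
- apply le_trans with (1 := sum_ge b); exists a; ring.
- rewrite eval_lam; evs; rewrite suE, sum_S; apply mon_nz.
  destruct L as [d ->]; exists d; ring.
- intros i L'; rewrite eval_lam; evs; rewrite suE; apply mon_eq0.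
  apply le_trans with (1 := sum_mono L'), le_addr.
Qed.
Lemma lo_ecode a b : a < b -> loM (ecodeM a b) = a.
Proof. intro L; unfold loM; rewrite hi_ecode; auto; apply mon_add. Qed.
Lemma pair_lt i j : i < i + j + 1.
Proof. exists j; ring. Qed.
Lemma lo_pair i j : loM (pairM i j) = i.
Proof. apply lo_ecode, pair_lt. Qed.
Lemma snd_pair i j : sndM (pairM i j) = j.
Proof.
unfold sndM; rewrite lo_pair; unfold pairM; rewrite hi_ecode by apply pair_lt.
rewrite predM1; apply mon_add.
Qed.
Lemma pair_mono i j j' : j < j' -> pairM i j < pairM i j'.
Proof.
intros [d ->]; unfold pairM, ecodeM.
replace (i + (j + 1 + d) + 1) with ((i + j + 1 + d) + 1) by ring;
  rewrite (sum_S (i + j + 1 + d)).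
assert (L : sumM (i + j + 1) <= sumM (i + j + 1 + d)) by apply sum_mono, le_addr.
destruct L as [e ->]; exists (e + i + j + d); ring.
Qed.
Lemma pair_ge_r i j : j <= pairM i j.
Proof.
unfold pairM, ecodeM; rewrite sum_S; exists (sumM (i + j) + i + i); ring.
Qed.

Section Sequences.
Variable k : nat.
Let K : M N := numM M k.

Lemma lev_0 c : levM k 0 c = c.
Proof. unfold levM, lev0; rewrite !eval_lam; apply rcZ. Qed.
Lemma lev_S r c : levM k (r + 1) c = K * levM k r c + 1.
Proof.
unfold levM, lev0; rewrite !eval_lam; unfold primrec; cbn [eval].
rewrite !eval_v1, !eval_v0, rc_step1, eval_snoc; unfold snocM.
rewrite eval_Zero, addM0.
do 2 f_equal; apply model_rec_ext; intros p i; rewrite !eval_lam; evs.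
reflexivity.
Qed.
(** The children of c have the codes from K c + 1 to K (c + 1), so the descendants of c at depth r +
    1 are those at depth r of this interval. *)
Lemma lev_shift r c : levM k (r + 1) c = levM k r (K * c + 1).
Proof.
ind_on r.
- rewrite lev_S, !lev_0; reflexivity.
- intros x E; rewrite lev_S, E, lev_S; reflexivity.
Qed.
Lemma lev_mono r c c' : c <= c' -> levM k r c <= levM k r c'.
Proof.
intro L; ind_on r; [rewrite !lev_0; exact L|].
intros x IH; rewrite !lev_S; apply le_add; [apply le_mul, IH|apply le_refl].
Qed.
Lemma restr_0 (f : M T1) : restrM k f 0 = 0.
Proof. unfold restrM, restr0; rewrite !eval_lam; apply rcZ. Qed.
Lemma restr_S (f : M T1) m : restrM k f (m + 1) = snocM k (restrM k f m) (f $ m).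
Proof.
unfold restrM, restr0; rewrite !eval_lam.
transitivity (eval (econs m (econs (restrM k f m) (econs (m + 1) (econs f enil))))
  (snoc k v1 (wk (wk v1) @ v0))).
- unfold restr, primrec; cbn [eval]; rewrite eval_v0, rc_step1.
  do 3 f_equal; unfold restrM, restr0; rewrite !eval_lam.
  unfold restr, primrec; cbn [eval]; rewrite eval_v0.
  apply model_rec_ext; intros p i; rewrite !eval_lam; evs; reflexivity.
- rewrite eval_snoc, eval_app, !eval_wk; unfold restrM, restr0.
  rewrite !eval_lam; reflexivity.
Qed.
(** Turns [has_length] into membership in the interval between two consecutive values of [levM] at
    the root. *)
Lemma restr_min (m : M N) : restrM k (pi $ 0) m = levM k m 0.
Proof.
ind_on m; [rewrite restr_0, lev_0; reflexivity|].
intros x E; rewrite restr_S, lev_S, E; unfold snocM.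
rewrite piE, addM0; reflexivity.
Qed.

Hypothesis k1 : Nat.lt 0 k.

Lemma one_le_K : 1 <= K.
Proof.
destruct (@num_lt M 0 k k1) as [d E]; exists d.
unfold K; rewrite E; cbn [numM]; ring.
Qed.
Lemma K_pred : exists K' : M N, K = K' + 1.
Proof. destruct one_le_K as [d E]; exists d; rewrite E; ring. Qed.
Lemma lev_ge r c : r <= levM k r c.
Proof.
destruct K_pred as [K' E].
ind_on r; [apply le0|intros x [d L]]; rewrite lev_S, L, E.
exists (K' * (x + d) + d); ring.
Qed.
Lemma lev_up i d : levM k i 0 <= levM k (i + d) 0.
Proof.
ind_on d; [rewrite addM0; apply le_refl|].
intros x L; apply le_trans with (1 := L).
replace (i + (x + 1)) with (i + x + 1) by ring; rewrite lev_shift.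
apply lev_mono, le0.
Qed.
End Sequences.
End Coding.

(** * Decoding of sequences and the tree of colorings *)

Definition dist G (a b : term G N) : term G N := add (monus a b) (monus b a).
Definition distM (M : cmodel) (a b : M N) : M N := (a - b) + (b - a).
Lemma eval_dist (M : cmodel) G (e : env M G) a b :
  eval e (dist a b) = distM (eval e a) (eval e b).
Proof. reflexivity. Qed.

(** For positive k the children of b have the codes kb + 1, ..., kb + k, so the parent of c is the
    least b with c at most k (b + 1). The root becomes its own parent. *)
Definition parent0 (k : nat) : term [] (N ~> N) :=
  lam (mu (monus (Succ @ mul (num k) (Succ @ v0)) v1) v0).
Definition parent G k (c : term G N) : term G N := cl (parent0 k) @ c.
Definition parentM (M : cmodel) k (c : M N) : M N := eval enil (parent0 k) $ c.
Definition last G k (c : term G N) : term G N :=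
  monus (pred c) (mul (num k) (parent k c)).
Definition lastM (M : model) k (c : M N) : M N := predM c - numM M k * parentM k c.
Definition len0 (k : nat) : term [] (N ~> N) :=
  lam (mu (monus (lev k (Succ @ v0) Zero) v1) v0).
Definition len G k (c : term G N) : term G N := cl (len0 k) @ c.
Definition lenM (M : cmodel) k (c : M N) : M N := eval enil (len0 k) $ c.
Definition anc0 (k : nat) : term [] (N ~> N ~> N) :=
  lam (lam (primrec v0 (parent k v1) v1)).
Definition anc G k (d c : term G N) : term G N := cl (anc0 k) @ d @ c.
Definition ancM (M : cmodel) k (d c : M N) : M N := eval enil (anc0 k) $ d $ c.
(* The [j]-th entry of the sequence coded by [c]. *)
Definition entry G k (c j : term G N) : term G N :=
  last k (anc k (monus (len k c) (Succ @ j)) c).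
Definition entryM (M : model) k (c j : M N) : M N :=
  lastM k (ancM k (lenM k c - (j + 1)) c).

Lemma eval_parent (M : cmodel) G (e : env M G) k c :
  eval e (parent k c) = parentM k (eval e c).
Proof. unfold parent; rewrite eval_app, eval_cl; reflexivity. Qed.
Lemma eval_last (M : model) G (e : env M G) k c :
  eval e (last k c) = lastM k (eval e c).
Proof.
unfold last, lastM.
rewrite eval_monus, eval_pred, eval_mul, eval_num, eval_parent; reflexivity.
Qed.
Lemma eval_len (M : cmodel) G (e : env M G) k c :
  eval e (len k c) = lenM k (eval e c).
Proof. unfold len; rewrite eval_app, eval_cl; reflexivity. Qed.
Lemma eval_anc (M : cmodel) G (e : env M G) k d c :
  eval e (anc k d c) = ancM k (eval e d) (eval e c).
Proof. unfold anc; rewrite !eval_app, eval_cl; reflexivity. Qed.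
Lemma eval_entry (M : model) G (e : env M G) k c j :
  eval e (entry k c j) = entryM k (eval e c) (eval e j).
Proof.
unfold entry, entryM; rewrite eval_last, eval_anc, eval_monus, eval_len, <- suE.
reflexivity.
Qed.

#[global] Hint Unfold parentM lastM lenM ancM entryM distM : mdef.
Ltac evs_decoding := first [evs_coding | rewrite eval_dist | rewrite eval_entry
  | rewrite eval_last | rewrite eval_parent | rewrite eval_len
  | rewrite eval_anc].
Ltac evs_more ::= evs_decoding.
(* [rewrite !suE] would loop, since [1] is itself a successor. *)
Ltac sus := repeat match goal with |- context [su $ ?x] =>
  lazymatch x with ze => fail | _ => rewrite (suE x) end end.

(* The code [c] belongs to the tree iff it codes a proper coloring of an
   initial segment of the graph [e]; [w] runs over the codes of pairs. *)
Definition tree0 (k : nat) : term [] T11 :=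
  lam (lam (monus (Succ @ mu
    (cond (v2 @ v0) Zero
      (cond (dist (entry k v1 (lo v0)) (entry k v1 (hi v0))) (Succ @ Zero) Zero))
    (sumbelow (len k v0))) (sumbelow (len k v0)))).

Section Decoding.
Variable M : model.
Implicit Types a b c d i j w x y m : M N.
Add Ring model_ring3 : (model_semiring M).

Lemma add_eq0 a b : a + b = 0 -> a = 0.
Proof.
destruct (zcase1 a) as [->|[c ->]]; auto.
intro E; destruct (@one_nz M (c + b)); rewrite <- E at 2; ring.
Qed.
Lemma dist_eq0 a b : distM a b = 0 <-> a = b.
Proof.
unfold distM; split.
- intro E; assert (E' := E); rewrite addC in E'; apply add_eq0 in E, E'.
  apply mon_eq0 in E, E'; apply le_antisym; assumption.
- intros ->; rewrite (proj2 (mon_eq0 b b) (le_refl b)); apply addM0.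
Qed.

Lemma hi_spec w : sumM (hiM w) <= w /\ w < sumM (hiM w + 1).
Proof.
rewrite hiE; set (F := eval _ _); set (h := muM F (w + 1)).
assert (FE : forall b, F $ b = sumM (b + 1) - w).
{ intro b; unfold F; rewrite eval_lam; evs; sus; reflexivity. }
split.
- destruct (zcase1 h) as [E|[b E]]; [rewrite E, sum_0; apply le0|].
  rewrite E; apply mon_eq0; rewrite <- FE.
  apply (@mu_below _ F (w + 1)); fold h; rewrite E; apply le_refl.
- apply mon_nz; rewrite <- FE.
  destruct (mu_found F (w + 1)) as [E|E]; auto; fold h in E.
  rewrite E, FE; apply mon_nz; rewrite !sum_S; exists (sumM w + w); ring.
Qed.
Lemma lo_lt_hi w : loM w < hiM w.
Proof.
destruct (hi_spec w) as [[d E] L]; unfold loM; rewrite E at 1; rewrite mon_add.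
rewrite sum_S in L; apply (@le_addI _ _ _ (sumM (hiM w))).
apply le_trans with (2 := L); rewrite E at 2; exists 0; ring.
Qed.
Lemma ecode_lo_hi w : ecodeM (loM w) (hiM w) = w.
Proof. apply mon_le, hi_spec. Qed.
Lemma hi_lt w m : w < sumM m <-> hiM w < m.
Proof.
destruct (hi_spec w) as [L1 L2]; split; intro L.
- destruct (lt_or_le (hiM w) m) as [L'|L']; auto.
  apply sum_mono in L'; destruct (lt_not_le L).
  apply le_trans with (1 := L'), L1.
- apply sum_mono in L; apply lt_le_trans with (1 := L2), L.
Qed.

Variables (k : nat) (k1 : Nat.lt 0 k).
Let K : M N := numM M k.

Lemma parent_snoc c i : i < K -> parentM k (snocM k c i) = c.
Proof.
intros [d E]; unfold parentM, parent0; rewrite eval_lam; evs.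
fold K; unfold snocM; fold K; apply mu_eq.
- destruct (@K_pred M k k1) as [K' E']; fold K in E'; rewrite E'.
  exists (K' * c + i + 1); ring.
- rewrite eval_lam; evs; sus; fold K; apply mon_nz.
  exists d; rewrite E; ring.
- intros j [l ->]; rewrite eval_lam; evs; sus; fold K; apply mon_eq0.
  exists (K * l + i); ring.
Qed.
Lemma last_snoc c i : i < K -> lastM k (snocM k c i) = i.
Proof.
intro L; unfold lastM; rewrite parent_snoc; auto; fold K.
unfold snocM; fold K; rewrite predM1; apply mon_add.
Qed.

Lemma lenE c : lenM k c =
  muM (eval (econs c enil) (lam (monus (lev k (Succ @ v0) Zero) v1))) c.
Proof. unfold lenM, len0; rewrite eval_lam; evs; reflexivity. Qed.
Lemma len_eq c m : levM k m 0 <= c -> c < levM k (m + 1) 0 -> lenM k c = m.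
Proof.
intros L1 L2; rewrite lenE; apply mu_eq.
- apply le_trans with (2 := L1), lev_ge, k1.
- rewrite eval_lam; evs; sus; apply mon_nz, L2.
- intros i [d ->]; rewrite eval_lam; evs; sus; apply mon_eq0.
  apply le_trans with (2 := L1), lev_up.
Qed.
Lemma len_spec c : levM k (lenM k c) 0 <= c /\ c < levM k (lenM k c + 1) 0.
Proof.
rewrite lenE; set (F := eval _ _); set (h := muM F c).
assert (FE : forall b, F $ b = levM k (b + 1) 0 - c).
{ intro b; unfold F; rewrite eval_lam; evs; sus; reflexivity. }
split.
- destruct (zcase1 h) as [E|[b E]]; [rewrite E, lev_0; apply le0|].
  rewrite E; apply mon_eq0; rewrite <- FE.
  apply (@mu_below _ F c); fold h; rewrite E; apply le_refl.
- apply mon_nz; rewrite <- FE.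
  destruct (mu_found F c) as [E|E]; auto; fold h in E.
  rewrite E, FE; apply mon_nz; apply (@lev_ge M k k1 (c + 1) 0).
Qed.
Lemma len_snoc c i : i < K -> lenM k (snocM k c i) = lenM k c + 1.
Proof.
intros [d E]; destruct (len_spec c) as [[x Ex] [y Ey]].
apply len_eq; rewrite lev_S; fold K; unfold snocM; fold K.
- exists (K * x + i); rewrite Ex at 1; ring.
- exists (K * y + d); rewrite Ey, E; ring.
Qed.

Lemma anc_0 c : ancM k 0 c = c.
Proof. unfold ancM, anc0; rewrite !eval_lam; apply rcZ. Qed.
Lemma anc_S d c : ancM k (d + 1) c = parentM k (ancM k d c).
Proof.
unfold ancM, anc0; rewrite !eval_lam; unfold primrec; cbn [eval].
change (eval (econs c (econs (d + 1) enil)) v1) with (d + 1).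
etransitivity; [apply rc_step1|].
rewrite eval_parent.
apply (f_equal (parentM k)).
apply model_rec_ext; intros p i; rewrite !eval_lam, !eval_parent; reflexivity.
Qed.
Lemma anc_snoc c i d : i < K -> ancM k (d + 1) (snocM k c i) = ancM k d c.
Proof.
intro L; ind_on d.
- rewrite anc_S, !anc_0; apply parent_snoc, L.
- intros x E; rewrite anc_S, E, anc_S; reflexivity.
Qed.
Lemma entry_snoc c i j : i < K -> j < lenM k c ->
  entryM k (snocM k c i) j = entryM k c j.
Proof.
intros L [d E]; unfold entryM; rewrite len_snoc, E; auto.
replace (j + 1 + d + 1) with (j + 1 + (d + 1)) by ring.
rewrite !mon_add, anc_snoc; auto.
Qed.

Section Restr.
Variables (f : M T1) (m0 : M N).
Hypothesis bf : forall j, j < m0 -> f $ j < K.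

(** Entries are bounded only before [m0], since a coloring of a finite segment is unconstrained
    beyond it; hence the conditions relative to [m0] throughout the decoding lemmas. *)
Lemma restr_bounds m : m <= m0 ->
  levM k m 0 <= restrM k f m /\ restrM k f m < levM k (m + 1) 0.
Proof.
ind_on m; [intros _; rewrite restr_0; split|].
- rewrite lev_0; apply le_refl.
- apply lev_ge, k1.
- intros x IH L; destruct IH as [[d E] [d' E']]; [apply lt_le, L|].
  destruct (bf L) as [y Ey].
  rewrite lev_S, restr_S; fold K; unfold snocM; fold K; split.
  + exists (K * d + f $ x); rewrite E; ring.
  + rewrite lev_S; fold K; rewrite E'; exists (y + K * d'); rewrite Ey; ring.
Qed.
Lemma len_restr m : m <= m0 -> lenM k (restrM k f m) = m.
Proof. intro L; apply len_eq; apply restr_bounds, L. Qed.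
Lemma anc_restr d m : d + m <= m0 -> ancM k d (restrM k f (d + m)) = restrM k f m.
Proof.
(* The total length x stays fixed while d varies, so that one more ancestor step acts on the same
   code. *)
revert m; enough (H : forall x, d <= x -> x <= m0 ->
  ancM k d (restrM k f x) = restrM k f (x - d)).
{ intros m L; rewrite H, mon_add; auto; apply le_addr. }
intros x; ind_on d.
- intros _ _; rewrite anc_0, monM0; reflexivity.
- intros d IH [y E] L; rewrite anc_S, IH; auto; [|exists (1 + y); rewrite E; ring].
  rewrite E; replace (d + 1 + y) with (d + (y + 1)) at 1 by ring.
  rewrite !mon_add, restr_S; apply parent_snoc, bf.
  apply le_trans with (2 := L); rewrite E; exists d; ring.
Qed.
Lemma entry_restr j m : m <= m0 -> j < m -> entryM k (restrM k f m) j = f $ j.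
Proof.
intros L [d E]; unfold entryM; rewrite len_restr by exact L.
rewrite E, mon_add.
replace (j + 1 + d) with (d + (j + 1)) in E |- * by ring; rewrite anc_restr.
- rewrite restr_S; apply last_snoc, bf.
  apply le_trans with (2 := L); rewrite E; exists d; ring.
- rewrite <- E; exact L.
Qed.
End Restr.

(** The pairs a < b < m have exactly the codes below [sumM m], so a single bounded search for a
    monochromatic edge decides whether the coded coloring is proper. *)
Lemma tree_spec (u : M T1) c : eval enil (tree0 k) $ u $ c <> 0 <->
  forall a b, a < b -> b < lenM k c -> u $ ecodeM a b <> 0 ->
    entryM k c a <> entryM k c b.
Proof.
unfold tree0; rewrite !eval_lam; evs; sus; rewrite mon_nz, ltS.
set (F := eval _ _).
assert (FE : forall w, F $ w <> 0 <->
  u $ w <> 0 /\ entryM k c (loM w) = entryM k c (hiM w)).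
{ intro w; unfold F; rewrite eval_lam; evs.
  match goal with |- context [condM ?x ?y ?z] =>
    destruct (cond_cases x y z) as [[E ->]|[E ->]] end.
  - tauto.
  - rewrite <- (dist_eq0 (entryM k c (loM w)) (entryM k c (hiM w))).
    match goal with |- context [condM ?x ?y ?z] =>
      destruct (cond_cases x y z) as [[E' ->]|[E' ->]] end.
    + split; [intros _; split; assumption|intros _; apply su_nz].
    + tauto. }
split.
- intros L a b ab bl ne Ee; apply (FE (ecodeM a b)).
  + rewrite lo_ecode, hi_ecode; auto.
  + apply (mu_below (m := sumM (lenM k c))).
    apply lt_le_trans with (2 := L); apply hi_lt; rewrite hi_ecode; auto.
- intro H; rewrite mu_none; [apply le_refl|].
  intros w L; apply NNPP; intro nz; apply FE in nz as [nz Ee].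
  apply (H (loM w) (hiM w)); auto.
  + apply lo_lt_hi.
  + apply hi_lt, L.
  + rewrite ecode_lo_hi; exact nz.
Qed.
End Decoding.

(** * Choosing a path with LLPO *)

Definition par0 : term [] (N ~> N) :=
  lam (primrec Zero (monus (Succ @ Zero) v1) v0).
Definition par G (j : term G N) : term G N := cl par0 @ j.
Definition parM (M : cmodel) (j : M N) : M N := eval enil par0 $ j.
Definition half0 : term [] (N ~> N) := lam (primrec Zero (add v1 (par v0)) v0).
Definition half G (j : term G N) : term G N := cl half0 @ j.
Definition halfM (M : cmodel) (j : M N) : M N := eval enil half0 $ j.
(* Nonzero iff no code in [a, b) belongs to the tree [u]. *)
Definition dead0 : term [] (T1 ~> N ~> N ~> N) :=
  lam (lam (lam (monus (Succ @ mu (v3 @ add v2 v0) (monus v0 v1)) (monus v0 v1)))).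
Definition dead G (u : term G T1) (a b : term G N) : term G N := cl dead0 @ u @ a @ b.
Definition deadM (M : cmodel) (u : M T1) (a b : M N) : M N :=
  eval enil dead0 $ u $ a $ b.
(* The instance of LLPO for the node [z] asks which comes first: the extinction
   of the descendants of [z] or that of the descendants of all the later
   siblings of [z]. *)
Definition race0 k : term [] (T1 ~> N ~> N ~> N) :=
  lam (lam (lam (cond (par v0)
    (dead v2 (lev k (half v0) v1) (lev k (half v0) (Succ @ v1)))
    (dead v2 (lev k (half v0) (Succ @ v1))
       (lev k (half v0) (snoc k (Succ @ parent k v1) Zero)))))).
Definition race G k (u : term G T1) (z j : term G N) : term G N :=
  cl (race0 k) @ u @ z @ j.
Definition raceM (M : cmodel) k (u : M T1) (z j : M N) : M N :=
  eval enil (race0 k) $ u $ z $ j.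
Definition races0 k : term [] T11 := lam (lam (race k v1 (lo v0) (snd v0))).
(* If no answer is 0, the search ends at [k - 1], the last child. *)
Definition choice0 k : term [] (T1 ~> N ~> N) :=
  lam (lam (mu (cond (v2 @ snoc k v1 v0) (Succ @ Zero) Zero) (num (Nat.pred k)))).
Definition choice G k (y : term G T1) (c : term G N) : term G N :=
  cl (choice0 k) @ y @ c.
Definition choiceM (M : cmodel) k (y : M T1) (c : M N) : M N :=
  eval enil (choice0 k) $ y $ c.
Definition branch0 k : term [] (T1 ~> N ~> N) :=
  lam (lam (primrec Zero (snoc k v1 (choice k v3 v1)) v0)).
Definition branch G k (y : term G T1) (m : term G N) : term G N :=
  cl (branch0 k) @ y @ m.
Definition branchM (M : cmodel) k (y : M T1) (m : M N) : M N :=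
  eval enil (branch0 k) $ y $ m.
Definition path0 k : term [] T11 := lam (lam (choice k v1 (branch k v1 v0))).

Section EvalRace.
Variables (M : model) (G : list ty) (e : env M G).
Lemma eval_par j : eval e (par j) = parM (eval e j).
Proof. unfold par; rewrite !eval_app, eval_cl; reflexivity. Qed.
Lemma eval_half j : eval e (half j) = halfM (eval e j).
Proof. unfold half; rewrite !eval_app, eval_cl; reflexivity. Qed.
Lemma eval_dead u a b : eval e (dead u a b) = deadM (eval e u) (eval e a) (eval e b).
Proof. unfold dead; rewrite !eval_app, eval_cl; reflexivity. Qed.
Lemma eval_race k u z j :
  eval e (race k u z j) = raceM k (eval e u) (eval e z) (eval e j).
Proof. unfold race; rewrite !eval_app, eval_cl; reflexivity. Qed.
Lemma eval_choice k y c : eval e (choice k y c) = choiceM k (eval e y) (eval e c).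
Proof. unfold choice; rewrite !eval_app, eval_cl; reflexivity. Qed.
Lemma eval_branch k y m : eval e (branch k y m) = branchM k (eval e y) (eval e m).
Proof. unfold branch; rewrite !eval_app, eval_cl; reflexivity. Qed.
End EvalRace.

#[global] Hint Unfold parM halfM deadM raceM choiceM branchM : mdef.
Ltac evs_race := first [evs_decoding | rewrite eval_par | rewrite eval_half
  | rewrite eval_dead | rewrite eval_race | rewrite eval_choice
  | rewrite eval_branch].
Ltac evs_more ::= evs_race.

Section Race.
Variable M : model.
Implicit Types a b c d h i j w x z m r s : M N.
Implicit Types u y : M T1.
Add Ring model_ring4 : (model_semiring M).

Lemma par_0 : parM (0 : M N) = 0.
Proof. unfold parM, par0; rewrite eval_lam; apply rcZ. Qed.
Lemma par_S j : parM (j + 1) = 1 - parM j.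
Proof.
unfold parM, par0; rewrite !eval_lam; unfold primrec; cbn [eval].
change (eval (econs (j + 1) enil) v0) with (j + 1).
etransitivity; [apply rc_step1|]; reflexivity.
Qed.
Lemma half_0 : halfM (0 : M N) = 0.
Proof. unfold halfM, half0; rewrite eval_lam; apply rcZ. Qed.
Lemma half_S j : halfM (j + 1) = halfM j + parM j.
Proof.
unfold halfM, half0; rewrite !eval_lam; unfold primrec; cbn [eval].
change (eval (econs (j + 1) enil) v0) with (j + 1).
etransitivity; [apply rc_step1|]; rewrite eval_add, eval_par.
apply (f_equal (fun a => a + parM j)).
apply model_rec_ext; intros p i; rewrite !eval_lam, !eval_add, !eval_par.
reflexivity.
Qed.
Lemma one_sub_0 : (1 : M N) - 0 = 1.
Proof. apply monM0. Qed.
Lemma one_sub_1 : (1 : M N) - 1 = 0.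
Proof. apply mon_eq0, le_refl. Qed.
Lemma par_double h : parM (h + h) = 0 /\ halfM (h + h) = h.
Proof.
ind_on h; [rewrite addM0, par_0, half_0; auto|].
intros x [E E']; replace (x + 1 + (x + 1)) with (x + x + 1 + 1) by ring.
rewrite par_S, half_S, par_S, half_S, E, E', one_sub_0, one_sub_1.
split; [reflexivity|ring].
Qed.
Lemma par_double1 h : parM (h + h + 1) = 1 /\ halfM (h + h + 1) = h.
Proof.
destruct (par_double h) as [E E'].
rewrite par_S, half_S, E, E', one_sub_0, addM0; auto.
Qed.
Lemma par_half j : (parM j = 0 /\ j = halfM j + halfM j) \/
  (parM j = 1 /\ j = halfM j + halfM j + 1).
Proof.
ind_on j; [left; rewrite par_0, half_0, addM0; auto|].
intros x [[E E']|[E E']]; rewrite par_S, half_S, E; [right|left].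
- rewrite one_sub_0, addM0, <- E'; auto.
- rewrite one_sub_1; split; [reflexivity|].
  rewrite E' at 1; ring.
Qed.
Lemma double_inj a b : a + a <= b + b + 1 -> a <= b.
Proof.
intro L; destruct (le_or_lt a b) as [L'|[d E]]; auto.
rewrite E in L; destruct (@lt_not_le M (b + b + 1) (b + 1 + d + (b + 1 + d))); auto.
exists (d + d); ring.
Qed.

Lemma dead_spec u a b : deadM u a b <> 0 <->
  forall x, a <= x -> x < b -> u $ x = 0.
Proof.
unfold deadM, dead0; rewrite !eval_lam; evs; sus; rewrite mon_nz, ltS.
set (F := eval _ _).
assert (FE : forall d, F $ d = u $ (a + d)).
{ intro d; unfold F; rewrite eval_lam; evs; reflexivity. }
split.
- intros L x [d ->] L'; rewrite <- FE.
  apply (@mu_below _ F (b - a)), lt_le_trans with (2 := L).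
  destruct L' as [y ->]; replace (a + d + 1 + y) with (a + (d + 1 + y)) by ring.
  rewrite mon_add; exists y; ring.
- intro H; rewrite mu_none; [apply le_refl|].
  intros d L; rewrite FE; apply H; [apply le_addr|].
  destruct (le_or_lt a b) as [[y ->]|L'].
  + rewrite mon_add in L; destruct L as [z ->]; exists z; ring.
  + apply lt_le, mon_eq0 in L'; rewrite L' in L; destruct (lt0 L).
Qed.
Lemma dead_union u a b c : deadM u a b <> 0 -> deadM u b c <> 0 -> deadM u a c <> 0.
Proof.
rewrite !dead_spec; intros H1 H2 x L1 L2.
destruct (lt_or_le x b); auto.
Qed.

Variables (k : nat) (k1 : Nat.lt 0 k).
Let K : M N := numM M k.

Lemma snoc_surj x : exists c i, i < K /\ x + 1 = snocM k c i.
Proof.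
(* Naming the witnesses by terms gives the induction predicate a characteristic function. *)
enough (H : x + 1 = snocM k (parentM k (x + 1)) (lastM k (x + 1)) /\
  lastM k (x + 1) < K) by (destruct H; eauto).
destruct (@K_pred M k k1) as [K' E]; fold K in E.
assert (z : 0 < K) by (exists K'; rewrite E; ring).
ind_on x.
- replace (0 + 1 : M N) with (snocM k (0 : M N) 0) by (unfold snocM; ring).
  rewrite parent_snoc, last_snoc; auto.
- intros x [Ex [d L]].
  set (c := parentM k (x + 1)) in *; set (i := lastM k (x + 1)) in *.
  assert (exists c' i', i' < K /\ x + 1 + 1 = snocM k c' i')
    as [c' [i' [L' E']]].
  { rewrite Ex; unfold snocM; fold K.
    destruct (zcase1 d) as [->|[d' ->]].
    - exists (c + 1), 0; split; auto; rewrite L; ring.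
    - exists c, (i + 1); split; [exists d'; rewrite L; ring|ring]. }
  rewrite E', parent_snoc, last_snoc; auto.
Qed.

Lemma race_even u z r : raceM k u z (r + r) = deadM u (levM k r z) (levM k r (z + 1)).
Proof.
destruct (par_double r) as [E E'].
unfold raceM, race0; rewrite !eval_lam; evs; sus; rewrite E, E'; apply condM0.
Qed.
(** The later siblings of z are the codes from z + 1 up to but excluding the first child of the code
    following the parent. *)
Lemma race_odd u z r : raceM k u z (r + r + 1) =
  deadM u (levM k r (z + 1)) (levM k r (snocM k (parentM k z + 1) 0)).
Proof.
destruct (par_double1 r) as [E E'].
unfold raceM, race0; rewrite !eval_lam; evs; sus; rewrite E, E'; apply condMS.
Qed.

(** In a tree extinction is permanent: a member one level deeper would have its parent in the tree,
    and the two bounds show that this parent descends from the same interval. *)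
Lemma dead_mono u a b r r' :
  (forall c i, i < K -> u $ snocM k c i <> 0 -> u $ c <> 0) ->
  r <= r' -> deadM u (levM k r a) (levM k r b) <> 0 ->
  deadM u (levM k r' a) (levM k r' b) <> 0.
Proof.
intros T [d ->] H; ind_on d; [rewrite addM0; exact H|].
intros d IH; replace (r + (d + 1)) with (r + d + 1) by ring.
rewrite !lev_S; fold K; rewrite dead_spec in IH |- *; intros x L1 L2.
apply NNPP; intro nz; destruct L1 as [q Eq].
destruct (snoc_surj (K * levM k (r + d) a + q)) as [c [i [Li E]]].
replace x with (snocM k c i) in *
  by (rewrite Eq, <- E; ring).
apply (T _ _ Li nz), IH.
- destruct (le_or_lt (levM k (r + d) a) c) as [L|L]; auto.
  apply (le_mul K) in L; destruct (@lt_irrefl M (snocM k c i)).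
  destruct L as [y L], Li as [y' Li].
  exists (y' + y + q); rewrite Eq at 1; rewrite L; unfold snocM; fold K.
  rewrite Li; ring.
- destruct (lt_or_le c (levM k (r + d) b)) as [L|[y L]]; auto.
  destruct (@lt_irrefl M (K * levM k (r + d) b + 1)).
  apply le_trans with (2 := L2); unfold snocM; fold K; rewrite L.
  exists (K * y + i); ring.
Qed.

Lemma least u x : u $ x <> 0 ->
  exists j, j <= x /\ u $ j <> 0 /\ forall t, t < j -> u $ t = 0.
Proof.
intro nz; exists (muM u x); split; [apply mu_le|split].
- destruct (mu_found u x) as [->|E]; auto.
- intros t; apply mu_below.
Qed.

Lemma choiceE y c : choiceM k y c = muM (eval (econs c (econs y enil))
  (lam (cond (v2 @ snoc k v1 v0) (Succ @ Zero) Zero))) (numM M (Nat.pred k)).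
Proof. unfold choiceM, choice0; rewrite !eval_lam; evs; reflexivity. Qed.

Lemma choice_test y c i : eval (econs c (econs y enil))
  (lam (cond (v2 @ snoc k v1 v0) (Succ @ Zero) Zero)) $ i <> 0 <->
  y $ snocM k c i = 0.
Proof.
rewrite eval_lam; evs.
match goal with |- context [condM ?x ?y ?z] =>
  destruct (cond_cases x y z) as [[E ->]|[E ->]] end.
- split; [intros _; exact E|intros _; apply su_nz].
- tauto.
Qed.

Lemma K_eq : K = numM M (Nat.pred k) + 1.
Proof. unfold K; destruct k; [inversion k1|reflexivity]. Qed.

Lemma choice_lt y c : choiceM k y c < K.
Proof.
rewrite choiceE, K_eq; apply le_add; [apply mu_le|apply le_refl].
Qed.

Section Path.
Variables u x y : M T1.
Hypothesis T : forall c i, i < K -> u $ snocM k c i <> 0 -> u $ c <> 0.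
Hypothesis X : forall w, x $ w = raceM k u (loM w) (sndM w).
Hypothesis A0 : forall z j, y $ z = 0 -> x $ pairM z j <> 0 ->
  (forall t, t < j -> x $ pairM z t = 0) -> parM j = 1.
Hypothesis A1 : forall z j, y $ z <> 0 -> x $ pairM z j <> 0 ->
  (forall t, t < j -> x $ pairM z t = 0) -> parM j = 0.

Lemma race_pair z j : x $ pairM z j = raceM k u z j.
Proof. rewrite X, lo_pair, snd_pair; reflexivity. Qed.

(** Extinction of z at depth r makes the instance nonzero at 2r, so there is a first nonzero index,
    odd by the answer 0 and at most 2r. It records the extinction of the later siblings at a depth
    not above r, and extinction persists. *)
Lemma race0_wins z r : y $ z = 0 -> deadM u (levM k r z) (levM k r (z + 1)) <> 0 ->
  deadM u (levM k r (z + 1)) (levM k r (snocM k (parentM k z + 1) 0)) <> 0.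
Proof.
intros Y; rewrite <- race_even; intro nz.
destruct (@least (eval enil (race0 k) $ u $ z) (r + r) nz) as [j [Lj [nj bj]]].
assert (P : parM j = 1).
{ apply (A0 Y); rewrite ?race_pair; auto.
  intros t Lt; rewrite race_pair; apply bj, Lt. }
destruct (par_half j) as [[E _]|[_ E]].
{ rewrite P in E; destruct (su_nz E). }
fold (raceM k u z j) in nj; rewrite E, race_odd in nj.
apply dead_mono with (3 := nj); auto.
apply double_inj; rewrite E in Lj; apply le_trans with (r + r).
- apply lt_le, Lj.
- apply le_addr.
Qed.
(** The mirror image: the first nonzero index is even and at most 2r + 1, hence at most 2r, and
    records the extinction of z. *)
Lemma race1_wins z r : y $ z <> 0 ->
  deadM u (levM k r (z + 1)) (levM k r (snocM k (parentM k z + 1) 0)) <> 0 ->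
  deadM u (levM k r z) (levM k r (z + 1)) <> 0.
Proof.
intros Y; rewrite <- race_odd; intro nz.
destruct (@least (eval enil (race0 k) $ u $ z) (r + r + 1) nz) as [j [Lj [nj bj]]].
assert (P : parM j = 0).
{ apply (A1 Y); rewrite ?race_pair; auto.
  intros t Lt; rewrite race_pair; apply bj, Lt. }
destruct (par_half j) as [[_ E]|[E _]];
  [|rewrite P in E; symmetry in E; destruct (su_nz E)].
fold (raceM k u z j) in nj; rewrite E, race_even in nj.
apply dead_mono with (3 := nj); auto.
apply double_inj; rewrite E in Lj; exact Lj.
Qed.

(** Up to the chosen child, the children from i on keep a descendant at depth r: a child that is
    passed over has a nonzero answer, so if its later siblings were extinct it would be too. At the
    chosen child either no later sibling is left, or its answer is 0 and its extinction would entail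
    theirs. *)
Lemma choice_alive c r :
  deadM u (levM k (r + 1) c) (levM k (r + 1) (c + 1)) = 0 ->
  deadM u (levM k r (snocM k c (choiceM k y c)))
    (levM k r (snocM k c (choiceM k y c) + 1)) = 0.
Proof.
rewrite !lev_shift; fold K; intro H.
set (e := K * (c + 1) + 1) in *.
assert (Ee : e = snocM k (c + 1) 0) by (unfold e, snocM; fold K; ring).
set (F := eval (econs c (econs y enil))
  (lam (cond (v2 @ snoc k v1 v0) (Succ @ Zero) Zero))).
assert (step : forall i, i <= choiceM k y c ->
  deadM u (levM k r (snocM k c i)) (levM k r e) = 0).
{ intro i; ind_on i.
  - intros _; unfold snocM; fold K; rewrite addM0; exact H.
  - intros i IH L.
    apply NNPP; intro D.
    assert (Li : i < K) by (apply le_trans with (1 := L), lt_le, choice_lt).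
    assert (Y : y $ snocM k c i <> 0).
    { intro Y; apply choice_test in Y; apply Y.
      rewrite choiceE in L; exact (mu_below L). }
    replace (snocM k c (i + 1)) with (snocM k c i + 1) in D
      by (unfold snocM; ring).
    apply (dead_union (race1_wins (r := r) Y
      ltac:(rewrite parent_snoc, <- Ee; assumption)) D).
    apply IH, lt_le, L. }
specialize (step _ (le_refl _)).
apply NNPP; intro D.
rewrite choiceE in *; fold F in step, D |- *.
set (i := muM F (numM M (Nat.pred k))) in *.
destruct (mu_found F (numM M (Nat.pred k))) as [E|E]; fold i in E.
- replace (snocM k c i + 1) with e in D; [contradiction|].
  unfold e, snocM; fold K; rewrite E, K_eq; ring.
- apply choice_test in E.
  apply (dead_union D (race0_wins E D)).
  rewrite (parent_snoc k1), <- Ee; [exact step|].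
  unfold i, F; rewrite <- choiceE; apply choice_lt.
Qed.

Lemma branch_0 : branchM k y 0 = 0.
Proof. unfold branchM, branch0; rewrite !eval_lam; apply rcZ. Qed.
Lemma branch_S m :
  branchM k y (m + 1) = snocM k (branchM k y m) (choiceM k y (branchM k y m)).
Proof.
unfold branchM, branch0; rewrite !eval_lam; unfold primrec; cbn [eval].
change (eval (econs (m + 1) (econs y enil)) v0) with (m + 1).
etransitivity; [apply rc_step1|]; rewrite eval_snoc, eval_choice.
apply (f_equal (fun p => snocM k p (choiceM k y p))).
apply model_rec_ext; intros p i; rewrite !eval_lam, !eval_snoc, !eval_choice.
reflexivity.
Qed.

Lemma branch_in_tree s c : levM k s 0 <= c -> c < levM k (s + 1) 0 -> u $ c <> 0 ->
  u $ branchM k y s <> 0.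
Proof.
intros L1 L2 nz.
assert (H : forall m, m <= s -> deadM u (levM k (s - m) (branchM k y m))
  (levM k (s - m) (branchM k y m + 1)) = 0).
{ intro m; ind_on m.
  - intros _; rewrite monM0, branch_0; apply NNPP; rewrite dead_spec; intro D.
    (* The descendants of the root at depth s are all the codes of length s, so [c] itself shows
       that the root is alive. *)
    apply nz, D; auto; replace (0 + 1 : M N) with (K * 0 + 1) by ring.
    rewrite <- lev_shift; exact L2.
  - intros m IH [d E]; rewrite branch_S; apply choice_alive.
    specialize (IH ltac:(exists (1 + d); rewrite E; ring)).
    rewrite E, mon_add.
    replace (s - m) with (d + 1) in IH; [exact IH|].
    rewrite E; replace (m + 1 + d) with (m + (d + 1)) by ring.
    symmetry; apply mon_add. }
specialize (H s (le_refl _)).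
replace (s - s) with (0 : M N) in H by (symmetry; apply mon_eq0, le_refl).
rewrite !lev_0 in H; intro Z; revert H; apply dead_spec.
(* At depth 0 a node is its only descendant. *)
intros w La Lb; replace w with (branchM k y s); auto.
apply le_antisym; auto; apply ltSW, Lb.
Qed.

Lemma restr_path (v : M T1) : (forall m, v $ m = choiceM k y (branchM k y m)) ->
  forall m, restrM k v m = branchM k y m.
Proof.
intros V m; ind_on m; [rewrite restr_0, branch_0; reflexivity|].
intros m E; rewrite restr_S, branch_S, V, E; reflexivity.
Qed.
End Path.
End Race.

(** * Graphs for instances of LLPO *)

(* Nonzero iff [j] is the least argument at which the [i]-th section of [x]
   does not vanish. *)
Definition first0 : term [] (T1 ~> N ~> N ~> N) :=
  lam (lam (lam (cond (dist (mu (v3 @ pair v2 v0) v0) v0) (v2 @ pair v1 v0) Zero))).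
Definition first G (x : term G T1) (i j : term G N) : term G N := cl first0 @ x @ i @ j.
Definition firstM (M : cmodel) (x : M T1) (i j : M N) : M N :=
  eval enil first0 $ x $ i $ j.
(* The vertices (i, 1), (i, 2), ... form a path; (i, 0) is joined to (i, j + 1)
   iff [j] is the least argument at which the [i]-th section does not vanish. *)
Definition adj0 : term [] (T1 ~> N ~> N ~> N) :=
  lam (lam (lam (cond (dist (lo v1) (lo v0))
    (cond (snd v1)
      (cond (snd v0) Zero (first v2 (lo v0) (pred (snd v0))))
      (cond (dist (snd v0) (Succ @ snd v1)) (Succ @ Zero) Zero))
    Zero))).
Definition adj G (x : term G T1) (s t : term G N) : term G N := cl adj0 @ x @ s @ t.
Definition adjM (M : cmodel) (x : M T1) (s t : M N) : M N := eval enil adj0 $ x $ s $ t.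
(* The vertices below [K] are joined to all others and use up [K] colors. *)
Definition graph0 K : term [] T11 :=
  lam (lam (cond (monus (Succ @ lo v0) (num K)) (Succ @ Zero)
    (adj v1 (monus (lo v0) (num K)) (monus (hi v0) (num K))))).
(** Compares the colors of (i, 0) and (i, 1). The vertices (i, j + 1) with j even have the color of
    (i, 1), so equal colors exclude an edge to them and the answer is 0. *)
Definition read0 K : term [] T11 :=
  lam (lam (cond (dist (v1 @ add (num K) (pair v0 Zero))
    (v1 @ add (num K) (pair v0 (Succ @ Zero)))) Zero (Succ @ Zero))).
(** A coloring of the segment up to m. The clique takes the colors from 2 on and (i, j + 1) the
    parity of j; (i, 0) takes the opposite of the parity of the first j found below m. The bound
    suffices because j lies below the number of the vertex (i, j + 1). *)
Definition color0 K : term [] (T1 ~> N ~> T1) :=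
  lam (lam (lam (cond (monus (Succ @ v0) (num K)) (Succ @ (Succ @ v0))
    (cond (snd (monus v0 (num K)))
      (monus (Succ @ Zero)
        (par (mu (v3 @ pair (lo (monus v1 (num K))) v0) v1)))
      (par (Succ @ snd (monus v0 (num K)))))))).
Definition colorM (M : cmodel) K (x : M T1) (m v : M N) : M N :=
  eval enil (color0 K) $ x $ m $ v.

Lemma eval_first (M : cmodel) G (e : env M G) x i j :
  eval e (first x i j) = firstM (eval e x) (eval e i) (eval e j).
Proof. unfold first; rewrite !eval_app, eval_cl; reflexivity. Qed.
Lemma eval_adj (M : cmodel) G (e : env M G) x i j :
  eval e (adj x i j) = adjM (eval e x) (eval e i) (eval e j).
Proof. unfold adj; rewrite !eval_app, eval_cl; reflexivity. Qed.

#[global] Hint Unfold firstM adjM colorM : mdef.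
Ltac evs_more ::= first [evs_race | rewrite eval_first | rewrite eval_adj].
Ltac cond_case E := match goal with |- context [condM ?x ?y ?z] =>
  destruct (cond_cases x y z) as [[E ->]|[E ->]] end.

Section Graph.
Variable M : model.
Implicit Types a b c d h i j w z m r s t q v : M N.
Implicit Types x : M T1.
Add Ring model_ring5 : (model_semiring M).

Lemma first_spec x i j : firstM x i j <> 0 <->
  x $ pairM i j <> 0 /\ forall t, t < j -> x $ pairM i t = 0.
Proof.
unfold firstM, first0; rewrite !eval_lam; evs.
set (F := eval _ _).
assert (FE : forall t, F $ t = x $ pairM i t).
{ intro t; unfold F; rewrite eval_lam; evs; reflexivity. }
cond_case E; rewrite dist_eq0 in E.
- split; [intro nz; split; auto|tauto].
  intros t L; rewrite <- FE; apply (@mu_below _ F j); rewrite E; exact L.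
- split; [tauto|intros [_ H]]; destruct E; apply mu_none.
  intros t L; rewrite FE; auto.
Qed.

Lemma adj_spec x i q i' q' : adjM x (pairM i q) (pairM i' q') <> 0 <->
  i = i' /\ ((q = 0 /\ exists j, q' = j + 1 /\ firstM x i j <> 0) \/
             (q <> 0 /\ q' = q + 1)).
Proof.
unfold adjM, adj0; rewrite !eval_lam; evs; rewrite !lo_pair, !snd_pair; sus.
cond_case E; rewrite dist_eq0 in E; [subst i'|tauto].
cond_case E.
- cond_case E'.
  + split; [tauto|intros [_ [[_ [j [Ej _]]]|[]]]; [|contradiction]].
    rewrite E' in Ej; destruct (@one_nz _ j); auto.
  + destruct (zcase1 q') as [|[j Ej]]; [contradiction|].
    rewrite Ej, predM1; split.
    * intro nz; split; auto; left; split; auto; exists j; auto.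
    * intros [_ [[_ [j' [Ej' nz]]]|[]]]; [|contradiction].
      replace j with j'; auto; apply (@addI _ _ _ 1).
      rewrite (addC 1), (addC 1); auto.
- cond_case E'; rewrite dist_eq0 in E'.
  + split; [intros _; auto|intros _; apply su_nz].
  + split; [tauto|intros [_ [[]|[_ ]]]; contradiction].
Qed.

Variable K : nat.
Let C : M N := numM M K.

Lemma graph_spec x a b : a < b -> eval enil (graph0 K) $ x $ ecodeM a b <> 0 <->
  a < C \/ (C <= a /\ adjM x (a - C) (b - C) <> 0).
Proof.
intro L; unfold graph0; rewrite !eval_lam; evs; rewrite lo_ecode, hi_ecode; auto.
fold C; sus; cond_case E; rewrite mon_eq0 in E.
- split; [auto|intros _; apply su_nz].
- split; [intro nz; right; split; auto; apply not_le in E|].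
  + apply ltSW, E.
  + intros [|[_ nz]]; [contradiction|exact nz].
Qed.

Lemma pair_surj w : pairM (loM w) (sndM w) = w.
Proof.
rewrite <- (ecode_lo_hi w) at 3; unfold pairM; f_equal.
unfold sndM; destruct (lo_lt_hi w) as [d E]; rewrite E at 1.
replace (loM w + 1 + d) with (loM w + d + 1) by ring.
rewrite predM1, mon_add, E; ring.
Qed.
Lemma vertexP a : C <= a -> exists i q, a = C + pairM i q.
Proof.
intros [d ->]; exists (loM d), (sndM d); rewrite pair_surj; reflexivity.
Qed.

Lemma colorE x m v : colorM K x m v = condM ((v + 1) - C) (v + 1 + 1)
  (condM (sndM (v - C))
     (1 - parM (muM (eval (econs v (econs m (econs x enil)))
       (lam (v3 @ pair (lo (monus v1 (num K))) v0))) m))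
     (parM (sndM (v - C) + 1))).
Proof.
unfold colorM, color0; rewrite !eval_lam; evs; fold C; sus; reflexivity.
Qed.
Lemma par_lt2 j : parM j < 1 + 1.
Proof.
destruct (par_half j) as [[-> _]|[-> _]].
- exists 1; ring.
- exists 0; ring.
Qed.
Lemma one_sub_par j : 1 - parM j = parM (j + 1).
Proof. rewrite par_S; reflexivity. Qed.
Lemma color_bounded x m v : colorM K x m v < C + 1 + 1.
Proof.
rewrite colorE; cond_case E.
- apply mon_eq0 in E; destruct E as [d ->]; exists d; ring.
- apply lt_le_trans with (1 + 1); [|exists C; ring].
  cond_case E'; rewrite ?one_sub_par; apply par_lt2.
Qed.
Lemma par_alt j : parM j <> parM (j + 1).
Proof.
rewrite par_S; destruct (par_half j) as [[-> _]|[-> _]].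
- rewrite one_sub_0; intro E; symmetry in E; apply (su_nz E).
- rewrite one_sub_1; apply su_nz.
Qed.
Lemma color_vertex x m i q : exists F : M T1,
  (forall t, F $ t = x $ pairM i t) /\
  colorM K x m (C + pairM i q) = condM q (1 - parM (muM F m)) (parM (q + 1)).
Proof.
eexists; split; [|rewrite colorE, mon_add, snd_pair].
2: { match goal with |- condM ?x _ _ = _ => cut (x <> 0) end.
  - intro nz; cond_case E; [contradiction|reflexivity].
  - apply mon_nz; exists (pairM i q); ring. }
intro t; rewrite eval_lam; evs; fold C; rewrite mon_add, lo_pair; reflexivity.
Qed.
Lemma color_low x m a : a < C -> colorM K x m a = a + 1 + 1.
Proof. intro L; rewrite colorE, (proj2 (mon_eq0 _ _) L); apply condM0. Qed.
Lemma color_high x m a : C <= a -> colorM K x m a < 1 + 1.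
Proof.
intro L; destruct (vertexP L) as [i [q ->]].
destruct (color_vertex x m i q) as [F [_ ->]].
cond_case E; rewrite ?one_sub_par; apply par_lt2.
Qed.
Lemma color_proper x m a b : a < b -> b <= m ->
  eval enil (graph0 K) $ x $ ecodeM a b <> 0 -> colorM K x m a <> colorM K x m b.
Proof.
intros L Lm; rewrite graph_spec by exact L; intros [La|[La nz]].
- rewrite (color_low x m La); destruct (lt_or_le b C) as [Lb|Lb].
  + rewrite (color_low x m Lb); intro Eq; apply (@lt_irrefl M a).
    replace b with a in L; [exact L|].
    apply (@addI _ _ _ (1 + 1)).
    transitivity (a + 1 + 1); [ring|rewrite Eq; ring].
  + intro Eq; destruct (color_high x m Lb) as [d E]; rewrite <- Eq in E.
    apply (@lt_irrefl M (1 + 1)); exists (a + d); rewrite E at 1; ring.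
- destruct (vertexP La) as [i [q ->]].
  destruct (vertexP (le_trans La (lt_le L))) as [i' [q' ->]].
  rewrite !mon_add, adj_spec in nz.
  destruct (color_vertex x m i q) as [F [FE ->]].
  destruct (color_vertex x m i' q') as [F' [_ ->]].
  destruct nz as [<- [[-> [j [-> fj]]]|[nq ->]]].
  + rewrite condM0, cond1; apply first_spec in fj as [fj bj].
    rewrite (@mu_eq _ F m j), one_sub_par; [apply par_alt| | |].
    * apply le_trans with (2 := Lm), le_trans with (j + 1); [apply le_addr|].
      apply le_trans with (1 := @pair_ge_r _ i (j + 1)), le_addl.
    * rewrite FE; exact fj.
    * intros t Lt; rewrite FE; auto.
  + rewrite cond1; cond_case E; [contradiction|apply par_alt].
Qed.

Section Answer.
Variables x f : M T1.
Hypothesis bf : forall v, f $ v < C + 1 + 1.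
Hypothesis pf : forall a b, a < b ->
  eval enil (graph0 K) $ x $ ecodeM a b <> 0 -> f $ a <> f $ b.

(** Pigeonhole: three different colors at a, b, c together with those of the clique would be K + 3
    colors out of K + 2. Clique vertices and colors are numerals, so lists in the metatheory do the
    counting. *)
Lemma two_colors a b c : C <= a -> C <= b -> C <= c ->
  f $ a <> f $ b -> f $ c <> f $ b -> f $ a = f $ c.
Proof.
intros La Lb Lc ab cb; apply NNPP; intro ac.
assert (cl : forall n v, Nat.lt n K -> numM M n < v -> f $ numM M n <> f $ v).
{ intros n v Ln L; apply pf; auto; apply graph_spec; auto.
  left; apply num_lt, Ln. }
assert (hi : forall v, C <= v -> ~ In (f $ v) (map (fun n => f $ numM M n) (seq 0 K))).
{ intros v L I; apply in_map_iff in I as [n [E I]]; apply in_seq in I.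
  revert E; apply cl; [lia|].
  apply lt_le_trans with (2 := L), num_lt; lia. }
pose (l := f $ a :: f $ b :: f $ c :: map (fun n => f $ numM M n) (seq 0 K)).
assert (nd : NoDup l).
{ repeat constructor.
  - intros [E|[E|I]]; [auto|auto|exact (hi _ La I)].
  - intros [E|I]; [auto|exact (hi _ Lb I)].
  - exact (hi _ Lc).
  - assert (all : forall n, In n (seq 0 K) -> Nat.lt n K)
      by (intros n I; apply in_seq in I; lia).
    revert all; generalize (seq_NoDup K 0); generalize (seq 0 K); clear - cl.
    induction 1 as [|n l nI nd IH]; intro all; [constructor|].
    simpl; constructor; [|apply IH; intros; apply all; right; auto].
    intro I; apply in_map_iff in I as [n' [E I]].
    assert (L := all _ (or_introl eq_refl)); assert (L' := all _ (or_intror I)).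
    destruct (Nat.lt_total n n') as [O|[O|O]].
    + apply (cl n (numM M n') L (num_lt M O)); auto.
    + subst; contradiction.
    + apply (cl n' (numM M n) L' (num_lt M O)); auto. }
assert (ic : incl l (map (numM M) (seq 0 (S (S K))))).
{ intros v I.
  assert (v < C + 1 + 1) as L.
  { destruct I as [<-|[<-|[<-|I]]]; [apply bf|apply bf|apply bf|].
    apply in_map_iff in I as [n [<- _]]; apply bf. }
  destruct (@lt_num M v (S (S K)) L) as [n [Ln ->]]; apply in_map, in_seq; lia. }
assert (len := NoDup_incl_length nd ic); unfold l in len.
cbn [length] in len; rewrite !length_map, !length_seq in len; lia.
Qed.

Let V i q : M N := C + pairM i q.
Lemma V_ge i q : C <= V i q.
Proof. apply le_addr. Qed.
Lemma edge i q q' : q < q' ->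
  adjM x (pairM i q) (pairM i q') <> 0 -> f $ V i q <> f $ V i q'.
Proof.
intros L nz; unfold V; assert (L' : C + pairM i q < C + pairM i q').
{ destruct (pair_mono i L) as [d E]; exists d; rewrite E; ring. }
apply pf; auto; apply graph_spec; auto.
right; rewrite !mon_add; split; auto; apply le_addr.
Qed.
Lemma edge_path i q : f $ V i (q + 1) <> f $ V i (q + 1 + 1).
Proof.
apply edge; [apply le_refl|].
apply adj_spec; split; auto; right; split; auto; apply one_nz.
Qed.
Lemma edge_first i j : firstM x i j <> 0 -> f $ V i 0 <> f $ V i (j + 1).
Proof.
intro nz; apply edge; [exists j; ring|].
apply adj_spec; split; auto; left; split; auto; exists j; auto.
Qed.
Lemma path_even i h : f $ V i (h + h + 1) = f $ V i 1.
Proof.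
unfold V; ind_on h; [replace (0 + 0 + 1 : M N) with (1 : M N) by ring; reflexivity|].
fold (V i 1); intros h; fold (V i (h + h + 1)); fold (V i (h + 1 + (h + 1) + 1)).
intro E; rewrite <- E; symmetry.
apply two_colors with (V i (h + h + 1 + 1)); try apply V_ge.
- apply edge_path.
- replace (h + 1 + (h + 1) + 1) with (h + h + 1 + 1 + 1) by ring.
  intro E'; symmetry in E'; revert E'; apply edge_path.
Qed.

Lemma readE y : (forall i, y $ i = eval enil (read0 K) $ f $ i) ->
  forall i, (f $ V i 0 = f $ V i 1 /\ y $ i = 0) \/
            (f $ V i 0 <> f $ V i 1 /\ y $ i = 1).
Proof.
intros Y i; rewrite Y; unfold read0; rewrite !eval_lam; evs; fold C.
cond_case E; rewrite dist_eq0 in E; auto.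
Qed.

(** For even j the neighbor (i, j + 1) of (i, 0) would have the color of (i, 1), which is that of
    (i, 0). *)
Lemma answer_odd i j : f $ V i 0 = f $ V i 1 -> firstM x i j <> 0 -> parM j = 1.
Proof.
intros E nz; destruct (par_half j) as [[_ Ej]|[Ej _]]; auto.
apply edge_first in nz; rewrite Ej, path_even in nz; contradiction.
Qed.
(** For odd j the vertex (i, j + 1) differs in color from (i, 0), its neighbor, and from (i, 1),
    whose color recurs at its predecessor on the path; with two colors left, (i, 0) and (i, 1) would
    agree. *)
Lemma answer_even i j : f $ V i 0 <> f $ V i 1 -> firstM x i j <> 0 -> parM j = 0.
Proof.
intros nE nz; destruct (par_half j) as [[Ej _]|[_ Ej]]; auto.
destruct nE; apply two_colors with (V i (j + 1)); try apply V_ge.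
- apply edge_first, nz.
- rewrite Ej, <- (path_even i (halfM j)); apply edge_path.
Qed.
End Answer.
End Graph.

(** * Reductions *)

Section Sat.
Variables (M : model) (G : list ty) (e : env M G).

Lemma sat_le a b : sat (le a b) e <-> eval e a <= eval e b.
Proof. unfold le; cbn [sat]; rewrite eval_monus, eval_Zero; apply mon_eq0. Qed.
Lemma sat_lt a b : sat (lt a b) e <-> eval e a < eval e b.
Proof. unfold lt; rewrite sat_le, eval_app, eval_Succ, suE; reflexivity. Qed.
Lemma sat_in_tree t c : sat (in_tree t c) e <-> eval e t $ eval e c <> 0.
Proof. reflexivity. Qed.
Lemma sat_has_length k c m : sat (has_length k c m) e <->
  (levM k (eval e m) 0 <= eval e c /\ eval e c < levM k (eval e m + 1) 0).
Proof.
unfold has_length; cbn [sat]; rewrite sat_le, sat_lt; unfold minseq.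
rewrite !eval_restr, !eval_app, eval_Succ, (suE (eval e m)).
change (eval e Pi $ eval e Zero) with (@pi M N N $ 0).
rewrite !restr_min; reflexivity.
Qed.
Lemma sat_adjacent g a b : sat (adjacent g a b) e <->
  eval e g $ ecodeM (eval e a) (eval e b) <> 0.
Proof.
unfold adjacent; cbn [sat]; rewrite eval_app, eval_ecode, eval_Zero; reflexivity.
Qed.
Lemma sat_eqt1 (a b : term G T1) : sat (eqt a b) e <->
  forall j, eval e a $ j = eval e b $ j.
Proof.
cbn [eqt sat]; split; intros H j; specialize (H j); revert H;
  rewrite !eval_app, !eval_wk; auto.
Qed.
Lemma eval_section (x : term G T1) i j :
  eval e (section x i) $ j = eval e x $ pairM (eval e i) j.
Proof.
unfold section; rewrite eval_lam, eval_app, eval_pair, !eval_wk; reflexivity.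
Qed.
End Sat.

Section Sat2.
Variables (M : model) (G : list ty) (e : env M G).

Lemma sat_is_tree k t : sat (is_tree k t) e <-> forall c i, i < numM M k ->
  eval e t $ snocM k c i <> 0 -> eval e t $ c <> 0.
Proof.
unfold is_tree; cbn [sat]; split; intros H c i; specialize (H c i); revert H;
  rewrite sat_lt, !sat_in_tree, eval_num, !eval_wk, eval_snoc; auto.
Qed.
Lemma sat_bounded k f : sat (bounded k f) e <->
  forall v, eval e f $ v < numM M k.
Proof.
unfold bounded; cbn [sat]; split; intros H v; specialize (H v); revert H;
  rewrite sat_lt, eval_num, eval_app, eval_wk; auto.
Qed.
Lemma sat_fin_coloring k g f m : sat (fin_coloring k g f m) e <->
  (forall v, v <= eval e m -> eval e f $ v < numM M k) /\
  (forall b a, a < b -> b <= eval e m -> eval e g $ ecodeM a b <> 0 ->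
     eval e f $ a <> eval e f $ b).
Proof.
unfold fin_coloring, proper; cbn [sat]; split; intros [H1 H2]; split;
  [intros v|intros b a|intros v|intros b a]; (specialize (H1 v)||specialize (H2 b a)).
- revert H1; rewrite sat_le, sat_lt, eval_num, eval_app, !eval_wk; auto.
- revert H2; rewrite sat_le, sat_lt, sat_adjacent, !eval_app, !eval_wk; auto.
- rewrite sat_le, sat_lt, eval_num, eval_app, !eval_wk; auto.
- rewrite sat_le, sat_lt, sat_adjacent, !eval_app, !eval_wk; auto.
Qed.
Lemma sat_coloring k g f : sat (coloring k g f) e <->
  (forall v, eval e f $ v < numM M k) /\
  (forall b a, a < b -> eval e g $ ecodeM a b <> 0 -> eval e f $ a <> eval e f $ b).
Proof.
unfold coloring, proper; cbn [sat]; rewrite sat_bounded.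
split; intros [H1 H2]; split; auto; intros b a; specialize (H2 b a).
- revert H2; rewrite sat_lt, sat_adjacent, !eval_app, !eval_wk; auto.
- rewrite sat_lt, sat_adjacent, !eval_app, !eval_wk; auto.
Qed.
Lemma sat_first_nonzero p j : sat (first_nonzero p j) e <->
  (eval e p $ eval e j <> 0 /\ forall t, t < eval e j -> eval e p $ t = 0).
Proof.
unfold first_nonzero; cbn [sat]; split; intros [H1 H2]; split; auto;
  intro t; specialize (H2 t).
- revert H2; rewrite sat_lt, eval_app, !eval_wk; auto.
- rewrite sat_lt, eval_app, !eval_wk; auto.
Qed.
Lemma sat_even j : sat (even j) e <-> exists h, eval e j = h + h.
Proof.
unfold even; cbn [sat]; split; intros [h H]; exists h; revert H;
  rewrite eval_add, eval_wk; auto.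
Qed.
Lemma sat_odd j : sat (odd j) e <-> exists h, eval e j = h + h + 1.
Proof.
unfold odd; cbn [sat]; split; intros [h H]; exists h; revert H;
  rewrite eval_app, eval_add, eval_wk, eval_Succ, !eval_v0, (suE (h + h)); auto.
Qed.
Lemma sat_inst1 A x : sat (inst1 A x) e <-> sat A (econs (eval e x) enil).
Proof.
unfold inst1; rewrite sat_fsubst, eval_scons.
match goal with |- sat _ (econs _ ?E) <-> _ =>
  rewrite (nov_ext E (@enil M)) end; reflexivity.
Qed.
Lemma sat_inst2 o (A : form [o; T1]) x y :
  sat (inst2 A x y) e <-> sat A (econs (eval e y) (econs (eval e x) enil)).
Proof.
unfold inst2; rewrite sat_fsubst, !eval_scons.
match goal with |- sat _ (econs _ (econs _ ?E)) <-> _ =>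
  rewrite (nov_ext E (@enil M)) end; reflexivity.
Qed.
End Sat2.

(** * Reducibility as a statement about derivations *)

Lemma fsubst_inst1 G D (A : form [T1]) x (f : sub G D) :
  fsubst (inst1 A x) f = inst1 A (tsubst f x).
Proof.
unfold inst1; rewrite fsubst_comp, scons_comp; do 2 f_equal; apply nov_ext.
Qed.
Lemma fsubst_inst2 G D o (A : form [o; T1]) x y (f : sub G D) :
  fsubst (inst2 A x y) f = inst2 A (tsubst f x) (tsubst f y).
Proof.
unfold inst2; rewrite fsubst_comp, !scons_comp; do 3 f_equal; apply nov_ext.
Qed.

(** The inputs [x] and [z] are only provably [eqt] to the values of the functionals: a composed
    combinator term applied to [u] equals the iterated application only in this sense, and the
    freedom makes the relation transitive. *)
Definition reduces (Q P : problem T1) := exists Phi Psi : term [] T11,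
  forall G (H : list (form G)) (u x y z : term G T1),
  prf H (eqt x (cl Phi @ u)) -> prf H (eqt z (cl Psi @ y)) ->
  prf H (inst1 (pre Q) u) ->
  prf H (inst1 (pre P) x) /\
  (prf H (inst2 (post P) x y) -> prf H (inst2 (post Q) u z)).

Lemma reduces_weihrauch_le Q P : reduces Q P -> iRCA0w (weihrauch_le Q P).
Proof.
intros [Phi [Psi R]]; unfold iRCA0w, weihrauch_le.
rewrite <- fsubst_ids; apply (@ExI' _ _ _ _ _ ids Phi).
apply (@ExI' _ _ _ _ _ _ Psi); cbn [fsubst].
apply AllI, AllI, ImpI; rewrite !fsubst_inst1, !fsubst_inst2; cbn [map].
set (f := up (up (scons Psi (scons Phi ids)))).
change (tsubst f v1) with (@v1 [] T1 T1).
change (tsubst f v0) with (@v0 [T1] T1).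
assert (EP : tsubst f (v3 @ v1) = cl Phi @ v1).
{ cbn. unfold cl, wk; rewrite !tsubst_comp; do 2 f_equal; apply nov_ext. }
assert (EQ : tsubst f (v2 @ v0) = cl Psi @ v0).
{ cbn. unfold cl, wk; rewrite !tsubst_comp; do 2 f_equal; apply nov_ext. }
rewrite EP, EQ.
apply AndI.
- apply (R _ _ v1 (cl Phi @ v1) v0 (cl Psi @ v0)); try apply eqt_refl; apply hyp0.
- apply ImpI.
  apply (R _ _ v1 (cl Phi @ v1) v0 (cl Psi @ v0)); try apply eqt_refl;
    [apply prf_S|]; apply hyp0.
Qed.

Lemma goal_fsubst G (A : form G) : forall D (f : sub G D),
  goal A -> goal (fsubst A f).
Proof.
induction A; intros D f; simpl; try tauto.
- intros []; split; auto.
- intros []; split; apply frag_fsubst; auto.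
- intros []; split; [apply frag_fsubst|]; auto.
- auto.
- apply frag_fsubst.
Qed.

Ltac frags := repeat first [apply goal_fsubst | apply frag_fsubst]; lazy; tauto.

Lemma comp_eqt G (H : list (form G)) (Phi Phi' : term [] T11) (u x : term G T1) :
  prf H (eqt x (cl (Sigma @ (Pi @ Phi') @ Phi) @ u)) ->
  prf H (eqt x (cl Phi' @ (cl Phi @ u))).
Proof.
intro X.
apply (@transfer G (eqt x (cl Phi' @ (cl Phi @ u))) ltac:(frags)
  [eqt x (cl (Sigma @ (Pi @ Phi') @ Phi) @ u)]).
- intros B [<-|[]]; split; [frags|exact X].
- intros M e h; specialize (h _ (or_introl eq_refl)).
  rewrite sat_eqt1 in h |- *; intro j; rewrite h; f_equal.
  rewrite !eval_app, !eval_cl; cbn [eval]; rewrite sgE, piE; reflexivity.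
Qed.

Lemma reduces_trans P Q R : reduces P Q -> reduces Q R -> reduces P R.
Proof.
intros [Phi [Psi PQ]] [Phi' [Psi' QR]].
exists (Sigma @ (Pi @ Phi') @ Phi), (Sigma @ (Pi @ Psi) @ Psi').
intros G H u x y z X Z U.
apply comp_eqt in X; apply comp_eqt in Z.
destruct (PQ G H u (cl Phi @ u) (cl Psi' @ y) z (eqt_refl _ _) Z U) as [p1 p2].
destruct (QR G H (cl Phi @ u) x y (cl Psi' @ y) X (eqt_refl _ _) p1) as [q1 q2].
split; auto.
Qed.

Lemma env_cases (M : ty -> Type) G r (P : env M (r :: G) -> Prop) :
  (forall x e, P (econs x e)) -> forall e, P e.
Proof. intros H e; rewrite (econs_eta e); apply H. Qed.

Ltac hyps := let B := fresh "B" in let i := fresh "i" in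
  intros B i; cbn [In] in i; in_list i ltac:(split; [frags|auto]).
Ltac vars := repeat first [rewrite eval_v0 | rewrite eval_v1 | rewrite eval_v2
  | rewrite eval_v3].

Definition first_at (M : model) (p : M T1) j :=
  p $ j <> 0 /\ forall t, t < j -> p $ t = 0.
Lemma sat_post_LLPO (M : model) (n : M N) (p : M T1) :
  sat (post LLPO) (econs n (econs p enil)) <->
  (n = 0 -> forall j, first_at p j -> exists h, j = h + h + 1) /\
  (n <> 0 -> n = 1 /\ forall j, first_at p j -> exists h, j = h + h).
Proof.
assert (F : forall j, sat (first_nonzero v2 v0) (econs j (econs n (econs p enil)))
  <-> first_at p j) by (intro j; apply sat_first_nonzero).
cbn [post LLPO sat]; vars; rewrite eval_num, eval_Zero.
replace (numM M 1) with (1 : M N) by (cbn [numM]; rewrite add0l; reflexivity).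
split; intros [H0 H1]; (split; [intros n0 j f|intros n0; split;
  [exact (proj1 (H1 n0))|intros j f]]).
- rewrite <- F in f; apply H0 in f; auto; rewrite sat_odd in f; exact f.
- rewrite <- F in f; apply H1 in f; auto; rewrite sat_even in f; exact f.
- rewrite F in f; rewrite sat_odd; apply H0; auto.
- rewrite F in f; rewrite sat_even; apply H1; auto.
Qed.

Theorem LLPO_le_GC K : reduces (parallelization LLPO) (GC (S (S K))).
Proof.
exists (graph0 K), (read0 K); intros G H u x y z X Z _; split.
- apply prf_cut with [eqt x (cl (graph0 K) @ u)];
    [intros B [<-|[]]; exact X|clear X Z].
  apply AllI; cbn [map].
  (* The witness depends on the segment; a coloring of the whole graph would already answer all the
     instances of LLPO. *)
  apply (@ExI' _ _ _ _ _ _ (cl (color0 K) @ wk u @ v0)).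
  apply transfer with [fwk (r := N) (eqt x (cl (graph0 K) @ u))].
  + frags.
  + intros B [<-|[]]; split; [frags|apply hyp0].
  + intros M; refine (env_cases _); intros m e h.
    specialize (h _ (or_introl eq_refl)); rewrite sat_fwk, sat_eqt1 in h.
    rewrite sat_fsubst, eval_scons, eval_up, eval_scons, sat_fin_coloring.
    vars; rewrite !eval_app, eval_wk, eval_cl, eval_v0.
    split; [intros v _; apply color_bounded|].
    intros b a L Lm; rewrite h, eval_app, eval_cl; apply color_proper; auto.
- intro P.
  apply transfer with [eqt x (cl (graph0 K) @ u); eqt z (cl (read0 K) @ y);
    inst2 (post (GC (S (S K)))) x y].
  + frags.
  + hyps.
  + intros M e h.
    assert (X' := h _ (or_introl eq_refl)).
    assert (Z' := h _ (or_intror (or_introl eq_refl))).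
    assert (P' := h _ (or_intror (or_intror (or_introl eq_refl)))).
    rewrite sat_eqt1 in X', Z'; rewrite sat_inst2 in P' |- *.
    cbn [post GC] in P'; rewrite sat_coloring, !eval_v0, !eval_v1, eval_v0 in P'.
    destruct P' as [P1 P2].
    rewrite eval_app, eval_cl in X', Z'.
    cbn [post parallelization LLPO sat]; intro i; rewrite sat_inst2.
    rewrite sat_post_LLPO; vars; rewrite eval_app, eval_v1, !eval_v0.
    set (p := eval _ (section v2 v0)).
    assert (pE : forall t, p $ t = eval e u $ pairM i t)
      by (intro t; unfold p; rewrite eval_section; vars; reflexivity).
    assert (fE : forall j, first_at p j -> firstM (eval e u) i j <> 0).
    { intros j [nz b]; apply first_spec; rewrite <- pE; split; auto.
      intros t L; rewrite <- pE; auto. }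
    assert (P2' : forall a b, a < b ->
      eval enil (graph0 K) $ eval e u $ ecodeM a b <> 0 ->
      eval e y $ a <> eval e y $ b).
    { intros a b L; rewrite <- X'; apply P2, L. }
    destruct (readE Z' i) as [[E ->]|[E ->]]; split; intro N0.
    * intros j f; destruct (par_half j) as [[Ej _]|[_ Ej]]; eauto.
      rewrite (answer_odd P1 P2' E (fE j f)) in Ej; destruct (su_nz Ej).
    * contradiction.
    * destruct (su_nz N0).
    * split; auto; intros j f.
      destruct (par_half j) as [[_ Ej]|[Ej _]]; eauto.
      rewrite (answer_even P1 P2' E (fE j f)) in Ej; destruct (su_nz (eq_sym Ej)).
Qed.

Lemma tree_closed (M : model) k (k1 : Nat.lt 0 k) (u : M T1) c i : i < numM M k ->
  eval enil (tree0 k) $ u $ snocM k c i <> 0 -> eval enil (tree0 k) $ u $ c <> 0.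
Proof.
intros L; rewrite !tree_spec; auto; intros T a b ab bl.
rewrite <- (@entry_snoc M k k1 c i a L), <- (@entry_snoc M k k1 c i b L); auto.
- apply T; auto; rewrite len_snoc; auto.
  apply le_trans with (1 := bl), le_addr.
- apply lt_le_trans with (1 := ab), lt_le, bl.
Qed.

Lemma restr_in_tree (M : model) k (k1 : Nat.lt 0 k) (u f : M T1) m :
  (forall v, v <= m -> f $ v < numM M k) ->
  eval enil (tree0 k) $ u $ restrM k f m <> 0 <->
  forall a b, a < b -> b < m -> u $ ecodeM a b <> 0 -> f $ a <> f $ b.
Proof.
intro bf; rewrite tree_spec; auto.
assert (bf' : forall v, v < m -> f $ v < numM M k) by (intros; apply bf, lt_le; auto).
rewrite (len_restr k1 bf'); [|apply le_refl].
split; intros T a b ab bl.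
- rewrite <- (@entry_restr M k k1 f m bf' a m (le_refl m)),
    <- (@entry_restr M k k1 f m bf' b m (le_refl m)); auto.
  apply lt_le_trans with (1 := ab), lt_le; auto.
- rewrite !(entry_restr k1 bf' (le_refl m)); auto.
  apply lt_le_trans with (1 := ab), lt_le; auto.
Qed.

Theorem GC_le_WKL k (k1 : Nat.lt 0 k) : reduces (GC k) (WKL k).
Proof.
exists (tree0 k), (lam v0); intros G H u x y z X Z U; split.
- apply prf_cut with [eqt x (cl (tree0 k) @ u); inst1 (pre (GC k)) u];
    [intros B [<-|[<-|[]]]; assumption|clear X Z U].
  apply AndI'.
  + apply transfer with [eqt x (cl (tree0 k) @ u)].
    * frags.
    * intros B [<-|[]]; split; [frags|apply hyp0].
    * intros M e h; specialize (h _ (or_introl eq_refl)).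
      rewrite sat_eqt1, eval_app, eval_cl in h.
      rewrite sat_fsubst, eval_scons, sat_is_tree, eval_v0.
      intros c i L; rewrite !h; apply tree_closed; auto.
  + apply AllI'; cbn [map].
    match goal with |- prf ?L _ =>
      assert (P : prf L (inst1 (pre (GC k)) (wk u)))
        by (unfold wk; rewrite <- fsubst_inst1; apply Hyp; simpl; auto) end.
    (* The finite coloring is an existential hypothesis, so it is opened in the calculus; the model
       then sees it as a variable. *)
    apply (@AllE' _ _ _ _ _ _ v0) in P.
    apply (ExE' P); cbn [map].
    match goal with |- prf (?F :: _ ) _ => set (FC := F) end.
    apply transfer with [FC; fwk (r := T1) (fwk (r := N) (eqt x (cl (tree0 k) @ u)))].
    * frags.
    * intros B [<-|[<-|[]]]; (split; [frags|apply Hyp; simpl; auto]).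
    * intros M; refine (env_cases _); intros f; refine (env_cases _); intros m e h.
      assert (hF := h _ (or_introl eq_refl)).
      assert (X := h _ (or_intror (or_introl eq_refl))).
      rewrite !sat_fwk, sat_eqt1, eval_app, eval_cl in X.
      unfold FC in hF.
      rewrite sat_fsubst, eval_up, !eval_scons, sat_fin_coloring in hF.
      revert hF; vars; rewrite eval_wk; intros [F1 F2].
      rewrite sat_fwk, sat_fsubst, eval_up, eval_scons; cbn [sat].
      exists (restrM k f m); rewrite sat_has_length, sat_in_tree; vars.
      split.
      -- apply (@restr_bounds M k k1 f m); [|apply le_refl].
         intros; apply F1, lt_le; auto.
      -- rewrite X; apply restr_in_tree; auto.
         intros a b L Lb; apply F2; auto; apply lt_le, Lb.
- intro P.
  apply transfer with [eqt x (cl (tree0 k) @ u); eqt z (cl (lam v0) @ y);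
    inst2 (post (WKL k)) x y].
  + frags.
  + hyps.
  + intros M e h.
    assert (X' := h _ (or_introl eq_refl)).
    assert (Z' := h _ (or_intror (or_introl eq_refl))).
    assert (P' := h _ (or_intror (or_intror (or_introl eq_refl)))).
    rewrite sat_eqt1 in X', Z'; rewrite sat_inst2 in P' |- *.
    rewrite eval_app, eval_cl in X', Z'; rewrite eval_lam, eval_v0 in Z'.
    cbn [post GC]; rewrite sat_coloring; vars.
    destruct P' as [P1 P2].
    rewrite sat_bounded, eval_v0 in P1; cbn [sat] in P2.
    assert (P2' : forall m, eval e x $ restrM k (eval e y) m <> 0).
    { intro m; specialize (P2 m); rewrite sat_in_tree, eval_restr in P2.
      revert P2; vars; auto. }
    split; [intro v; rewrite Z'; apply P1|].
    intros b a L nz; rewrite !Z'.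
    (* The initial segment of length b + 1 is the shortest that contains the colors of both [a] and
       [b]. *)
    specialize (P2' (b + 1)); rewrite X' in P2'.
    revert nz; apply (proj1 (restr_in_tree k1 _ (fun v _ => P1 v)) P2'); auto.
    apply le_refl.
Qed.

(* Universal consequences of the correctness of the answers [y] to the
   sequence [x] of instances of LLPO. *)
Definition answers0 G (x y : term G T1) : form G :=
  All N (All N (wk (wk y) @ v1 == Zero ==>
    first (wk (wk x)) v1 v0 != Zero ==> par v0 == Succ @ Zero))%fm.
Definition answers1 G (x y : term G T1) : form G :=
  All N (All N (wk (wk y) @ v1 != Zero ==>
    first (wk (wk x)) v1 v0 != Zero ==> par v0 == Zero))%fm.

Lemma odd_par G (H : list (form G)) D (f : sub D G) (j : term D N) :
  prf H (fsubst (odd j) f) -> prf H (par (tsubst f j) == Succ @ Zero).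
Proof.
intro P; apply (ExE' P).
match goal with |- prf (?F :: _ ) _ => set (E := F) end.
apply transfer with [E]; [frags|intros B [<-|[]]; split; [frags|apply hyp0]|].
intros M; refine (env_cases _); intros h e hE; specialize (hE _ (or_introl eq_refl)).
unfold E in hE; rewrite sat_fsubst, eval_up in hE; cbn [sat] in hE.
rewrite eval_wk, eval_app, eval_Succ, eval_add, eval_v0 in hE.
rewrite sat_fwk; cbn [sat]; rewrite eval_par, eval_tsubst, hE, (suE (h + h)).
apply par_double1.
Qed.
Lemma even_par G (H : list (form G)) D (f : sub D G) (j : term D N) :
  prf H (fsubst (even j) f) -> prf H (par (tsubst f j) == Zero).
Proof.
intro P; apply (ExE' P).
match goal with |- prf (?F :: _ ) _ => set (E := F) end.
apply transfer with [E]; [frags|intros B [<-|[]]; split; [frags|apply hyp0]|].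
intros M; refine (env_cases _); intros h e hE; specialize (hE _ (or_introl eq_refl)).
unfold E in hE; rewrite sat_fsubst, eval_up in hE; cbn [sat] in hE.
rewrite eval_wk, eval_add, eval_v0 in hE.
rewrite sat_fwk; cbn [sat]; rewrite eval_par, eval_tsubst, hE.
apply par_double.
Qed.

Lemma sat_first_hyp (M : model) G (e : env M G) (x p : term G T1) i j n
  (f : sub [] G) :
  (forall t, eval e p $ t = eval e x $ pairM (eval e i) t) ->
  sat (first x i j != Zero)%fm e ->
  sat (fsubst (first_nonzero (@v2 [] T1 N N) v0) (scons j (scons n (scons p f)))) e.
Proof.
intros pE h; cbn [sat] in h; rewrite eval_first, eval_Zero in h.
apply first_spec in h as [h1 h2].
rewrite sat_fsubst, !eval_scons, sat_first_nonzero; vars.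
split; [rewrite pE; exact h1|intros t L; rewrite pE; auto].
Qed.

(** The formulas [odd] and [even] are existential, which bars the postcondition from being a
    hypothesis of [transfer]. Its existentials are eliminated in the calculus and parity is restated
    as an equation. *)
Lemma LLPO_answers G (H : list (form G)) (x y : term G T1) :
  prf H (inst2 (post (parallelization LLPO)) x y) ->
  prf H (answers0 x y) /\ prf H (answers1 x y).
Proof.
intro P; split; apply prf_cut with [inst2 (post (parallelization LLPO)) x y];
  try (intros B [<-|[]]; exact P); clear P;
  apply AllI, AllI, ImpI, ImpI; cbn [map];
  match goal with |- prf (?F :: ?E :: _) _ =>
    set (hf := F); set (hy := E) end;
  match goal with |- prf ?L _ =>
    assert (P : prf L (inst2 (post (parallelization LLPO)) (wk (wk x)) (wk (wk y))))
      by (unfold wk; rewrite <- !fsubst_inst2; apply Hyp; simpl; auto) end;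
  apply (@AllE' _ _ _ _ _ _ v1) in P; rewrite fsubst_inst2 in P;
  match type of P with prf _ (inst2 _ ?S0 ?T0) =>
    set (sx := S0) in P; set (ny := T0) in P end;
  assert (SE : forall (M : model) (e : env M (N :: N :: G)) j,
    eval e sx $ j = eval e (wk (wk x)) $ pairM (eval e v1) j)
    by (intros M e j; unfold sx; rewrite eval_tsubst, !eval_scons, eval_section;
        vars; reflexivity);
  assert (TE : forall (M : model) (e : env M (N :: N :: G)),
    eval e ny = eval e (wk (wk y) @ v1)) by reflexivity;
  clearbody sx ny; unfold inst2 in P; cbn [post LLPO] in P.
- refine (odd_par (j := v0) (ImpE' (AllE' v0 (ImpE' (AndE1' P) _)) _)); clear P.
  + apply transfer with [hy].
    * frags.
    * intros B [<-|[]]; split; [frags|apply Hyp; simpl; auto].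
    * intros M e h; specialize (h _ (or_introl eq_refl)).
      rewrite sat_fsubst, !eval_scons; cbn [sat]; vars; rewrite TE; exact h.
  + apply transfer with [hf].
    * frags.
    * intros B [<-|[]]; split; [frags|apply hyp0].
    * intros M e h; exact (sat_first_hyp ny _ (SE M e) (h _ (or_introl eq_refl))).
- refine (even_par (j := v0)
    (ImpE' (AllE' v0 (AndE2' (ImpE' (AndE2' P) _))) _)); clear P.
  + apply transfer with [hy].
    * frags.
    * intros B [<-|[]]; split; [frags|apply Hyp; simpl; auto].
    * intros M e h; specialize (h _ (or_introl eq_refl)).
      rewrite sat_fsubst, !eval_scons; cbn [sat]; vars; rewrite TE; exact h.
  + apply transfer with [hf].
    * frags.
    * intros B [<-|[]]; split; [frags|apply hyp0].
    * intros M e h; exact (sat_first_hyp ny _ (SE M e) (h _ (or_introl eq_refl))).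
Qed.

Theorem WKL_le_LLPO k (k1 : Nat.lt 0 k) : reduces (WKL k) (parallelization LLPO).
Proof.
exists (races0 k), (path0 k); intros G H u x y z X Z U; split.
{ apply transfer with (@nil (form G)).
  - frags.
  - intros B [].
  - intros M e _; rewrite sat_inst1; cbn [pre parallelization sat].
    intro i; rewrite sat_inst1; cbn [pre LLPO]; intros []. }
intro P; destruct (LLPO_answers P) as [P0 P1]; clear P.
(* The full precondition contains an existential; its tree half is split off because it can be
   handed to the models. *)
assert (UT : prf H (inst1 (is_tree k v0) u)).
{ unfold inst1 in U; cbn [pre WKL] in U; exact (AndE1' U). }
apply prf_cut with [eqt x (cl (races0 k) @ u); eqt z (cl (path0 k) @ y);
  inst1 (pre (WKL k)) u; answers0 x y; answers1 x y; inst1 (is_tree k v0) u];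
  [intros B [<-|[<-|[<-|[<-|[<-|[<-|[]]]]]]]; try assumption
  |clear X Z U UT P0 P1].
apply AndI'.
- apply transfer with [eqt z (cl (path0 k) @ y)].
  + frags.
  + intros B [<-|[]]; split; [frags|apply Hyp; simpl; auto].
  + intros M e h; specialize (h _ (or_introl eq_refl)).
    rewrite sat_eqt1, eval_app, eval_cl in h.
    rewrite sat_fsubst, !eval_scons, sat_bounded, eval_v0.
    intro m; rewrite h; unfold path0; rewrite !eval_lam, eval_choice.
    apply (choice_lt k1).
- apply AllI'; cbn [map].
  match goal with |- prf ?L _ =>
    assert (P : prf L (inst1 (pre (WKL k)) (wk u)))
      by (unfold wk; rewrite <- fsubst_inst1; apply Hyp; simpl; auto) end.
  unfold inst1 in P; cbn [pre WKL] in P.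
  (* The tree member of the given length serves only to show that the branch, which does not depend
     on it, survives to that level. *)
  apply (ExE' (AllE' v0 (AndE2' P))); clear P; cbn [map].
  match goal with |- prf (?F :: _ ) _ => set (FC := F) end.
  match goal with |- prf (_ :: ?L) _ => apply transfer with
    [FC; fwk (r := N) (fwk (r := N) (eqt x (cl (races0 k) @ u)));
     fwk (r := N) (fwk (r := N) (eqt z (cl (path0 k) @ y)));
     fwk (r := N) (fwk (r := N) (answers0 x y));
     fwk (r := N) (fwk (r := N) (answers1 x y));
     fwk (r := N) (fwk (r := N) (inst1 (is_tree k v0) u))] end.
  + frags.
  + intros B [<-|[<-|[<-|[<-|[<-|[<-|[]]]]]]]; (split; [frags|]);
      apply Hyp; simpl; tauto.
  + intros M; refine (env_cases _); intros c; refine (env_cases _); intros s e h.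
    assert (hF := h _ (or_introl eq_refl)).
    assert (X := h _ (or_intror (or_introl eq_refl))).
    assert (Z := h _ (or_intror (or_intror (or_introl eq_refl)))).
    assert (A0 := h _ (or_intror (or_intror (or_intror (or_introl eq_refl))))).
    assert (A1 := h _ (or_intror (or_intror (or_intror (or_intror
      (or_introl eq_refl)))))).
    assert (T := h _ (or_intror (or_intror (or_intror (or_intror
      (or_intror (or_introl eq_refl))))))).
    clear h; rewrite !sat_fwk in X, Z, A0, A1, T.
    rewrite sat_eqt1, eval_app, eval_cl in X, Z.
    rewrite sat_inst1, sat_is_tree, eval_v0 in T.
    unfold FC in hF; rewrite sat_fsubst, eval_up, !eval_scons in hF.
    cbn [sat] in hF; rewrite sat_has_length, sat_in_tree in hF.
    revert hF; vars; rewrite eval_wk; intros [[L1 L2] nz].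
    rewrite sat_fwk, sat_fsubst, eval_up, !eval_scons, sat_in_tree, eval_restr.
    vars.
    assert (Z' : forall m, eval e z $ m =
      choiceM k (eval e y) (branchM k (eval e y) m)).
    { intro m; rewrite Z; unfold path0; rewrite !eval_lam, eval_choice, eval_branch.
      reflexivity. }
    assert (X' : forall w, eval e x $ w = raceM k (eval e u) (loM w) (sndM w)).
    { intro w; rewrite X; unfold races0; rewrite !eval_lam, eval_race, eval_lo, eval_snd.
      reflexivity. }
    rewrite (restr_path Z').
    apply (branch_in_tree k1 T X') with (c := c); auto.
    * intros i j Yi nz' b; specialize (A0 i j); cbn [sat] in A0.
      revert A0; rewrite eval_first, eval_par, !eval_app, !eval_wk; vars; intro A0.
      apply A0; [exact Yi|apply first_spec; auto].
    * intros i j Yi nz' b; specialize (A1 i j); cbn [sat] in A1.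
      revert A1; rewrite eval_first, eval_par, !eval_app, !eval_wk; vars; intro A1.
      apply A1; [exact Yi|apply first_spec; auto].
Qed.

Local Close Scope num_scope.

Theorem theorem16 : forall n : nat, 2 <= n ->
  iRCA0w
    (And (weihrauch_equiv (WKL n) (WKL 2))
    (And (weihrauch_equiv (WKL 2) (parallelization LLPO))
    (And (weihrauch_equiv (parallelization LLPO) (GC n))
         (weihrauch_equiv (GC n) (GC 2))))).
Proof.
assert (LG : forall k, Nat.le 2 k -> reduces (parallelization LLPO) (GC k)).
{ intros [|[|K]] L; [lia|lia|apply LLPO_le_GC]. }
assert (GW : forall k, Nat.le 2 k -> reduces (GC k) (WKL k)).
{ intros k L; apply GC_le_WKL; lia. }
assert (WL : forall k, Nat.le 2 k -> reduces (WKL k) (parallelization LLPO)).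
{ intros k L; apply WKL_le_LLPO; lia. }
intros n L; assert (L2 := Nat.le_refl 2).
(* The cycles for [n] and for 2 meet at [parallelization LLPO], so each of the eight reductions is a
   composition of at most three. *)
repeat apply AndI; apply reduces_weihrauch_le;
  eauto 6 using reduces_trans.
Qed.
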